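(* Let $n\ge1$, $\lambda\vdash n$, $\rho=[1^{n-2}2^1]$, $r_\lambda=|\lambda|-\ell(\lambda)$, and let $r$ be an integer greater than $r_\lambda$. With $$a^r_\lambda(\alpha)=\sum_{\beta\vdash n}\frac{1}{h_\beta(\alpha)h'_\beta(\alpha)}\,\theta^\beta_\lambda(\alpha)\left(\theta^\beta_{\rho}(\alpha)\right)^r ,$$ the quantity $n!\,\alpha^{\ell(\lambda)}a^r_\lambda(\alpha)$ is a polynomial in $b=\alpha-1$ with non-negative integer coefficients, of degree at most $r-r_\lambda$.
   Context: Partitions: $\lambda\vdash n$ has $\ell(\lambda)$ parts and size $|\lambda|=n$; $[1^{m_1}2^{m_2}\dots]$ denotes the partition with $m_i$ parts equal to $i$. For a box $s$ of the Young diagram of $\lambda$, $a(s)$ and $l(s)$ are the numbers of boxes strictly to the east and strictly to the south of $s$. $h_\lambda(\alpha)=\prod_{s\in\lambda}(\alpha a(s)+l(s)+1)$, $h'_\lambda(\alpha)=\prod_{s\in\lambda}(\alpha(1+a(s))+l(s))$, $z_\lambda=\prod_i i^{m_i(\lambda)}m_i(\lambda)!$. The Jack symmetric functions $J^\alpha_\lambda$ are orthogonal for $\langle p_\lambda,p_\mu\rangle_\alpha=\alpha^{\ell(\lambda)}z_\lambda\delta_{\lambda\mu}$ ($p$ = power sums) and satisfy $J^\alpha_\lambda=h_\lambda(\alpha)m_\lambda+\sum_{\mu<\lambda}u^\alpha_{\lambda\mu}m_\mu$ ($m$ = monomial symmetric functions, $<$ = dominance order). Jack characters $\theta^\lambda_\mu(\alpha)$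 are defined by $J^\alpha_\lambda=\sum_{\mu\vdash n}\theta^\lambda_\mu(\alpha)p_\mu$. *)

(* Defs.v *)
From HB Require Import structures.
From mathcomp Require Import all_boot all_order all_algebra.
From mathcomp Require Import mpoly.

Set Implicit Arguments.
Unset Strict Implicit.
Unset Printing Implicit Defensive.

Import GRing.Theory.
Local Open Scope ring_scope.

Definition is_part (s : seq nat) : bool := sorted geq s && (0%N \notin s).

Record intpartn (n : nat) := IntPartn {
  intpartn_val :> seq nat;
  _ : is_part intpartn_val && (sumn intpartn_val == n)
}.

HB.instance Definition _ n := [isSub for @intpartn_val n].
HB.instance Definition _ n := [Countable of intpartn n by <:].

Lemma part_le_sumn (s : seq nat) k : k \in s -> (k <= sumn s)%N.
Proof.
elim: s => //= x s IH; rewrite inE => /orP[/eqP ->|/IH ks].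
  exact: leq_addr.
exact: leq_trans ks (leq_addl _ _).
Qed.

Lemma size_part_le (s : seq nat) : 0%N \notin s -> (size s <= sumn s)%N.
Proof.
elim: s => //= x s IH; rewrite inE negb_or eq_sym -lt0n => /andP[x0 /IH].
by move=> h; rewrite -add1n leq_add.
Qed.

Definition intpartn_enc n (lam : intpartn n) : n.-bseq 'I_n.+1 :=
  insub_bseq n [seq inord k | k <- lam].

Definition intpartn_dec n (b : n.-bseq 'I_n.+1) : option (intpartn n) :=
  insub [seq val i | i <- b].

Lemma intpartn_encK n : pcancel (@intpartn_enc n) (@intpartn_dec n).
Proof.
move=> lam; have /andP[/andP[_ l0] /eqP ln] := valP lam.
have sz : (size [seq (inord k : 'I_n.+1) | k <- lam] <= n)%N.
  by rewrite size_map -[leqRHS]ln size_part_le.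
rewrite /intpartn_dec /intpartn_enc /insub_bseq insubdK //.
rewrite -map_comp map_id_in ?valK // => k kl /=.
by rewrite inordK // ltnS -[leqRHS]ln part_le_sumn.
Qed.

HB.instance Definition _ n :=
  isFinite.Build (intpartn n) (pcan_enumP (@intpartn_encK n)).

(** A partition of [n] has at most [n] parts, so [k <= n] covers all partial
    sums of the dominance order. *)
Definition dom_lt n (mu lam : intpartn n) : bool :=
  (mu != lam) && [forall k : 'I_n.+1, sumn (take k mu) <= sumn (take k lam)]%N.

(** The box in row [i] and column [j] (both counted from 0) belongs to [lam]
    iff [i < size lam] and [j < nth 0 lam i]. *)
Definition arm (lam : seq nat) (i j : nat) : nat := (nth 0 lam i - j.+1)%N.

Definition leg (lam : seq nat) (i j : nat) : nat :=
  count (fun k => j < k)%N (drop i.+1 lam).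

Definition zpart (lam : seq nat) : nat :=
  (\prod_(1 <= i < (sumn lam).+1) (i ^ count_mem i lam * (count_mem i lam)`!))%N.

Section Hooks.
Variables (F : fieldType) (alpha : F).

Definition hook (lam : seq nat) : F :=
  \prod_(i < size lam) \prod_(j < nth 0%N lam i)
    (alpha * (arm lam i j)%:R + (leg lam i j)%:R + 1).

Definition hook' (lam : seq nat) : F :=
  \prod_(i < size lam) \prod_(j < nth 0%N lam i)
    (alpha * (1 + (arm lam i j)%:R) + (leg lam i j)%:R).

End Hooks.

(** The power sums [p_mu] form a basis of the ring of symmetric functions over
    a field of characteristic 0.  A homogeneous symmetric function
    [f = \sum_mu (f mu) p_mu] of degree [n] is represented by its coordinates
    [f : {ffun intpartn n -> F}] in that basis; [symf_eval N f] is the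
    symmetric polynomial obtained from it in [N] variables. *)

Section SymmetricFunctions.
Variable F : fieldType.

Definition power_sum (N : nat) (mu : seq nat) : {mpoly F[N]} :=
  \prod_(k <- mu) \sum_(i < N) 'X_i ^+ k.

(** Sum of all distinct monomials [x_1^e_1 ... x_N^e_N] whose nonzero exponents
    are the parts of [lam]; it is 0 when [N < size lam]. *)
Definition monomial_sym (N : nat) (lam : seq nat) : {mpoly F[N]} :=
  \sum_(e : 'X_{1..N < (sumn lam).+1} | perm_eq [seq k <- e | k != 0%N] lam)
    'X_[e].

Definition symf_eval (N n : nat) (f : {ffun intpartn n -> F}) : {mpoly F[N]} :=
  \sum_(mu : intpartn n) f mu *: power_sum N mu.

(** The bilinear form with
    [<p_lam, p_mu> = alpha ^ l(lam) * z_lam * delta_(lam, mu)]. *)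
Definition symf_dot (alpha : F) (n : nat) (f g : {ffun intpartn n -> F}) : F :=
  \sum_(mu : intpartn n) alpha ^+ size mu * (zpart mu)%:R * (f mu * g mu).

(** Orthogonality between different degrees holds by definition of the form,
    so only pairs of partitions of the same integer are mentioned.  An identity
    of symmetric functions is an identity in every number [N] of variables, with
    coefficients independent of [N]. *)
Record is_jack (alpha : F)
    (J : forall n : nat, intpartn n -> {ffun intpartn n -> F}) : Prop := IsJack {
  jack_orthogonal : forall n (lam mu : intpartn n),
    lam != mu -> symf_dot alpha (J n lam) (J n mu) = 0;
  jack_triangular : forall n (lam : intpartn n),
    exists u : intpartn n -> F, forall N : nat,
      symf_eval N (J n lam) =
        hook alpha lam *: monomial_sym N lam
        + \sum_(mu : intpartn n | dom_lt mu lam) u mu *: monomial_sym N mu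
}.

(** [jack_char J lam mu] is the coefficient of [p_mu] in [J lam]; it is 0 when
    [mu] is not a partition of the size of [lam]. *)
Definition jack_char (J : forall n : nat, intpartn n -> {ffun intpartn n -> F})
    (n : nat) (lam : intpartn n) (mu : seq nat) : F :=
  oapp (J n lam) 0 (insub mu).

(** [[1^(n-2) 2^1]]. For [n = 1] this list is [[:: 2]], which is not a partition
    of 1, so that the corresponding Jack character vanishes. *)
Definition rho (n : nat) : seq nat := 2%N :: nseq (n - 2) 1%N.

Definition jack_coef (alpha : F)
    (J : forall n : nat, intpartn n -> {ffun intpartn n -> F})
    (n : nat) (lam : intpartn n) (r : nat) : F :=
  \sum_(beta : intpartn n)
    (hook alpha beta * hook' alpha beta)^-1
    * jack_char J beta lam * jack_char J beta (rho n) ^+ r.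

End SymmetricFunctions.

Definition ratfun : fieldType := {fraction {poly rat}}.

(** The Jack parameter is the indeterminate of [Q(alpha)]. *)
Definition alpha : ratfun := tofrac ('X : {poly rat}).

(* Main.v *)
From HB Require Import structures.
Require Import Defs.
From mathcomp Require Import all_boot all_order all_algebra perm.
From mathcomp Require Import ssrcomplements mpoly zify ring.

Set Implicit Arguments.
Unset Strict Implicit.
Unset Printing Implicit Defensive.

Import Order.TTheory GRing.Theory Num.Theory.
Local Open Scope ring_scope.

(* In terms of the power sums, half the Laplace-Beltrami operator, corrected by a
   multiple of the degree, is a self-adjoint operator [D]; in finitely many
   variables it is triangular for the dominance order.  Hence [J_lam] is an
   eigenvector of [D], with the sum [c_lam] of the contents [alpha j - i] as its
   eigenvalue.  As comparable partitions have distinct eigenvalues, [J_lam] is the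
   only eigenvector for [c_lam] whose monomials are dominated by [lam], and so
   removing the first row or column of [lam] yields again a Jack function.

   The identities [[d/dp_1, D] = plower] and [[D, p_1] = alpha praise] show that
   the specialization [p_i |-> t] of [J_lam] is a multiple of the content product
   [\prod (t + alpha j - i)].  The factor is the coefficient of [p_1^n], which is 1
   by removal of the first column in [l(lam)] variables.  Reading off the
   coefficient of [p_1^n] in [D J_lam = c_lam J_lam] gives [theta^lam_rho = c_lam].
   The pairing of [\prod_i (1 - x_i)^M] with [J_lam] is a specialization too, so
   that removing the first row of [lam] gives [<J_lam, J_lam> = h_lam h'_lam].

   Therefore [p_1^n = \sum_beta n! alpha^n J_beta / (h_beta h'_beta)], and
   [n! alpha^n a^r_lam] is the coefficient of [p_lam] in [D^r p_1^n].  On power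
   sums [D] joins two parts (with a factor [alpha]), cuts a part in two, or fixes
   a part (with a factor [alpha - 1]), always with natural multiplicities.  Going
   from [1^n] to [lam] takes [n - l(lam)] more joins than cuts. *)

(** * The Laplace-Beltrami operator in finitely many variables *)

(** [J_lam] vanishes in [N] variables exactly when [lam] has more than [N] rows, and the other Jack
    functions stay independent there. The choice of [N] is therefore a tool: with l(lam) variables
    the first column splits off as [x_1 ... x_N], with one variable less [J_lam] disappears. The
    delicate step is the specialization. Its recursion runs over the [J_mu] occurring in
    [d/dp_1 J_lam], and without a Pieri rule it is unknown whether [mu] is [lam] minus a box. The
    recursion only asks that the content product of [lam] be that of [mu] times [t + c_lam - c_mu].
    If [mu] has fewer rows, the vanishing of [J_lam] in l(lam) - 1 variables fixes [c_lam - c_mu],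
    and genericity with dominance recovers the shape; if the numbers of rows agree, a column is
    removed from both. Integrality hides in the factor one half of [D]: the operator sums over
    ordered pairs of parts, where pairs of distinct sizes occur twice and pairs of equal sizes have
    even multiplicities. *)

Section LinearExtension.
Variables (R : comNzRingType) (n : nat) (V : lmodType R).
Implicit Types (phi : 'X_{1..n} -> V) (g : {mpoly R[n]}).

Definition mlift phi g : V := \sum_(m <- msupp g) g@_m *: phi m.

Lemma mlift_wE phi g k : (msize g <= k)%N ->
  mlift phi g = \sum_(m : 'X_{1..n < k}) g@_m *: phi m.
Proof.
move=> le_gk; pose I : subFinType _ := 'X_{1..n < k}.
rewrite /mlift (big_mksub I) /=; first last.
- by move=> x /msize_mdeg_lt/leq_trans/(_ le_gk).
- exact: msupp_uniq.
by rewrite big_rmcond //= => j /memN_msupp_eq0 ->; rewrite scale0r.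
Qed.

Lemma mlift_is_linear phi : linear (mlift phi).
Proof.
move=> c p q; pose k := maxn (msize (c *: p + q)) (maxn (msize p) (msize q)).
rewrite !(@mlift_wE _ _ k) ?leq_max ?leqnn ?orbT //.
rewrite scaler_sumr -big_split; apply: eq_bigr => m _ /=.
by rewrite mcoeffD mcoeffZ scalerDl scalerA.
Qed.

HB.instance Definition _ phi :=
  GRing.isLinear.Build R {mpoly R[n]} V _ (mlift phi) (mlift_is_linear phi).

Lemma mliftX phi m : mlift phi 'X_[m] = phi m.
Proof. by rewrite /mlift msuppX big_seq1 mcoeffX eqxx scale1r. Qed.

End LinearExtension.

(** Only monomials in the support of [p] are tested, so that homogeneity or degree bounds on [p] can
    be used for them. *)
Lemma mpoly_lin_ext (R : comNzRingType) (n : nat) (V : lmodType R)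
    (f h : {mpoly R[n]} -> V) (p : {mpoly R[n]}) : linear f -> linear h ->
  (forall m, m \in msupp p -> f 'X_[m] = h 'X_[m]) -> f p = h p.
Proof.
have lin0 (k : {mpoly R[n]} -> V) : linear k -> k 0 = 0.
  by move=> lk; have := lk (-1) 0 0; rewrite scaler0 add0r scaleN1r addNr.
move=> lf lh fh; rewrite [p]mpolyE; elim: (msupp p) fh => [|m s IH] fh.
  by rewrite !big_nil !lin0.
rewrite !big_cons lf lh fh ?inE ?eqxx // IH // => m' m's.
by apply: fh; rewrite inE m's orbT.
Qed.

Section DividedDifference.
Variables (F : fieldType) (N : nat).
Implicit Types (m : 'X_{1..N}) (i j : 'I_N) (g u : {mpoly F[N]}).

Definition mnm_put i j (a b : nat) m : 'X_{1..N} :=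
  [multinom if k == i then a else if k == j then b else m k | k < N].

(** The quotient of [x^m - s_ij x^m] by [x_i - x_j], expanded as a geometric sum. Truncated
    subtraction empties at least one of the two sums, so a single formula covers both signs of
    [m i - m j]. The triangularity arguments read the monomials off this form. *)
Definition ddiff_mnm i j m : {mpoly F[N]} :=
  \sum_(t < m i - m j) 'X_[mnm_put i j (m i - t.+1) (m j + t) m]
  - \sum_(t < m j - m i) 'X_[mnm_put i j (m i + t) (m j - t.+1) m].

Definition ddiff i j := mlift (ddiff_mnm i j).

HB.instance Definition _ i j := GRing.Linear.on (ddiff i j).

Lemma mnm_put_mulXi i j a b m : i != j ->
  'X_i * 'X_[mnm_put i j a b m] = 'X_[F, mnm_put i j a.+1 b m].
Proof.
move=> ij; rewrite -mpolyXD; congr 'X_[_]; apply/mnmP => k.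
rewrite mnmDE mnm1E !mnmE eq_sym; case: (k =P i) => //=.
Qed.

Lemma mnm_put_mulXj i j a b m : i != j ->
  'X_j * 'X_[mnm_put i j a b m] = 'X_[F, mnm_put i j a b.+1 m].
Proof.
move=> ij; rewrite -mpolyXD; congr 'X_[_]; apply/mnmP => k.
rewrite mnmDE mnm1E !mnmE eq_sym; case: (k =P i) => [->|_] /=.
  by rewrite (negPf ij).
by case: (k =P j).
Qed.

Lemma mnm_put_id i j m : mnm_put i j (m i) (m j) m = m.
Proof. by apply/mnmP => k; rewrite mnmE; case: eqP => [->|_] //; case: eqP => [->|]. Qed.

Lemma mnm_put_swap i j m : i != j ->
  mnm_put i j (m j) (m i) m = [multinom m ((tperm i j) k) | k < N].
Proof.
move=> ij; apply/mnmP => k; rewrite !mnmE.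
by case: tpermP => [->|->|/eqP/negPf -> /eqP/negPf ->] //; rewrite ?eqxx // eq_sym (negPf ij).
Qed.

Lemma ddiffP i j g : i != j ->
  ('X_i - 'X_j) * ddiff i j g = g - msym (tperm i j) g.
Proof.
move=> ij; elim/mpolyind: g => [|c m g _ _ IH]; first by rewrite msym0 linear0 mulr0 subr0.
rewrite [ddiff _ _ _]linearP /= mulrDr IH msymD msymZ opprD addrACA; congr (_ + _).
rewrite -scalerAr -scalerBr; congr (_ *: _).
rewrite /ddiff mliftX msymX tpermV.
have -> : [multinom m ((tperm i j) k) | k < N] = mnm_put i j (m j) (m i) m.
  by rewrite mnm_put_swap.
rewrite /ddiff_mnm.
(* Multiplied by [x_i - x_j], the geometric sum telescopes. *)
have tele (a : nat) (f : nat -> {mpoly F[N]}) :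
    \sum_(t < a) (f t - f t.+1) = f 0%N - f a.
  elim: a => [|a IHa]; first by rewrite big_ord0 subrr.
  by rewrite big_ord_recr /= IHa addrA subrK.
case: (leqP (m j) (m i)) => h.
  have -> : (m j - m i = 0)%N by lia.
  rewrite big_ord0 subr0 mulr_sumr.
  pose f t := 'X_[F, mnm_put i j (m i - t) (m j + t) m].
  rewrite (eq_bigr (fun t : 'I_(m i - m j) => f t - f t.+1)); last first.
    move=> t _; rewrite mulrBl mnm_put_mulXi // mnm_put_mulXj // /f.
    have lt := ltn_ord t; congr ('X_[mnm_put _ _ _ _ _] - 'X_[mnm_put _ _ _ _ _]); lia.
  rewrite tele /f subn0 addn0 mnm_put_id; congr (_ - 'X_[mnm_put _ _ _ _ _]); lia.
have -> : (m i - m j = 0)%N by lia.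
rewrite big_ord0 sub0r mulrN mulr_sumr.
pose f t := 'X_[F, mnm_put i j (m i + t) (m j - t) m].
rewrite -sumrN (eq_bigr (fun t : 'I_(m j - m i) => f t - f t.+1)); last first.
  move=> t _; rewrite mulrBl mnm_put_mulXi // mnm_put_mulXj // /f opprB.
  have lt := ltn_ord t; congr ('X_[mnm_put _ _ _ _ _] - 'X_[mnm_put _ _ _ _ _]); lia.
rewrite tele /f subn0 addn0 mnm_put_id; congr (_ - 'X_[mnm_put _ _ _ _ _]); lia.
Qed.

Lemma ddiff_symM i j u g : i != j -> u \is symmetric ->
  ddiff i j (u * g) = u * ddiff i j g.
Proof.
move=> ij /issymP us.
have nz : ('X_i - 'X_j : {mpoly F[N]}) != 0.
  apply/eqP => /mpolyP /(_ U_(i)%MM); rewrite mcoeffB !mcoeffXU mcoeff0 eqxx.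
  by rewrite eq_sym (negPf ij) subr0 => /eqP; rewrite oner_eq0.
apply: (mulfI nz); rewrite ddiffP // mulrCA ddiffP // msymM us.
by rewrite mulrBr.
Qed.

End DividedDifference.

Section Excess.
Variable N : nat.
Implicit Types (m : 'X_{1..N}) (i j : 'I_N).

(* All the sums [\sum_i max (m_i - x, 0)] together determine the dominance order
   without requiring the exponents to be sorted. *)
Definition excess (x : nat) m : nat := (\sum_(i < N) (m i - x))%N.
Definition sqsum m : nat := (\sum_(i < N) (m i) ^ 2)%N.

Lemma sum_mnm_put (f : nat -> nat) i j a b m : i != j ->
  (\sum_(k < N) f (mnm_put i j a b m k) + (f (m i) + f (m j))
   = \sum_(k < N) f (m k) + (f a + f b))%N.
Proof.
move=> ij; rewrite (bigD1 i) // (bigD1 j) 1?eq_sym //=.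
rewrite [in RHS](bigD1 i) // [in RHS](bigD1 j) 1?eq_sym //=.
rewrite !mnmE !eqxx eq_sym (negPf ij).
have -> : (\sum_(k < N | (k != i) && (k != j)) f (mnm_put i j a b m k)
          = \sum_(k < N | (k != i) && (k != j)) f (m k))%N.
  by apply: eq_bigr => k /andP[/negPf ki /negPf kj]; rewrite mnmE ki kj.
by move: (\sum_(k < N | _) _)%N (f _) (f _) (f _) (f _) => X y1 y2 y3 y4; lia.
Qed.

Lemma excess0 m : excess 0 m = mdeg m.
Proof. by rewrite /excess mdegE; apply: eq_bigr => i _; rewrite subn0. Qed.

(** [y ^ 2 + y] is twice [\sum_(x < y) (y - x)]. In a fixed degree the sum of squares is therefore
    monotone for the dominance order. *)
Lemma sqsumE m B : (forall i, m i <= B)%N ->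
  (sqsum m + mdeg m = \sum_(x < B) 2 * excess x m)%N.
Proof.
move=> mB; rewrite /sqsum mdegE -big_split -big_distrr /= exchange_big big_distrr /=.
apply: eq_bigr => i _; have := mB i; move: (m i) => a {mB}.
move=> aB.
have -> : (\sum_(x < B) (a - x) = \sum_(x < a) (a - x))%N.
  rewrite -!(big_mkord xpredT (fun x => a - x)%N) (@big_cat_nat _ _ _ a 0 B) //=.
  have -> : (\sum_(a <= x < B) (a - x) = 0)%N by rewrite big_nat big1 // => x; lia.
  by rewrite addn0.
elim: a {aB} => [|a IH]; first by rewrite big_ord0.
rewrite big_ord_recl subn0 /=.
rewrite (eq_bigr (fun x : 'I_a => a - x)%N) //.
by rewrite mulnDr -IH; lia.
Qed.

End Excess.

Lemma sumX_neq0 (F : fieldType) N p (f : 'I_p -> 'X_{1..N}) m :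
  (\sum_t 'X_[F, f t])@_m != 0 -> exists t, m = f t.
Proof.
case: (pickP (fun t => f t == m)) => [t /eqP <-|h]; first by exists t.
by rewrite raddf_sum big1 ?eqxx // => t _; rewrite /= mcoeffX h.
Qed.

Section Laplacian.
Variables (F : fieldType) (N : nat) (a : F).
Implicit Types (m : 'X_{1..N}) (i j : 'I_N) (g u : {mpoly F[N]}).

(* The Laplace-Beltrami operator: for a symmetric [g] the divided differences are
   [(x_i^2 d_i g - x_j^2 d_j g) / (x_i - x_j)]. *)
Definition laplN g : {mpoly F[N]} :=
  a *: (\sum_i 'X_i ^+ 2 * g^`M(i)^`M(i))
  + 2%:R *: \sum_(i < N) \sum_(j < N | (i < j)%N) ddiff i j ('X_i ^+ 2 * g^`M(i)).

Lemma laplN_is_linear : linear laplN.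
Proof.
move=> c p q; rewrite /laplN scalerDr addrACA; congr (_ + _).
  rewrite scalerA [c * a]mulrC -scalerA -scalerDr; congr (_ *: _); rewrite scaler_sumr -big_split.
  by apply: eq_bigr => i _ /=; rewrite !linearP /= mulrDr scalerAr.
rewrite scalerA [c * _]mulrC -scalerA -scalerDr; congr (_ *: _); rewrite scaler_sumr -big_split.
apply: eq_bigr => i _ /=; rewrite scaler_sumr -big_split; apply: eq_bigr => j _.
by rewrite [(_ + _)^`M(_)]linearP /= mulrDr -scalerAr [ddiff _ _ _]linearP.
Qed.

HB.instance Definition _ :=
  GRing.isLinear.Build F {mpoly F[N]} {mpoly F[N]} _ laplN laplN_is_linear.

Lemma mulX_mderivX i m : 'X_i * 'X_[m]^`M(i) = (m i)%:R *: 'X_[F, m].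
Proof.
rewrite mderivX -scalerAr -mpolyXD; case: (posnP (m i)) => [->|mi].
  by rewrite !scale0r.
by rewrite addmC submK // lep1mP -lt0n.
Qed.

Lemma mulX2_mderivX i m :
  'X_i ^+ 2 * 'X_[m]^`M(i) = (m i)%:R *: 'X_[F, m + U_(i)].
Proof. by rewrite expr2 -mulrA mulX_mderivX -scalerAr addmC mpolyXD. Qed.

Lemma mulX2_mderiv2X i m :
  'X_i ^+ 2 * 'X_[m]^`M(i)^`M(i) = (m i * (m i).-1)%:R *: 'X_[F, m].
Proof.
rewrite mderivX mderivZ -scalerAr expr2 -mulrA mulX_mderivX -scalerAr.
rewrite -mpolyXD mnmBE mnm1E eqxx subn1 scalerA -natrM.
case: (posnP (m i)) => [->|mi]; first by rewrite mul0n !scale0r.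
by rewrite addmC submK // lep1mP -lt0n.
Qed.

Lemma laplNX m : laplN 'X_[m] =
  (a * (\sum_i m i * (m i).-1)%:R) *: 'X_[m]
  + 2%:R *: \sum_(i < N) \sum_(j < N | (i < j)%N) (m i)%:R *: ddiff_mnm F i j (m + U_(i)).
Proof.
rewrite /laplN; congr (_ + _ *: _).
  rewrite -scalerA natr_sum scaler_suml; congr (_ *: _).
  by apply: eq_bigr => i _; rewrite mulX2_mderiv2X.
apply: eq_bigr => i _; apply: eq_bigr => j _.
by rewrite mulX2_mderivX linearZ /= /ddiff mliftX.
Qed.

Lemma ddiff_mnmU i j m : i != j -> ddiff_mnm F i j (m + U_(i)) =
  \sum_(t < (m i).+1 - m j) 'X_[mnm_put i j (m i - t) (m j + t) m]
  - \sum_(t < m j - (m i).+1) 'X_[mnm_put i j (m i + t.+1) (m j - t.+1) m].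
Proof.
move=> ij; rewrite /ddiff_mnm !mnmDE !mnm1E eqxx (negPf ij) !addn0 addn1.
have putU p q : mnm_put i j p q (m + U_(i)) = mnm_put i j p q m.
  apply/mnmP => k; rewrite !mnmE.
  by case: (eqVneq k i) => // _; rewrite addn0.
congr (_ - _); apply: eq_bigr => t _; rewrite putU; congr 'X_[mnm_put _ _ _ _ _]; lia.
Qed.

(* The exponents of [x_i] and [x_j] only get closer to each other, whence the
   triangularity of [laplN] for the dominance order. *)
Lemma supp_ddiff_mnmU i j m m' : i != j ->
  (ddiff_mnm F i j (m + U_(i)))@_m' != 0 ->
  exists p q, [/\ m' = mnm_put i j p q m, (p + q = m i + m j)%N
    & [\/ p = m i, p = m j /\ (m j < m i)%N
        | (p < maxn (m i) (m j))%N /\ (q < maxn (m i) (m j))%N]].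
Proof.
move=> ij; rewrite ddiff_mnmU // mcoeffB.
case: (leqP (m j) (m i)) => h.
  have -> : (m j - (m i).+1 = 0)%N by lia.
  rewrite big_ord0 mcoeff0 subr0 => /sumX_neq0[t ->].
  have lt := ltn_ord t; exists (m i - t)%N, (m j + t)%N; split=> //; first lia.
  case: (posnP t) => [->|t0]; first by apply: Or31; rewrite subn0.
  case: (ltnP t (m i - m j)) => h'; last by apply: Or32; lia.
  by apply: Or33; lia.
have -> : ((m i).+1 - m j = 0)%N by lia.
rewrite big_ord0 mcoeff0 sub0r oppr_eq0 => /sumX_neq0[t ->].
have lt := ltn_ord t.
exists (m i + t.+1)%N, (m j - t.+1)%N; split=> //; first lia.
by apply: Or33; lia.
Qed.

Lemma supp_laplN g m' : (laplN g)@_m' != 0 ->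
  exists2 m, m \in msupp g & m' = m \/ exists i j p q,
   [/\ (i < j)%N, m' = mnm_put i j p q m, (p + q = m i + m j)%N
    & [\/ p = m i, p = m j /\ (m j < m i)%N
        | (p < maxn (m i) (m j))%N /\ (q < maxn (m i) (m j))%N]].
Proof.
rewrite {1}[g]mpolyE linear_sum raddf_sum /= => nz.
have /hasP[m mg] : has (fun m => (laplN (g@_m *: 'X_[m]))@_m' != 0) (msupp g).
  apply/hasPn => h; move/eqP: nz; apply; rewrite big_seq big1 // => m /h.
  by rewrite negbK => /eqP.
rewrite linearZ mcoeffZ mulf_eq0 negb_or => /andP[_ nz1]; exists m => //.
case: (eqVneq m' m) => [->|ne]; [by left | right].
move: nz1; rewrite /= laplNX mcoeffD !mcoeffZ mcoeffX [m == m']eq_sym (negPf ne) mulr0 add0r.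
rewrite mulf_eq0 negb_or => /andP[_]; rewrite raddf_sum /=.
case: (pickP (fun p : 'I_N * 'I_N => (p.1 < p.2)%N &&
     ((ddiff_mnm F p.1 p.2 (m + U_(p.1)))@_m' != 0))) => [[i j] /= /andP[ij h] _|h].
  have ij' : i != j by rewrite -val_eqE /= ltn_eqF.
  case: (supp_ddiff_mnmU ij' h) => p [q [h1 h2 h3]].
  by exists i, j, p, q.
rewrite big1 ?eqxx // => i _; rewrite raddf_sum big1 // => j ij /=.
by rewrite mcoeffZ; have := h (i, j); rewrite /= ij /= => /negbFE/eqP ->; rewrite mulr0.
Qed.

(** [y |-> max(y - x, 0)] is convex: moving two exponents towards each other with their sum fixed,
    or swapping them, cannot increase the excess. *)
Lemma laplN_excess g x B :
  (forall m, m \in msupp g -> excess x m <= B)%N ->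
  forall m, m \in msupp (laplN g) -> (excess x m <= B)%N.
Proof.
move=> gB m'; rewrite mcoeff_msupp => /supp_laplN[m /gB mB [-> //|]].
case=> i [j [p [q [ij -> pq h]]]]; apply: leq_trans mB.
have ij' : i != j by rewrite -val_eqE /= ltn_eqF.
have := sum_mnm_put (fun y => y - x)%N p q m ij'; rewrite -!/(excess _ _).
by case: h => [h|[h h']|[h h']]; lia.
Qed.

(** Any other monomial that contributes at [m] does so by bringing two exponents closer, and then
    has a larger [sqsum], or by swapping two exponents, and then [m] is not sorted. Both are
    excluded, so only the diagonal entry remains. *)
Lemma mcoeff_laplN_extremal g m :
  (forall i j, (i < j)%N -> (m j <= m i)%N) ->
  (forall m', m' \in msupp g -> (sqsum m' <= sqsum m)%N) ->
  (laplN g)@_m =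
    (a * (\sum_i m i * (m i).-1)%:R + 2%:R * (\sum_(i < N) \sum_(j < N | (i < j)%N) m i)%:R) * g@_m.
Proof.
move=> sm mmax.
have diag : (laplN 'X_[m])@_m =
    a * (\sum_i m i * (m i).-1)%:R + 2%:R * (\sum_(i < N) \sum_(j < N | (i < j)%N) m i)%:R.
  rewrite laplNX mcoeffD !mcoeffZ mcoeffX eqxx mulr1; congr (_ + _ * _).
  rewrite natr_sum raddf_sum; apply: eq_bigr => i _; rewrite natr_sum raddf_sum.
  apply: eq_bigr => j ij; rewrite /= mcoeffZ.
  have ij' : i != j by rewrite -val_eqE /= ltn_eqF.
  rewrite ddiff_mnmU // mcoeffB subSn ?sm // big_ord_recl subn0 addn0 mnm_put_id.
  rewrite mcoeffD mcoeffX eqxx raddf_sum big1 => [|t _].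
    have -> : (m j - (m i).+1 = 0)%N by have := sm _ _ ij; lia.
    by rewrite big_ord0 mcoeff0 subr0 addr0 mulr1.
  rewrite /= mcoeffX; case: eqP => // /mnmP /(_ i); rewrite !mnmE eqxx /=.
  have := ltn_ord t; rewrite /bump /=; lia.
rewrite -diag {1}[g]mpolyE linear_sum raddf_sum /=.
have off m' : m' \in msupp g -> m' != m -> (laplN (g@_m' *: 'X_[m']))@_m = 0.
  move=> m'g ne; rewrite linearZ mcoeffZ; apply/eqP; rewrite mulf_eq0; apply/orP; right.
  apply: contraT => /supp_laplN[m1]; rewrite msuppX inE => /eqP -> [e|].
    by rewrite e eqxx in ne.
  case=> i [j [p [q [ij e pq h]]]].
  have ij' : i != j by rewrite -val_eqE /= ltn_eqF.
  have := mmax _ m'g; have := sum_mnm_put (fun y => y ^ 2)%N p q m' ij'.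
  rewrite -!/(sqsum _) -e => eQ leQ; case: h => [h|[h h']|[h h']].
  - have hq : q = m' j by lia.
    by rewrite h hq mnm_put_id in e; rewrite e eqxx in ne.
  - have := sm _ _ ij; rewrite e !mnmE !eqxx eq_sym (negPf ij'); lia.
  - exfalso; move: (m' i) (m' j) pq h h' eQ => x y pq h h' eQ.
    have : (p ^ 2 + q ^ 2 < x ^ 2 + y ^ 2)%N; last lia.
    case: (leqP y x) h h' => _ h h'; nia.
have [mg|mg] := boolP (m \in msupp g); last first.
  rewrite (memN_msupp_eq0 mg) mulr0 big_seq big1 // => m' m'g.
  by apply: off => //; apply: contraNneq mg => <-.
rewrite (bigD1_seq m) ?msupp_uniq //= big_seq_cond big1 ?addr0.
  by rewrite linearZ mcoeffZ mulrC.
by move=> m' /andP[m'g ne]; apply: off.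
Qed.

End Laplacian.

(** * Dominance order *)

Section PartitionStatistics.
Implicit Types (s l : seq nat) (a b : nat -> nat).

Definition psum a k : nat := (\sum_(i < k) a i)%N.
Definition excess_seq x s : nat := (\sum_(k <- s) (k - x))%N.
(** Usually written n(lambda); for a partition it is also the sum of the leg lengths. *)
Definition nstat s : nat := (\sum_(i < size s) i * nth 0 s i)%N.

Lemma sum_nth_pad (f : nat -> nat) s N : f 0%N = 0%N -> (size s <= N)%N ->
  (\sum_(i < N) f (nth 0 s i) = \sum_(k <- s) f k)%N.
Proof.
move=> f0 sN; rewrite (big_nth 0%N) -(big_mkord xpredT (fun i => f (nth 0%N s i))).
rewrite (@big_cat_nat _ _ _ (size s)) //= [X in (_ + X)%N]big_nat.
rewrite [X in (_ + X)%N]big1 ?addn0 // => i /andP[si _].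
by rewrite nth_default.
Qed.

Lemma nstat_pad s N : (size s <= N)%N -> nstat s = (\sum_(i < N) i * nth 0 s i)%N.
Proof.
move=> sN; rewrite /nstat -!(big_mkord xpredT (fun i => i * nth 0 s i)%N).
rewrite [RHS](@big_cat_nat _ _ _ (size s)) //= [X in (_ = _ + X)%N]big_nat.
rewrite [X in (_ = _ + X)%N]big1 ?addn0 // => i /andP[si _].
by rewrite nth_default ?muln0.
Qed.

Lemma sorted_nth s i j : sorted geq s -> (i <= j)%N -> (nth 0 s j <= nth 0 s i)%N.
Proof.
move=> ss ij; case: (ltnP j (size s)) => js; last by rewrite nth_default.
apply: (sorted_leq_nth (leT := geq)) => //.
- by move=> y x z /= yx zy; apply: leq_trans yx.
- exact: leqnn.
- exact: leq_ltn_trans js.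
Qed.

Lemma psum_excess a k N x : (k <= N)%N ->
  (psum a k <= k * x + \sum_(i < N) (a i - x))%N.
Proof.
move=> kN; rewrite -(big_mkord xpredT (fun i => a i - x)%N) (@big_cat_nat _ _ _ k) //=.
rewrite big_mkord addnA; apply: leq_trans (leq_addr _ _).
rewrite -[X in (X * x)%N]card_ord -sum_nat_const -big_split /=.
by apply: leq_sum => i _; lia.
Qed.

(** The bound of [psum_excess] is attained at the threshold [nth 0 l k]: the parts before index [k]
    are at least that large, the others contribute nothing. *)
Lemma excess_psum l k N : sorted geq l -> (size l <= N)%N -> (k <= N)%N ->
  (k * nth 0 l k + excess_seq (nth 0 l k) l = psum (nth 0 l) k)%N.
Proof.
move=> sl lN kN; rewrite /excess_seq -(@sum_nth_pad (fun y => y - nth 0 l k)%N _ N) //.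
rewrite -(big_mkord xpredT (fun i => nth 0 l i - nth 0 l k)%N) (@big_cat_nat _ _ _ k) //=.
rewrite [X in (_ + (_ + X))%N]big_nat [X in (_ + (_ + X))%N]big1; last first.
  by move=> i /andP[ki _]; apply/eqP; rewrite subn_eq0 sorted_nth.
rewrite addn0 big_mkord -[X in (X * _)%N]card_ord -sum_nat_const -big_split /=.
by apply: eq_bigr => i _; rewrite subnKC // sorted_nth // ltnW.
Qed.

(** The threshold is the part of [l] at index [k], where the bound is an equality for [l]. As [a]
    may be unsorted, this compares exponent vectors with partitions. *)
Lemma psum_le_of_excess a l N : sorted geq l ->
  (forall x, (\sum_(i < N) (a i - x) <= excess_seq x l)%N) ->
  forall k, (k <= N)%N -> (psum a k <= psum (nth 0 l) k)%N.
Proof.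
move=> sl H k kN; rewrite -(@excess_psum l k (maxn N (size l))) ?leq_maxr ?leq_max ?kN //.
apply: leq_trans (psum_excess a (nth 0 l k) kN) _.
by rewrite leq_add2l.
Qed.

(** Here the threshold is given and the index is chosen: [k] counts the parts of [mu] above [x],
    which makes the bound an equality for [mu], while it still holds for [l]. *)
Lemma excess_le_of_psum mu l : sorted geq mu -> sorted geq l ->
  (forall k, (k <= size mu)%N -> (psum (nth 0 mu) k <= psum (nth 0 l) k)%N) ->
  forall x, (excess_seq x mu <= excess_seq x l)%N.
Proof.
move=> smu sl H x; pose k := count (fun y => x < y)%N mu.
have km : (k <= size mu)%N by apply: count_size.
have big i : (i < k)%N -> (x < nth 0 mu i)%N.
  move=> ik; rewrite ltnNge; apply/negP => h.
  suff : (k <= i)%N by rewrite leqNgt ik.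
  rewrite /k -[mu](cat_take_drop i) count_cat.
  have -> : count (fun y => x < y)%N (drop i mu) = 0%N.
    apply/eqP; rewrite -leqn0 leqNgt -has_count; apply/hasPn => y /(nthP 0%N)[j jd <-].
    by rewrite nth_drop -leqNgt; apply: leq_trans h; rewrite sorted_nth // leq_addr.
  rewrite addn0; apply: leq_trans (count_size _ _) _.
  by rewrite size_take_min geq_minl.
have small i : (k <= i)%N -> (nth 0 mu i <= x)%N.
  move=> ki; rewrite leqNgt; apply/negP => h.
  have im : (i < size mu)%N by rewrite ltnNge; apply/negP => /(nth_default 0%N) e; rewrite e in h.
  suff : (i < k)%N by rewrite ltnNge ki.
  rewrite /k -[mu](cat_take_drop i.+1) count_cat.
  have -> : count (fun y => x < y)%N (take i.+1 mu) = i.+1.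
    rewrite (_ : count _ _ = size (take i.+1 mu)); last first.
      apply/eqP; rewrite -all_count; apply/(all_nthP 0%N) => j.
      rewrite size_takel // => ji; rewrite nth_take //.
      by apply: leq_trans h _; rewrite sorted_nth.
    by rewrite size_takel.
  by rewrite addSn ltnS leq_addr.
have -> : excess_seq x mu = (psum (nth 0 mu) k - k * x)%N.
  rewrite /excess_seq -(@sum_nth_pad (fun y => y - x)%N _ (size mu)) //.
  rewrite -(big_mkord xpredT (fun i => nth 0 mu i - x)%N) (@big_cat_nat _ _ _ k) //=.
  rewrite [X in (_ + X)%N]big_nat [X in (_ + X)%N]big1; last first.
    by move=> i /andP[ki _]; apply/eqP; rewrite subn_eq0 small.
  rewrite addn0 big_mkord -[X in (X * _)%N]card_ord -sum_nat_const.
  apply/esym/eqP; rewrite -(eqn_add2r (\sum_(i < k) x)%N) subnK.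
    rewrite -big_split /=; apply/eqP/eq_bigr => i _; rewrite subnK // ltnW //; exact: big.
  by apply: leq_sum => i _; rewrite ltnW //; apply: big.
rewrite leq_subLR; apply: leq_trans (H _ km) _.
rewrite /excess_seq -(@sum_nth_pad (fun y => y - x)%N _ (maxn k (size l))) ?leq_maxr //.
by apply: psum_excess; rewrite leq_maxl.
Qed.

Lemma sum_psum a N : (\sum_(k < N.+1) psum a k = \sum_(i < N) (N - i) * a i)%N.
Proof.
elim: N => [|N IH]; first by rewrite big_ord_recr !big_ord0 /psum big_ord0.
rewrite big_ord_recr IH /= [psum _ _]big_ord_recr [RHS]big_ord_recr /= subSnn mul1n addnA; congr (_ + _)%N.
rewrite -big_split; apply: eq_bigr => i _ /=.
by rewrite subSn 1?ltnW // mulSn addnC.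
Qed.

(* [\sum_i (N - i) a_i] is the sum of all partial sums. *)
Lemma psum_rigid a b N : (forall k, (k <= N)%N -> (psum a k <= psum b k)%N) ->
  (\sum_(i < N) (N - i) * b i <= \sum_(i < N) (N - i) * a i)%N ->
  forall i, (i < N)%N -> a i = b i.
Proof.
move=> le_ab; rewrite -!sum_psum => le_ba.
have le_ab' (k : 'I_N.+1) : xpredT k -> (psum a k <= psum b k ?= iff (psum a k == psum b k))%N.
  by move=> _; split=> //; apply: le_ab; rewrite -ltnS.
have /leqifP := leqif_sum le_ab'.
case: ifP => [/forallP eqs _|_]; last by rewrite ltnNge le_ba.
have eqk k : (k <= N)%N -> psum a k = psum b k.
  by move=> kN; have /= /eqP := eqs (Ordinal (kN : (k < N.+1)%N)).
move=> i iN; have := eqk _ iN; rewrite /psum !big_ord_recr /= -/(psum a i) -/(psum b i).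
by rewrite (eqk _ (ltnW iN)) => /addnI.
Qed.

Lemma nstat_weighted a N : (\sum_(i < N) (N - i) * a i + \sum_(i < N) i * a i
  = N * \sum_(i < N) a i)%N.
Proof.
rewrite -big_split big_distrr /=; apply: eq_bigr => i _.
by rewrite -mulnDl subnK // ltnW.
Qed.

End PartitionStatistics.

Section PartitionMonomials.
Variable N : nat.
Implicit Types (m : 'X_{1..N}) (s l : seq nat).

Definition mpart s : 'X_{1..N} := [multinom nth 0 s i | i < N].

Lemma excess_mpart x s : (size s <= N)%N -> excess x (mpart s) = excess_seq x s.
Proof.
move=> sN; rewrite /excess_seq -(@sum_nth_pad (fun y => y - x)%N _ N) //.
by apply: eq_bigr => i _; rewrite mnmE.
Qed.

Lemma mdeg_mpart s : (size s <= N)%N -> mdeg (mpart s) = sumn s.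
Proof.
by move=> sN; rewrite -excess0 excess_mpart // sumnE; apply: eq_bigr => i _; rewrite subn0.
Qed.

Lemma sqsum_mperm m (p : 'S_N) : sqsum [multinom m (p i) | i < N] = sqsum m.
Proof.
rewrite /sqsum [RHS](reindex_inj (@perm_inj _ p)).
by apply: eq_bigr => i _; rewrite mnmE.
Qed.

Lemma mnm_sort m : exists p : 'S_N,
  forall i j : 'I_N, (i < j)%N -> (m (p j) <= m (p i))%N.
Proof.
have sz : size (sort geq m) == N by rewrite size_sort size_tuple.
have /tuple_permP[p e] : perm_eq (Tuple sz) (multinom_val m) by rewrite perm_sort.
exists p => i j ij.
have E (k : 'I_N) : m (p k) = nth 0%N (sort geq m) k.
  rewrite -[sort geq m]/(tval (Tuple sz)) e -tnth_nth tnth_mktuple.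
  by rewrite mnm_tnth.
rewrite !E; apply: sorted_nth; last exact: ltnW.
by apply: sort_sorted => x y; rewrite /= leq_total.
Qed.

Lemma sqsum_le_of_excess m m' : mdeg m = mdeg m' ->
  (forall x, (excess x m <= excess x m')%N) -> (sqsum m <= sqsum m')%N.
Proof.
move=> dm le; have hB (k : 'X_{1..N}) i : (k i <= mdeg k)%N.
  by rewrite mdegE (bigD1 i) //= leq_addr.
rewrite -(leq_add2r (mdeg m)) (sqsumE (hB m)).
have hB' i : (m' i <= mdeg m)%N by rewrite dm hB.
rewrite [X in (_ <= _ + X)%N]dm (sqsumE hB').
by apply: leq_sum => x _; rewrite leq_mul2l le orbT.
Qed.

Lemma sum_ord_gt (f : 'I_N -> nat) :
  (\sum_(i < N) \sum_(j < N | (i < j)%N) f i + \sum_(i < N) i * f i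
   = N.-1 * \sum_(i < N) f i)%N.
Proof.
rewrite -big_split big_distrr; apply: eq_bigr => i _ /=.
rewrite sum_nat_const -mulnDl; congr (_ * _)%N.
have iN := ltn_ord i; have -> : #|[pred j : 'I_N | (i < j)%N]| = (N - i.+1)%N.
  rewrite -sum1_card (eq_bigl (fun j : 'I_N => i < j)%N) //.
  rewrite -(big_mkord (fun j => i < j)%N (fun=> 1%N)) (@big_cat_nat _ _ _ i.+1) //=.
  rewrite big_nat_cond big1 => [|j]; last by lia.
  rewrite add0n big_nat_cond (eq_bigl (fun j => (i.+1 <= j < N)%N)) => [|j]; last by lia.
  by rewrite -big_nat sum_nat_const_nat muln1.
by lia.
Qed.

End PartitionMonomials.

(* [a] behaves like an indeterminate over the integers. *)
Definition generic (F : fieldType) (a : F) : Prop :=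
  forall A B A' B' : nat,
    a * A%:R + B%:R = a * A'%:R + B'%:R -> A = A' /\ B = B'.

(* Twice the sum over the boxes of [s] of the contents [a j - i]. *)
Definition content2 (F : fieldType) (a : F) (s : seq nat) : F :=
  a * (\sum_(k <- s) k * k.-1)%:R - 2%:R * (nstat s)%:R.

Lemma seq_argmax (T : eqType) (f : T -> nat) (s : seq T) : s != [::] ->
  exists2 x, x \in s & forall y, y \in s -> (f y <= f x)%N.
Proof.
elim: s => // x s IH _; case: (eqVneq s [::]) => [->|/IH [y ys my]].
  by exists x; rewrite ?inE // => y; rewrite inE => /eqP ->.
case: (leqP (f x) (f y)) => h.
  exists y; first by rewrite inE ys orbT.
  by move=> z; rewrite inE => /orP[/eqP ->|/my].
exists x; first by rewrite inE eqxx.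
move=> z; rewrite inE => /orP[/eqP -> //|/my]; move/leq_trans; apply; exact: ltnW.
Qed.

(** * Uniqueness of eigenvectors *)

Section Uniqueness.
Variables (F : fieldType) (a : F) (N : nat).
Hypothesis gen_a : generic a.
Implicit Types (g : {mpoly F[N]}) (l : seq nat).

(** Twice the content sum, plus a shift depending only on [N] and the degree. It comes from
    [sum_ord_gt]: row [i] is followed by [N - 1 - i] rows, so the divided differences contribute
    [2 (N - 1) |l| - 2 nstat l]. *)
Definition eigenN l : F := content2 a l + 2%:R * (N%:R - 1) * (sumn l)%:R.

Lemma pred_mul_nat d : (N = 0 -> d = 0)%N -> (N.-1 * d)%:R = (N%:R - 1) * d%:R :> F.
Proof.
case: N => [->//|n _]; first by rewrite muln0 mulr0.
by rewrite natrM -natr1 addrK.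
Qed.

Lemma extremal_coef_mpart l : (size l <= N)%N ->
  a * (\sum_(i < N) mpart N l i * (mpart N l i).-1)%:R
  + 2%:R * (\sum_(i < N) \sum_(j < N | (i < j)%N) mpart N l i)%:R = eigenN l.
Proof.
move=> lN; have := sum_ord_gt (mpart N l).
have -> : (\sum_(i < N) mpart N l i = sumn l)%N by rewrite -mdegE mdeg_mpart.
have -> : (\sum_(i < N) i * mpart N l i = nstat l)%N.
  by rewrite (nstat_pad lN); apply: eq_bigr => i _; rewrite mnmE.
have -> : (\sum_(i < N) mpart N l i * (mpart N l i).-1 = \sum_(k <- l) k * k.-1)%N.
  rewrite -(@sum_nth_pad (fun k => k * k.-1)%N _ N) //.
  by apply: eq_bigr => i _; rewrite mnmE.
move=> /(congr1 (GRing.natmul (1 : F))); rewrite natrD pred_mul_nat => [e|N0].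
  by rewrite /eigenN /content2 -mulrA -e; ring.
by case: l lN => // x s; rewrite N0.
Qed.

(** A non-zero symmetric [g] has a monomial [m] of maximal [sqsum] with sorted exponents, whose
    coefficient [laplN] multiplies by the diagonal entry at [m]. That entry must equal the one at
    [l]; genericity gives equal [nstat], and since [l] dominates [m] the two coincide, contrary to
    the last hypothesis. With fewer than [size l] variables no monomial can be dominated by [l],
    whence the guard there. *)
Lemma laplN_uniq g l : sorted geq l -> 0%N \notin l -> g \is symmetric ->
  g \is (sumn l).-homog ->
  (forall m x, m \in msupp g -> (excess x m <= excess_seq x l)%N) ->
  laplN a g = eigenN l *: g ->
  ((size l <= N)%N -> g@_(mpart N l) = 0) -> g = 0.
Proof.
move=> sl l0 gsym /dhomogP ghom gdom geig glead.
apply/eqP; apply: contraT; rewrite -msupp_eq0 => /(@seq_argmax _ (@sqsum N)).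
case=> m0 m0g m0max; have [p sp] := mnm_sort m0.
pose m : 'X_{1..N} := [multinom m0 (p i) | i < N].
have mg : m \in msupp g by rewrite /m (issym_msupp _ _ gsym).
have sm (i j : 'I_N) : (i < j)%N -> (m j <= m i)%N by move=> ij; rewrite !mnmE sp.
have mmax m' : m' \in msupp g -> (sqsum m' <= sqsum m)%N.
  by move=> m'g; rewrite sqsum_mperm m0max.
have md := ghom _ mg; rewrite /= in md.
have me x : (\sum_(i < N) (nth 0 m i - x) <= excess_seq x l)%N.
  rewrite -/(excess x m); apply: leq_trans (gdom _ x mg).
  by rewrite /excess; apply: eq_leq; apply: eq_bigr => i _; rewrite (mnm_nth 0).
have mp := psum_le_of_excess sl me.
have summ : (\sum_(i < N) nth 0 m i = sumn l)%N.
  by rewrite -md mdegE; apply: eq_bigr => i _; rewrite (mnm_nth 0).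
have lN : (size l <= N)%N.
  rewrite leqNgt; apply/negP => lN.
  have := mp N (leqnn N); rewrite {1}/psum summ leqNgt => /negP; apply.
  rewrite sumnE -(@sum_nth_pad id _ (size l)) // -(big_mkord xpredT (nth 0%N l)).
  rewrite (@big_cat_nat _ _ _ N) //=; last exact: ltnW.
  rewrite big_mkord -/(psum (nth 0%N l) N) -addn1 leq_add2l big_ltn //.
  apply: leq_trans (leq_addr _ _).
  by rewrite lt0n; apply: contraNneq l0 => <-; rewrite mem_nth.
have gm0 : g@_m != 0 by rewrite -mcoeff_msupp.
have := mcoeff_laplN_extremal a sm mmax; rewrite geig mcoeffZ => /(mulIf gm0).
have := sum_ord_gt m; rewrite -mdegE md => /(congr1 (GRing.natmul (1 : F))).
rewrite natrD pred_mul_nat; last by move=> N0; case: l lN {l0 sl ghom gdom geig glead md me mp summ} => // x s; rewrite N0.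
rewrite /eigenN -mulrA => <- e.
(* [generic] compares sums with natural coefficients, so the two negative [nstat] terms change sides
   first. *)
have /gen_a[_ e2] : a * (\sum_(k <- l) k * k.-1)%:R + (2 * \sum_(i < N) i * m i)%:R
    = a * (\sum_i m i * (m i).-1)%:R + (2 * nstat l)%:R.
  rewrite !natrM; apply: (addIr (2%:R * (\sum_(i < N) \sum_(j < N | (i < j)%N) m i)%:R
    - 2%:R * (nstat l)%:R)).
  rewrite [RHS]addrACA -e /content2; ring.
have eqn : (\sum_(i < N) i * nth 0 m i = nstat l)%N.
  apply/eqP; rewrite -(eqn_pmul2l (isT : 0 < 2)%N) -e2; apply/eqP; congr (_ * _)%N.
  by apply: eq_bigr => i _; rewrite (mnm_nth 0).
have : forall i, (i < N)%N -> nth 0%N m i = nth 0%N l i.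
  apply: psum_rigid mp _; rewrite -(leq_add2r (nstat l)) -{2}eqn.
  rewrite (nstat_pad lN) !nstat_weighted summ leq_mul2l.
  by rewrite (@sum_nth_pad id) // -sumnE leqnn orbT.
move=> eml; move/eqP: gm0; case.
have -> : m = mpart N l; last exact: glead.
by apply/mnmP => i; rewrite [RHS]mnmE -eml // -mnm_nth.
Qed.

End Uniqueness.

(** * Removing a column or a row *)

Section ColumnStrip.
Variables (F : fieldType) (a : F) (N : nat).
Implicit Types (g : {mpoly F[N]}) (m : 'X_{1..N}).

Lemma euler_homog g d : g \is d.-homog -> \sum_i 'X_i * g^`M(i) = d%:R *: g.
Proof.
move=> /dhomogP gd; rewrite [g]mpolyE scaler_sumr.
under eq_bigr do rewrite linear_sum mulr_sumr.
rewrite exchange_big /= !big_seq; apply: eq_bigr => m /gd /= md.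
under eq_bigr do rewrite mderivZ -scalerAr mulX_mderivX scalerA mulrC -scalerA.
by rewrite -scaler_suml -natr_sum -mdegE md.
Qed.

Definition mones : 'X_{1..N} := [multinom 1 | i < N].

Lemma mones_sym : 'X_[F, mones] \is symmetric.
Proof.
apply/issymP => s; rewrite msymX; congr 'X_[_].
by apply/mnmP => i; rewrite !mnmE.
Qed.

Lemma mulX_mderiv_mones i g :
  'X_i * ('X_[mones] * g)^`M(i) = 'X_[mones] * (g + 'X_i * g^`M(i)).
Proof.
have e : 'X_i * 'X_[mones]^`M(i) = 'X_[F, mones].
  by rewrite mulX_mderivX mnmE scale1r.
by rewrite mderivM [RHS]mulrDr -{3}e; ring.
Qed.

Lemma mulX2_mderiv2_mones i g :
  'X_i ^+ 2 * ('X_[mones] * g)^`M(i)^`M(i)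
  = 'X_[mones] * ('X_i ^+ 2 * g^`M(i)^`M(i) + 2%:R * ('X_i * g^`M(i))).
Proof.
have e : 'X_i * 'X_[mones]^`M(i) = 'X_[F, mones].
  by rewrite mulX_mderivX mnmE scale1r.
have e2 : 'X_[F, mones]^`M(i)^`M(i) = 0.
  by rewrite mderivX mderivZ mderivX mnmBE mnm1E eqxx mnmE scale0r scaler0.
rewrite !(mderivM, mderivD) e2 mul0r add0r [RHS]mulrDr -{5}e; ring.
Qed.

(** The mixed second-order terms add [2 a d] by Euler's identity. For each pair [i < j] the extra
    term is [ddiff i j] of [x_i] times [g], that is [g] itself, and twice the number of pairs is
    [N (N - 1)]. So multiplication by [x_1 ... x_N] keeps symmetric homogeneous eigenvectors. *)
Lemma laplN_mones g d : g \is symmetric -> g \is d.-homog ->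
  laplN a ('X_[mones] * g) =
    'X_[mones] * laplN a g + (2%:R * a * d%:R + N%:R * (N%:R - 1)) *: ('X_[mones] * g).
Proof.
move=> gs gd; rewrite /laplN.
under eq_bigr do rewrite mulX2_mderiv2_mones.
have hd (i j : 'I_N) : (i < j)%N ->
    ddiff i j ('X_i ^+ 2 * ('X_[mones] * g)^`M(i))
    = 'X_[mones] * ddiff i j ('X_i ^+ 2 * g^`M(i)) + 'X_[mones] * g.
  move=> ij; have ij' : i != j by rewrite -val_eqE /= ltn_eqF.
  rewrite expr2 -mulrA mulX_mderiv_mones mulrCA (ddiff_symM _ ij' mones_sym).
  rewrite (mulrDr 'X_i) [ddiff i j _]linearD mulrDr addrC mulrA -expr2; congr (_ + _ * _).
  rewrite -[LHS]/(ddiff i j _) mulrC ddiff_symM // /ddiff mliftX /ddiff_mnm !mnm1E eqxx (negPf ij') /=.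
  rewrite big_ord_recl !big_ord0 subr0 addr0 subnn addn0.
  rewrite (_ : mnm_put _ _ _ _ _ = 0%MM) ?mpolyX0 ?mulr1 //.
  apply/mnmP => k; rewrite !mnmE; case: (eqVneq k i) => // ki.
  by case: (eqVneq k j) => //; rewrite eq_sym (negPf ki).
have -> : \sum_(i < N) \sum_(j < N | (i < j)%N) ddiff i j ('X_i ^+ 2 * ('X_[mones] * g)^`M(i))
   = 'X_[mones] * (\sum_(i < N) \sum_(j < N | (i < j)%N) ddiff i j ('X_i ^+ 2 * g^`M(i)))
     + (\sum_(i < N) \sum_(j < N | (i < j)%N) 1)%:R *: ('X_[mones] * g).
  rewrite natr_sum scaler_suml; under eq_bigr => i _.
    rewrite (eq_bigr (fun j : 'I_N => 'X_[mones] * ddiff i j ('X_i ^+ 2 * g^`M(i))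
      + 1%:R *: ('X_[mones] * g))); last by move=> j ij; rewrite hd // scale1r.
    rewrite big_split /= -mulr_sumr -scaler_suml -natr_sum; over.
  by rewrite big_split -mulr_sumr.
have cnt : 2%:R * (\sum_(i < N) \sum_(j < N | (i < j)%N) 1)%:R = N%:R * (N%:R - 1) :> F.
  have := sum_ord_gt (fun=> 1%N : nat) (N := N).
  rewrite sum_nat_const card_ord muln1.
  under [X in (_ + X)%N]eq_bigr do rewrite muln1.
  rewrite -(big_mkord xpredT (fun i => i)) bin2_sum => e.
  rewrite -natrM; have -> : (2 * \sum_(i < N) \sum_(j < N | i < j) 1 = N * N.-1)%N.
    by have := mul_bin_diag N 1; rewrite bin1; move: e; move: (\sum_(i < N) _)%N => x; lia.
  by case: (N) => [|n]; rewrite ?mul0n ?mul0r //= natrM -natr1 addrK.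
rewrite -mulr_sumr big_split /= -mulr_sumr (euler_homog gd).
rewrite !mulrDr !scalerDr scalerA cnt -!mul_mpolyC.
rewrite !(mpolyCM, mpolyCD, mpolyCN, mpolyC_nat, mpolyC1); ring.
Qed.

End ColumnStrip.

Section RowStrip.
Variables (F : fieldType) (a : F) (N M : nat).
Implicit Types (g : {mpoly F[N.+1]}).

Definition mnm_tail (m : 'X_{1..N.+1}) : 'X_{1..N} := [multinom m (lift ord0 i) | i < N].

Definition mnm_cons (p : nat) (m : 'X_{1..N}) : 'X_{1..N.+1} :=
  [multinom oapp m p (unlift ord0 i) | i < N.+1].

Lemma mnm_cons0 p m : mnm_cons p m ord0 = p.
Proof. by rewrite mnmE unlift_none. Qed.

Lemma mnm_consS p m i : mnm_cons p m (lift ord0 i) = m i.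
Proof. by rewrite mnmE liftK. Qed.

Lemma mnm_cons_tail (m : 'X_{1..N.+1}) : mnm_cons (m ord0) (mnm_tail m) = m.
Proof.
apply/mnmP => i; case: (unliftP ord0 i) => [j|] ->.
  by rewrite mnm_consS mnmE.
by rewrite mnm_cons0.
Qed.

Lemma mnm_tail_cons p m : mnm_tail (mnm_cons p m) = m.
Proof. by apply/mnmP => i; rewrite mnmE mnm_consS. Qed.

(** The coefficient of [x_0 ^ M], as a polynomial in the remaining variables. With [M] the first
    part of a partition it detaches the first row. *)
Definition xtop : {mpoly F[N.+1]} -> {mpoly F[N]} :=
  mlift (fun m => if m ord0 == M then 'X_[mnm_tail m] else 0).

HB.instance Definition _ := GRing.Linear.on xtop.

Lemma xtopX (m : 'X_{1..N.+1}) : xtop 'X_[m] = if m ord0 == M then 'X_[mnm_tail m] else 0.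
Proof. by rewrite /xtop mliftX. Qed.

Lemma mcoeff_xtop g m : (xtop g)@_m = g@_(mnm_cons M m).
Proof.
elim/mpolyind: g => [|c m' g _ _ IH]; first by rewrite linear0 !mcoeff0.
rewrite linearP !mcoeffD !mcoeffZ IH /= xtopX mcoeffX; congr (_ * _ + _).
case: (m' ord0 =P M) => e.
  rewrite mcoeffX; congr ((nat_of_bool _)%:R); apply/eqP/eqP => [<-|->].
    by rewrite -e mnm_cons_tail.
  by rewrite mnm_tail_cons.
by rewrite mcoeff0; case: eqP => // e'; rewrite e' mnm_cons0 in e.
Qed.

(** As no exponent exceeds [M], the only term in which [x_0] can have exponent [M] is the one equal
    to [x^m]. *)
Lemma xtop_ddiff0 j (m : 'X_{1..N.+1}) : (forall i, m i <= M)%N ->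
  xtop (ddiff_mnm F ord0 (lift ord0 j) (m + U_(ord0))) = xtop 'X_[m].
Proof.
move=> mM; rewrite ddiff_mnmU // linearB [X in X - _]linear_sum [X in _ - X]linear_sum /= [X in _ - X]big1 => [|t _].
  rewrite subr0; have mj := mM (lift ord0 j); have m0 := mM ord0.
  case: (leqP (m (lift ord0 j)) (m ord0)) => h.
    rewrite subSn // big_ord_recl subn0 addn0 mnm_put_id big1 ?addr0 // => t _.
    rewrite xtopX mnmE eqxx; case: eqP => //= e.
    have := ltn_ord t; rewrite /bump /= in e *; lia.
  rewrite (_ : ((m ord0).+1 - m (lift ord0 j) = 0)%N); last by lia.
  by rewrite big_ord0 xtopX; case: eqP => // e; lia.
rewrite xtopX mnmE eqxx; case: eqP => // e.
have := ltn_ord t; have := mM (lift ord0 j); lia.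
Qed.

Lemma mnm_tail_put i j p q (m : 'X_{1..N.+1}) :
  mnm_tail (mnm_put (lift ord0 i) (lift ord0 j) p q m) = mnm_put i j p q (mnm_tail m).
Proof. by apply/mnmP => k; rewrite !mnmE !(inj_eq (@lift_inj N.+1 ord0)). Qed.

Lemma xtop_ddiffS i j m : i != j ->
  xtop (ddiff_mnm F (lift ord0 i) (lift ord0 j) (m + U_(lift ord0 i))) =
  if m ord0 == M then ddiff_mnm F i j (mnm_tail m + U_(i)) else 0.
Proof.
move=> ij; have ij' : lift ord0 i != lift ord0 j by apply: contraNneq ij => /lift_inj ->.
rewrite !ddiff_mnmU //.
rewrite linearB [X in X - _]linear_sum [X in _ - X]linear_sum /=.
have put0 p q : mnm_put (lift ord0 i) (lift ord0 j) p q m ord0 = m ord0 by rewrite mnmE.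
rewrite (eq_bigr (fun t : 'I_((m (lift ord0 i)).+1 - m (lift ord0 j)) =>
  if m ord0 == M then 'X_[mnm_put i j (m (lift ord0 i) - t) (m (lift ord0 j) + t) (mnm_tail m)]
  else 0)); last by move=> t _; rewrite xtopX put0 mnm_tail_put.
rewrite [X in _ - X](eq_bigr (fun t : 'I_(m (lift ord0 j) - (m (lift ord0 i)).+1) =>
  if m ord0 == M then 'X_[mnm_put i j (m (lift ord0 i) + t.+1) (m (lift ord0 j) - t.+1) (mnm_tail m)]
  else 0)); last by move=> t _; rewrite xtopX put0 mnm_tail_put.
case: eqP => _; last by rewrite !big1 ?subrr.
by rewrite !mnmE.
Qed.

(** Each of the [N] pairs containing [x_0] contributes the scalar [2 M], the pairs without [x_0]
    commute with [xtop]. Hence the top coefficient of an eigenvector is again an eigenvector. *)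
Lemma xtop_laplN g : (forall m i, m \in msupp g -> (m i <= M)%N) ->
  xtop (laplN a g) =
    laplN a (xtop g) + (a * (M * M.-1)%:R + 2%:R * (N * M)%:R) *: xtop g.
Proof.
move=> gM; pose h g := laplN a (xtop g) + (a * (M * M.-1)%:R + 2%:R * (N * M)%:R) *: xtop g.
apply: (@mpoly_lin_ext _ _ _ (fun g => xtop (laplN a g)) h) => [c p q|c p q|m mg].
- by rewrite [laplN a _]linearP [LHS]linearP.
- rewrite /h [xtop _]linearP /= [laplN a _]linearP /= !scalerDr addrACA.
  by congr (_ + _ + (_ + _)); rewrite scalerA mulrC -scalerA.
rewrite {}/h; have {}gM i := gM m i mg.
pose T (i j : 'I_N.+1) := (m i)%:R *: ddiff_mnm F i j (m + U_(i)).
have S0 : xtop (\sum_(j < N.+1 | (@ord0 N < j)%N) T ord0 j) = (m ord0 * N)%:R *: xtop 'X_[m].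
  rewrite big_mkcond big_ord_recl /= add0r linear_sum.
  rewrite (eq_bigr (fun=> (m ord0)%:R *: xtop 'X_[m])) => [|j _].
    by rewrite sumr_const card_ord -scaler_nat scalerA mulrC -natrM.
  by rewrite linearZ /= xtop_ddiff0.
have S1 (i : 'I_N) : xtop (\sum_(j < N.+1 | (lift ord0 i < j)%N) T (lift ord0 i) j) =
    if m ord0 == M then \sum_(j < N | (i < j)%N)
      (mnm_tail m i)%:R *: ddiff_mnm F i j (mnm_tail m + U_(i)) else 0.
  rewrite big_mkcond big_ord_recl /= add0r.
  rewrite (eq_bigr (fun j : 'I_N => if (i < j)%N then T (lift ord0 i) (lift ord0 j) else 0)).
    rewrite -big_mkcond linear_sum /=.
    rewrite (eq_bigr (fun j : 'I_N => if m ord0 == M then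
      (mnm_tail m i)%:R *: ddiff_mnm F i j (mnm_tail m + U_(i)) else 0)).
      by case: eqP => // _; rewrite big1.
    move=> j ij; have ij' : i != j by rewrite -val_eqE /= ltn_eqF.
    by rewrite linearZ /= xtop_ddiffS // mnmE; case: eqP => // _; rewrite scaler0.
  by move=> j _; rewrite /bump /= !add1n ltnS.
have S : xtop (\sum_(i < N.+1) \sum_(j < N.+1 | (i < j)%N) T i j) =
    (m ord0 * N)%:R *: xtop 'X_[m] + \sum_(i < N) (if m ord0 == M then
      \sum_(j < N | (i < j)%N) (mnm_tail m i)%:R *: ddiff_mnm F i j (mnm_tail m + U_(i))
      else 0).
  rewrite big_ord_recl; apply: etrans (linearD _ _ _) _; congr (_ + _); first exact: S0.
  by apply: etrans (linear_sum _ _ _ _) _; apply: eq_bigr => i _; apply: S1.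
rewrite laplNX -/T linearD [X in X + _]linearZ [X in _ + X]linearZ /= S.
rewrite xtopX; case: eqP => [m0|_].
  rewrite laplNX.
  have -> : (\sum_i m i * (m i).-1 = M * M.-1 + \sum_i mnm_tail m i * (mnm_tail m i).-1)%N.
    by rewrite big_ord_recl m0; congr (_ + _)%N; apply: eq_bigr => i _; rewrite mnmE.
  rewrite m0 [(M * N)%N]mulnC natrD -!mul_mpolyC.
  by rewrite !(mpolyCM, mpolyCD, mpolyC_nat); ring.
by rewrite [laplN a 0]linear0 big1_eq !scaler0 !addr0 !scaler0 addr0.
Qed.

Lemma msym_xtop g : g \is symmetric -> xtop g \is symmetric.
Proof.
move=> /issymP gs; apply/issymP => s; apply/mpolyP => m.
rewrite mcoeff_sym !mcoeff_xtop -[in RHS](gs (lift_perm ord0 ord0 s)) mcoeff_sym.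
congr (g@__); apply/mnmP => i; rewrite [RHS]mnmE.
case: (unliftP ord0 i) => [j|] ->.
  by rewrite lift_perm_lift !mnm_consS mnmE.
by rewrite lift_perm_id !mnm_cons0.
Qed.

Lemma mdeg_mnm_cons p m : mdeg (mnm_cons p m) = (p + mdeg m)%N.
Proof.
rewrite !mdegE big_ord_recl mnm_cons0; congr (_ + _)%N.
by apply: eq_bigr => i _; rewrite mnm_consS.
Qed.

Lemma excess_mnm_cons x p m : excess x (mnm_cons p m) = (p - x + excess x m)%N.
Proof.
rewrite /excess big_ord_recl mnm_cons0; congr (_ + _)%N.
by apply: eq_bigr => i _; rewrite mnm_consS.
Qed.

End RowStrip.

(** * Power sums *)

(* Symmetric functions of degree at most [K] are polynomials in the power sums,
   ['X_i] standing for [p_(i+1)]; their degree is the weight [mnmwgt]. *)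
Section PowerSumSide.
Variables (F : fieldType) (K : nat).
Notation P := {mpoly F[K]}.
Implicit Types (f g h : P) (m : 'X_{1..K}) (a t : F) (d : nat).

Lemma mnm_indU (Q : 'X_{1..K} -> Prop) :
  Q 0%MM -> (forall m i, Q m -> Q (m + U_(i))%MM) -> forall m, Q m.
Proof.
move=> Q0 QS m; move: {2}(mdeg m) (erefl (mdeg m)) => d.
elim: d m => [|d IH] m md.
  by move/eqP: md; rewrite mdeg_eq0 => /eqP ->.
case: (pickP (fun i => m i != 0%N)) => [i mi|m0]; last first.
  by move: md; rewrite mdegE big1 // => i _; have /negbFE/eqP := m0 i.
have e : (m - U_(i) + U_(i))%MM = m by rewrite submK // lep1mP.
rewrite -e; apply/QS/IH.
by have := mdegD (m - U_(i)) U_(i); rewrite e mdeg1 md addn1 => -[<-].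
Qed.

Lemma whomogP d f : reflect (forall m, m \in msupp f -> mnmwgt m = d)
  (f \is d.-homog for (@mnmwgt K)).
Proof. exact: dhomogP. Qed.

Lemma whomog_mulX d i f : f \is d.-homog for (@mnmwgt K) ->
  'X_i * f \is (i.+1 + d).-homog for (@mnmwgt K).
Proof. by move=> fd; apply: dhomogM => //; rewrite dhomogX /= mnmwgt1. Qed.

Lemma whomog_mderiv d i f : f \is d.-homog for (@mnmwgt K) ->
  f^`M(i) = 0 \/ (i < d)%N /\ f^`M(i) \is (d - i.+1).-homog for (@mnmwgt K).
Proof.
move=> /whomogP fd.
have H m : m \in msupp f^`M(i) -> (mnmwgt m + i.+1 = d)%N.
  rewrite mcoeff_msupp mcoeff_deriv => nz; rewrite -(fd (m + U_(i))%MM).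
    by rewrite mnmwgtD mnmwgt1.
  by rewrite mcoeff_msupp; apply: contraNneq nz => ->; rewrite mul0rn.
case: (eqVneq f^`M(i) 0) => [->|nz]; [by left | right].
move: nz; rewrite -msupp_eq0; case E : (msupp _) => [//|m s] _.
have mi : m \in msupp f^`M(i) by rewrite E inE eqxx.
split; first by rewrite -(H m mi); lia.
by apply/whomogP => m' /H <-; rewrite addnK.
Qed.

Lemma weuler d f : f \is d.-homog for (@mnmwgt K) ->
  \sum_(i < K) i.+1%:R *: ('X_i * f^`M(i)) = d%:R *: f.
Proof.
move=> /whomogP fd.
apply: (@mpoly_lin_ext _ _ _ (fun f => \sum_(i < K) i.+1%:R *: ('X_i * f^`M(i)))
  (fun f => d%:R *: f)) => [c p q|c p q|m /fd <-].
- rewrite scaler_sumr -big_split; apply: eq_bigr => i _ /=.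
  by rewrite linearP /= mulrDr scalerDr -scalerAr !scalerA mulrC.
- by rewrite scalerDr !scalerA mulrC.
rewrite natr_sum scaler_suml; apply: eq_bigr => i _.
by rewrite mulX_mderivX scalerA -natrM mulnC.
Qed.

Section Form.
Variable a : F.

Definition pweight m : F := \prod_(i < K) ((a * i.+1%:R) ^+ m i * (m i)`!%:R).

Lemma pweightU m i : pweight (m + U_(i)) = pweight m * (a * i.+1%:R * (m i).+1%:R).
Proof.
rewrite /pweight (bigD1 i) // [in RHS](bigD1 i) //= mnmDE mnm1E eqxx addn1.
rewrite (eq_bigr (fun j : 'I_K => (a * j.+1%:R) ^+ m j * (m j)`!%:R)) => [|j /negPf ji].
  by rewrite exprS factS natrM; ring.
by rewrite mnmDE mnm1E eq_sym ji addn0.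
Qed.

Definition pdot f g : F := mlift (fun m => pweight m * g@_m : F^o) f.

Lemma pdotX m g : pdot 'X_[m] g = pweight m * g@_m.
Proof. by rewrite /pdot mliftX. Qed.

Lemma pdot_linearl g : linear (fun f => pdot f g : F^o).
Proof. by move=> c p q; rewrite /pdot linearP. Qed.

Lemma pdotC f g : pdot f g = pdot g f.
Proof.
have linr p : linear (fun q => pdot p q : F^o).
  move=> c q r; rewrite /pdot /mlift scaler_sumr -big_split; apply: eq_bigr => m _.
  by rewrite mcoeffD mcoeffZ /GRing.scale /=; ring.
apply: (@mpoly_lin_ext _ _ _ (fun f => pdot f g : F^o) (fun f => pdot g f : F^o)) => //.
  exact: pdot_linearl.
move=> m _; apply: (@mpoly_lin_ext _ _ _ (fun g => pdot 'X_[m] g : F^o)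
  (fun g => pdot g 'X_[m] : F^o)) => //; first exact: pdot_linearl.
move=> m' _; rewrite !pdotX !mcoeffX eq_sym.
by case: eqP => [->|] //; rewrite !mulr0.
Qed.

Lemma pdotDl f g h : pdot (f + g) h = pdot f h + pdot g h.
Proof. by have := pdot_linearl h 1 f g; rewrite !scale1r. Qed.

Lemma pdotDr f g h : pdot f (g + h) = pdot f g + pdot f h.
Proof. by rewrite pdotC pdotDl !(pdotC f). Qed.

Lemma pdot0l f : pdot 0 f = 0.
Proof. by rewrite /pdot linear0. Qed.

Lemma pdotZl c f g : pdot (c *: f) g = c * pdot f g.
Proof. by have := pdot_linearl g c f 0; rewrite addr0 pdot0l addr0. Qed.

Lemma pdotZr c f g : pdot f (c *: g) = c * pdot f g.
Proof. by rewrite pdotC pdotZl pdotC. Qed.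

Lemma pdot_suml (I : Type) (r : seq I) (Q : pred I) (f : I -> P) g :
  pdot (\sum_(i <- r | Q i) f i) g = \sum_(i <- r | Q i) pdot (f i) g.
Proof.
by elim/big_rec2: _ => [|i x y _ <-]; rewrite ?pdot0l // pdotDl.
Qed.

Lemma pdot_sumr (I : Type) (r : seq I) (Q : pred I) (f : I -> P) g :
  pdot g (\sum_(i <- r | Q i) f i) = \sum_(i <- r | Q i) pdot g (f i).
Proof. by rewrite pdotC pdot_suml; apply: eq_bigr => i _; rewrite pdotC. Qed.

Lemma pdot_mulXl i f g : pdot ('X_i * f) g = a * i.+1%:R * pdot f g^`M(i).
Proof.
apply: (@mpoly_lin_ext _ _ _ (fun f => pdot ('X_i * f) g : F^o)
  (fun f => a * i.+1%:R * pdot f g^`M(i) : F^o)) => [c p q|c p q|m _].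
- by rewrite mulrDr -scalerAr pdot_linearl.
- by rewrite pdot_linearl mulrDr /GRing.scale /=; congr (_ + _); ring.
by rewrite -mpolyXD addmC !pdotX pweightU mcoeff_deriv -mulr_natl; ring.
Qed.

Lemma pdot_mulXr i f g : pdot f ('X_i * g) = a * i.+1%:R * pdot f^`M(i) g.
Proof. by rewrite pdotC pdot_mulXl pdotC. Qed.

(** Twice the operator [D] of the overview: loops, then joins and cuts. The shift in [l = i + j + 1]
    is due to ['X_i] standing for [p_(i+1)]. Joins beyond [p_K] are dropped, which changes nothing
    in degree at most [K]. *)
Definition lapl f : P :=
  (a - 1) *: (\sum_(i < K) (i.+1 * i)%:R *: ('X_i * f^`M(i)))
  + \sum_(i < K) \sum_(j < K) \sum_(l < K | l == (i + j).+1 :> nat)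
      ((a * (i.+1 * j.+1)%:R) *: ('X_l * f^`M(i)^`M(j))
       + l.+1%:R *: ('X_i * 'X_j * f^`M(l))).

Lemma lapl_is_linear : linear lapl.
Proof.
move=> c p q; rewrite /lapl scalerDr addrACA; congr (_ + _).
  rewrite scalerA [c * _]mulrC -scalerA -scalerDr; congr (_ *: _).
  rewrite scaler_sumr -big_split; apply: eq_bigr => i _ /=.
  by rewrite linearP /= mulrDr scalerDr -scalerAr !scalerA mulrC.
rewrite scaler_sumr -big_split; apply: eq_bigr => i _ /=.
rewrite scaler_sumr -big_split; apply: eq_bigr => j _ /=.
rewrite scaler_sumr -big_split; apply: eq_bigr => l _ /=.
rewrite !linearP /= !mulrDr !scalerDr -!scalerAr !scalerA.
by rewrite [c * l.+1%:R]mulrC addrACA.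
Qed.

HB.instance Definition _ := GRing.isLinear.Build F P P _ lapl lapl_is_linear.

(** The adjoint of [p_i] is [a i d/dp_i]; a loop is thus its own adjoint, and the join and the cut
    with the same [i], [j], [l] are adjoint to each other. *)
Lemma pdot_lapl f g : pdot (lapl f) g = pdot f (lapl g).
Proof.
rewrite /lapl pdotDl pdotDr pdotZl pdotZr !pdot_suml !pdot_sumr; congr (_ * _ + _).
  by apply: eq_bigr => i _; rewrite pdotZl pdotZr pdot_mulXl pdot_mulXr.
apply: eq_bigr => i _; rewrite pdot_suml pdot_sumr; apply: eq_bigr => j _.
rewrite pdot_suml pdot_sumr; apply: eq_bigr => l _.
rewrite !(pdotDl, pdotDr, pdotZl, pdotZr) -!mulrA !pdot_mulXl !pdot_mulXr natrM.
by rewrite mderiv_comm [g^`M(i)^`M(j)]mderiv_comm; ring.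
Qed.

Lemma lapl_whomog d f : f \is d.-homog for (@mnmwgt K) ->
  lapl f \is d.-homog for (@mnmwgt K).
Proof.
move=> fd; rewrite /lapl rpredD // ?rpredZ // rpred_sum // => i _; rewrite ?rpredZ //.
  have [->|[di]] := whomog_mderiv i fd; first by rewrite mulr0 rpred0.
  by move=> /(whomog_mulX i); rewrite subnKC.
apply: rpred_sum => j _; apply: rpred_sum => l /eqP el; rewrite rpredD // rpredZ //.
  have [->|[di fi]] := whomog_mderiv i fd; first by rewrite linear0 mulr0 rpred0.
  have [->|[dj fj]] := whomog_mderiv j fi; first by rewrite mulr0 rpred0.
  have := whomog_mulX l fj; have -> // : (l.+1 + (d - i.+1 - j.+1) = d)%N by lia.
have [->|[dl fl]] := whomog_mderiv l fd; first by rewrite mulr0 rpred0.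
rewrite -mulrA; have := whomog_mulX i (whomog_mulX j fl).
by have -> // : (i.+1 + (j.+1 + (d - l.+1)) = d)%N by lia.
Qed.

End Form.
End PowerSumSide.

Section Commutators.
Variables (F : fieldType) (k : nat) (a : F).
Notation K := k.+1.
Notation P := {mpoly F[K]}.
Implicit Types (f g h : P) (m : 'X_{1..K}) (t : F) (d : nat).

Lemma mderivXU (i j : 'I_K) : 'X_j^`M(i) = (j == i)%:R *: 1 :> P.
Proof.
rewrite mderivX mnm1E; case: eqP => [->|_]; last by rewrite !scale0r.
by rewrite (_ : (U_(i) - U_(i))%MM = 0%MM) ?mpolyX0 //; apply/mnmP => l; rewrite mnmBE subnn mnm0E.
Qed.

Definition praise f : P :=
  \sum_(i < K) \sum_(l < K | l == i.+1 :> nat) i.+1%:R *: ('X_l * f^`M(i)).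
Definition plower f : P :=
  \sum_(i < K) \sum_(l < K | l == i.+1 :> nat) l.+1%:R *: ('X_i * f^`M(l)).

Lemma pdot_praise f g : pdot a (praise f) g = pdot a f (plower g).
Proof.
rewrite pdot_suml pdot_sumr; apply: eq_bigr => i _.
rewrite pdot_suml pdot_sumr; apply: eq_bigr => l _.
by rewrite pdotZl pdotZr pdot_mulXl pdot_mulXr; ring.
Qed.

(** No join creates [p_1] and the loop on [p_1] has coefficient 0, so only the cuts that create
    [p_1] fail to commute; [p_1] can be either of the two factors, whence the 2. *)
Lemma mderiv0_lapl f : (lapl a f)^`M(ord0) = lapl a f^`M(ord0) + 2%:R *: plower f.
Proof.
rewrite /lapl linearD linearZ /= -addrA; congr (_ *: _ + _).
  rewrite linear_sum; apply: eq_bigr => i _; rewrite linearZ /= mderivM mderivXU.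
  case: (eqVneq i ord0) => [->|ne]; first by rewrite muln0 !scale0r.
  by rewrite scale0r mul0r add0r mderiv_comm.
transitivity (\sum_(i < K) \sum_(j < K) \sum_(l < K | l == (i + j).+1 :> nat)
   ((a * (i.+1 * j.+1)%:R) *: ('X_l * f^`M(ord0)^`M(i)^`M(j))
    + l.+1%:R *: ('X_i * 'X_j * f^`M(ord0)^`M(l))
    + (((i == ord0)%:R * l.+1%:R) *: ('X_j * f^`M(l))
       + ((j == ord0)%:R * l.+1%:R) *: ('X_i * f^`M(l))))).
  rewrite linear_sum; apply: eq_bigr => i _; rewrite linear_sum; apply: eq_bigr => j _.
  rewrite linear_sum; apply: eq_bigr => l /eqP el.
  rewrite linearD !linearZ /= !mderivM !mderivXU -addrA.
  have -> : (l == ord0) = false by apply/eqP => e; rewrite e in el.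
  rewrite scale0r mul0r add0r [f^`M(ord0)^`M(i)]mderiv_comm.
  rewrite [f^`M(i)^`M(ord0)^`M(j)]mderiv_comm; congr (_ + _).
  rewrite [f^`M(l)^`M(ord0)]mderiv_comm addrC.
  by rewrite -!mul_mpolyC !(mpolyCM, mpolyC_nat, mpolyC1); ring.
have split3 (A B : 'I_K -> 'I_K -> 'I_K -> P) :
   \sum_(i < K) \sum_(j < K) \sum_(l < K | l == (i + j).+1 :> nat) (A i j l + B i j l)
   = \sum_(i < K) \sum_(j < K) \sum_(l < K | l == (i + j).+1 :> nat) A i j l
     + \sum_(i < K) \sum_(j < K) \sum_(l < K | l == (i + j).+1 :> nat) B i j l.
  rewrite -big_split; apply: eq_bigr => i _; rewrite -big_split; apply: eq_bigr => j _.
  by rewrite -big_split.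
rewrite split3; congr (_ + _); rewrite split3 scaler_nat mulr2n; congr (_ + _).
  rewrite big_ord_recl [X in _ + X]big1 ?addr0 => [|i _]; last first.
    by rewrite big1 // => j _; rewrite big1 // => l _; rewrite mul0r scale0r.
  by apply: eq_bigr => j _; apply: eq_bigr => l _; rewrite eqxx mul1r.
rewrite exchange_big big_ord_recl /= [X in _ + X]big1 ?addr0 => [|j _]; last first.
  by rewrite big1 // => i _; rewrite big1 // => l _; rewrite mul0r scale0r.
apply: eq_bigr => i _; rewrite addn0; apply: eq_bigr => l _.
by rewrite ?eqxx mul1r.
Qed.

Lemma lapl_mulX0 f : lapl a ('X_ord0 * f) = 'X_ord0 * lapl a f + (2%:R * a) *: praise f.
Proof.
rewrite /lapl mulrDr -addrA; congr (_ + _).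
  rewrite -scalerAr; congr (_ *: _); rewrite mulr_sumr; apply: eq_bigr => i _.
  rewrite mderivM mderivXU eq_sym -scalerAr.
  case: (eqVneq i ord0) => [->|ne]; first by rewrite muln0 !scale0r.
  by rewrite scale0r mul0r add0r mulrCA.
transitivity (\sum_(i < K) \sum_(j < K) \sum_(l < K | l == (i + j).+1 :> nat)
   ('X_ord0 * ((a * (i.+1 * j.+1)%:R) *: ('X_l * f^`M(i)^`M(j))
    + l.+1%:R *: ('X_i * 'X_j * f^`M(l)))
    + (((j == ord0)%:R * (a * (i.+1 * j.+1)%:R)) *: ('X_l * f^`M(i))
       + ((i == ord0)%:R * (a * (i.+1 * j.+1)%:R)) *: ('X_l * f^`M(j))))).
  apply: eq_bigr => i _; apply: eq_bigr => j _; apply: eq_bigr => l /eqP el.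
  rewrite !(mderivM, mderivD, mderivXU, mderivZ) ![ord0 == _]eq_sym.
  have -> : (l == ord0) = false by apply/eqP => e; rewrite e in el.
  have -> : (1 : P)^`M(j) = 0 by rewrite -mpolyC1 mderivC.
  rewrite scaler0 mul0r add0r.
  by rewrite -!mul_mpolyC !(mpolyCM, mpolyC_nat, mpolyC1) [false%:R]mulr0n; ring.
have split3 (A B : 'I_K -> 'I_K -> 'I_K -> P) :
   \sum_(i < K) \sum_(j < K) \sum_(l < K | l == (i + j).+1 :> nat) (A i j l + B i j l)
   = \sum_(i < K) \sum_(j < K) \sum_(l < K | l == (i + j).+1 :> nat) A i j l
     + \sum_(i < K) \sum_(j < K) \sum_(l < K | l == (i + j).+1 :> nat) B i j l.
  rewrite -big_split; apply: eq_bigr => i _; rewrite -big_split; apply: eq_bigr => j _.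
  by rewrite -big_split.
rewrite split3; congr (_ + _).
  rewrite mulr_sumr; apply: eq_bigr => i _; rewrite mulr_sumr; apply: eq_bigr => j _.
  by rewrite mulr_sumr.
rewrite split3 -scalerA scaler_nat mulr2n /praise scaler_sumr; congr (_ + _).
  rewrite exchange_big big_ord_recl /= [X in _ + X]big1 ?addr0 => [|j _]; last first.
    by rewrite big1 // => i _; rewrite big1 // => l _; rewrite mul0r scale0r.
  apply: eq_bigr => i _; rewrite addn0 scaler_sumr; apply: eq_bigr => l _.
  by rewrite ?eqxx mul1r muln1 scalerA.
rewrite big_ord_recl [X in _ + X]big1 ?addr0 => [|i _]; last first.
  by rewrite big1 // => j _; rewrite big1 // => l _; rewrite mul0r scale0r.
apply: eq_bigr => j _; rewrite add0n scaler_sumr; apply: eq_bigr => l _.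
by rewrite eqxx mul1r mul1n scalerA.
Qed.

Definition pval t f : F := f.@[fun=> t].

(** Once all power sums equal [t], [p_i] and [p_(i+1)] are interchangeable, and [plower] becomes the
    weighted Euler operator without its [p_1] term. *)
Lemma pval_weuler t f d : f \is d.-homog for (@mnmwgt K) ->
  pval t (t *: f^`M(ord0) + plower f) = d%:R * pval t f.
Proof.
move=> fd; rewrite /pval -mevalZ -(weuler fd) mevalD mevalZ big_ord_recl mevalD; congr (_ + _).
  by rewrite mevalZ mul1r mevalM mevalXU.
rewrite /plower (exchange_big_dep xpredT) //= big_ord_recl [X in X + _]big1 ?add0r // !raddf_sum.
apply: eq_bigr => i _; rewrite (big_pred1 (widen_ord (leqnSn k) i)) => [|j].
  by rewrite /= !mevalZ !mevalM !mevalXU.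
by rewrite /= /bump add1n eqSS eq_sym.
Qed.

End Commutators.

Lemma sum_symm (V : zmodType) (N : nat) (f : 'I_N -> 'I_N -> V) :
  (forall i j, f i j = f j i) ->
  \sum_(i < N) \sum_(j < N) f i j
  = \sum_(i < N) f i i + (\sum_(i < N) \sum_(j < N | (i < j)%N) f i j) *+ 2.
Proof.
move=> fC; have e : \sum_(i < N) \sum_(j < N | (j < i)%N) f i j
    = \sum_(i < N) \sum_(j < N | (i < j)%N) f i j.
  rewrite (exchange_big_dep xpredT) //=.
  by apply: eq_bigr => i _; apply: eq_bigr.
rewrite mulr2n -{1}e -!big_split; apply: eq_bigr => i _ /=.
rewrite (bigID (fun j : 'I_N => (i < j)%N)) /= [RHS]addrA addrC; congr (_ + _).
rewrite (bigD1 i) ?ltnn //=; congr (_ + _); apply: eq_bigl => j.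
by rewrite -val_eqE /= [RHS]ltn_neqAle -leqNgt andbC.
Qed.

(** * Power sums in finitely many variables *)

Section Evaluation.
Variables (F : fieldType) (k N : nat).
Notation K := k.+1.
Notation P := {mpoly F[K]}.
Notation S := {mpoly F[N]}.
Implicit Types (f g h : P) (m : 'X_{1..K}) (d : nat).

Definition psum_mpoly (j : nat) : S := \sum_(i < N) 'X_i ^+ j.

Definition evN f : S := f \mPo [tuple psum_mpoly i.+1 | i < K].

HB.instance Definition _ := GRing.LRMorphism.copy evN
  (comp_mpoly [tuple psum_mpoly i.+1 | i < K]).

Lemma evNX i : evN 'X_i = psum_mpoly i.+1.
Proof. by rewrite /evN comp_mpolyXU -tnth_nth tnth_mktuple. Qed.

Lemma evNZ c f : evN (c *: f) = c *: evN f.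
Proof. exact: linearZ. Qed.

Lemma evND f g : evN (f + g) = evN f + evN g.
Proof. exact: linearD. Qed.

Lemma evNM f g : evN (f * g) = evN f * evN g.
Proof. exact: rmorphM. Qed.

Lemma evN0 : evN 0 = 0.
Proof. exact: linear0. Qed.

Lemma evN_sum (I : Type) (r : seq I) (Q : pred I) (f : I -> P) :
  evN (\sum_(i <- r | Q i) f i) = \sum_(i <- r | Q i) evN (f i).
Proof. exact: linear_sum. Qed.

Lemma psum_mpoly_sym j : psum_mpoly j \is symmetric.
Proof.
apply/issymP => s; rewrite /psum_mpoly linear_sum /=.
rewrite [RHS](reindex_inj (@perm_inj _ s)) /=; apply: eq_bigr => i _.
rewrite mpolyXn msymX mpolyXn; congr 'X_[_]; apply/mnmP => l.
rewrite mnmE !mulmnE !mnm1E; congr (nat_of_bool _ * _)%N.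
by apply/eqP/eqP => [->|<-]; rewrite (permKV, permK).
Qed.

Lemma evN_sym f : evN f \is symmetric.
Proof.
apply: mcomp_sym => i; rewrite -tnth_nth tnth_mktuple; exact: psum_mpoly_sym.
Qed.

Lemma mderiv_Xn (i j : 'I_N) l :
  ('X_i ^+ l.+1)^`M(j) = (i == j)%:R *: (l.+1%:R *: 'X_i ^+ l) :> S.
Proof.
rewrite !mpolyXn mderivX mulmnE mnm1E; case: eqP => [->|_]; last by rewrite mul0n !scale0r.
rewrite mul1n scale1r; congr (_ *: 'X_[_]); apply/mnmP => p.
by rewrite mnmBE !mulmnE mnm1E; case: eqP => _; rewrite ?subn0 ?mul0n // !mul1n subn1.
Qed.

Lemma mderiv_psum j l : (psum_mpoly l.+1)^`M(j) = l.+1%:R *: 'X_j ^+ l :> S.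
Proof.
rewrite /psum_mpoly linear_sum (bigD1 j) //= mderiv_Xn eqxx scale1r.
by rewrite big1 ?addr0 // => i /negPf ij; rewrite mderiv_Xn ij scale0r.
Qed.

Lemma mderiv_evN j f :
  (evN f)^`M(j) = \sum_(i < K) evN f^`M(i) * (i.+1%:R *: 'X_j ^+ i).
Proof.
apply: (@mpoly_lin_ext _ _ _ (fun f => (evN f)^`M(j))
  (fun f => \sum_(i < K) evN f^`M(i) * (i.+1%:R *: 'X_j ^+ i))) => [c p q|c p q|m _].
- by rewrite linearP linearP.
- rewrite scaler_sumr -big_split; apply: eq_bigr => i _ /=.
  by rewrite linearP linearP mulrDl scalerAl.
elim/mnm_indU: m => [|m i IH].
  rewrite mpolyX0 rmorph1 -[1]mpolyC1 mderivC big1 // => i _.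
  by rewrite -[1]mpolyC1 mderivC rmorph0 mul0r.
rewrite mpolyXD rmorphM /= mderivM IH evNX mderiv_psum mulr_suml.
rewrite (bigD1 i) //= [in RHS](bigD1 i) //=.
have e l : evN ('X_[m] * 'X_i)^`M(l) * (l.+1%:R *: 'X_j ^+ l) =
    evN 'X_[m]^`M(l) * (l.+1%:R *: 'X_j ^+ l) * psum_mpoly i.+1
    + (i == l)%:R *: (evN 'X_[m] * (l.+1%:R *: 'X_j ^+ l)).
  rewrite mderivM rmorphD !rmorphM /= evNX mderivXU evNZ rmorph1.
  by rewrite -!mul_mpolyC !(mpolyCM, mpolyC_nat); ring.
rewrite e eqxx scale1r -!addrA; congr (_ + _); rewrite addrC; congr (_ + _).
by apply: eq_bigr => l /negPf li; rewrite e eq_sym li scale0r addr0.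
Qed.

(** The chain rule yields the terms [(i+1) p_i d/dp_(i+1)], where [p_0 = N]. The result is the
    operator of [pval_weuler] at [t = N]. *)
Lemma sum_mderiv_evN f :
  \sum_j (evN f)^`M(j) = evN (N%:R *: f^`M(ord0) + plower f).
Proof.
under eq_bigr do rewrite mderiv_evN.
rewrite exchange_big big_ord_recl /= evND evNZ; congr (_ + _).
  rewrite -mulr_sumr; under eq_bigr do rewrite expr0 scale1r.
  by rewrite sumr_const card_ord mulr_natr scaler_nat.
rewrite /plower [X in evN X](exchange_big_dep xpredT) //= [X in evN X]big_ord_recl [X in evN (X + _)]big1 ?add0r //.
rewrite evN_sum; apply: eq_bigr => i _.
rewrite (big_pred1 (widen_ord (leqnSn k) i)) => [|j]; last first.
  by rewrite /= /bump add1n eqSS eq_sym.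
rewrite /= evNZ evNM evNX -mulr_sumr -scaler_sumr /= /bump add1n.
by rewrite -scalerAr mulrC.
Qed.

(** [d < K] ensures that raising a part never leaves the [K] available power sums. *)
Lemma sum_X2_mderiv_evN f d : (d < K)%N -> f \is d.-homog for (@mnmwgt K) ->
  \sum_j 'X_j ^+ 2 * (evN f)^`M(j) = evN (praise f).
Proof.
move=> dK fd; under eq_bigr do rewrite mderiv_evN mulr_sumr.
rewrite exchange_big /praise evN_sum; apply: eq_bigr => i _ /=.
have [->|[di _]] := whomog_mderiv i fd.
  rewrite evN0; under eq_bigr do rewrite mul0r mulr0.
  rewrite big1 // big1 ?evN0 // => j _; by rewrite mulr0 scaler0.
have iK : (i.+1 < K)%N by apply: leq_ltn_trans di _.
rewrite (big_pred1 (Ordinal iK)) //.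
rewrite /= evNZ evNM evNX /psum_mpoly mulr_suml scaler_sumr.
apply: eq_bigr => j _; rewrite -!scalerAr; congr (_ *: _).
by rewrite mulrCA -exprD mulrC.
Qed.

Lemma ddiffXn (i j : 'I_N) l : i != j ->
  ddiff i j ('X_i ^+ l) = \sum_(t < l) 'X_i ^+ (l - t.+1) * 'X_j ^+ t :> S.
Proof.
move=> ij; rewrite mpolyXn /ddiff mliftX /ddiff_mnm !mulmnE !mnm1E eqxx (negPf ij).
rewrite mul1n mul0n sub0n subn0 big_ord0 subr0; apply: eq_bigr => t _.
rewrite !mpolyXn -mpolyXD; congr 'X_[_]; apply/mnmP => p.
rewrite mnmDE !mnmE !mulmnE !mnm1E; case: (eqVneq p i) => [->|pi].
  by rewrite [j == i]eq_sym (negPf ij) mul1n mul0n addn0.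
by rewrite mul0n; case: (eqVneq p j) => _; rewrite ?mul1n ?mul0n.
Qed.

(** Over all pairs [(i, j)] the geometric sums add up to products of power sums. The diagonal
    accounts for [(l+1) p_l], and the rest counts every pair [i < j] twice. *)
Lemma sum_ddiffXn l :
  2%:R *: (\sum_(i < N) \sum_(j < N | (i < j)%N) ddiff i j ('X_i ^+ l.+1)) =
  \sum_(t < l.+1) psum_mpoly (l - t) * psum_mpoly t - l.+1%:R *: psum_mpoly l :> S.
Proof.
have -> : \sum_(t < l.+1) psum_mpoly (l - t) * psum_mpoly t =
    \sum_(i < N) \sum_(j < N) \sum_(t < l.+1) 'X_i ^+ (l - t) * 'X_j ^+ t.
  under [RHS]eq_bigr do rewrite exchange_big /=.
  rewrite exchange_big /=; apply: eq_bigr => t _.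
  by rewrite /psum_mpoly mulr_suml; apply: eq_bigr => i _; rewrite mulr_sumr.
rewrite sum_symm => [|i j]; last first.
  rewrite (reindex_inj rev_ord_inj) /=; apply: eq_bigr => t _.
  rewrite mulrC; congr (_ ^+ _ * _ ^+ _); have := ltn_ord t; lia.
rewrite (_ : \sum_(i < N) \sum_(t < l.+1) 'X_i ^+ (l - t) * 'X_i ^+ t
    = l.+1%:R *: psum_mpoly l); last first.
  rewrite /psum_mpoly scaler_sumr; apply: eq_bigr => i _.
  rewrite (eq_bigr (fun=> 'X_i ^+ l)) => [|t _]; last first.
    by rewrite -exprD subnK // -ltnS.
  by rewrite sumr_const card_ord scaler_nat.
rewrite addrAC subrr add0r scaler_nat; congr (_ *+ _).
apply: eq_bigr => i _; apply: eq_bigr => j ij; rewrite ddiffXn //.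
by rewrite -val_eqE /= ltn_eqF.
Qed.

(** In the coefficient of [(l+1) p_(l+1) d/dp_(l+1)], the divided differences give [2 N - (l + 2)],
    with [2 N] from the two terms containing [p_0 = N], and the second derivatives give [a l]. The
    sum is [(a - 1) l + 2 (N - 1)]: the loop coefficient and the degree shift. *)
Lemma laplN_evN a f d : (d <= K)%N -> f \is d.-homog for (@mnmwgt K) ->
  laplN a (evN f) = evN (lapl a f) + (2%:R * (N%:R - 1) * d%:R) *: evN f.
Proof.
move=> dK fd.
pose G i := evN f^`M(i); pose G2 i j := evN f^`M(i)^`M(j).
have second : \sum_j 'X_j ^+ 2 * (evN f)^`M(j)^`M(j) =
    \sum_(i < K) (i.+1 * i)%:R *: (psum_mpoly i.+1 * G i)
    + \sum_(i < K) \sum_(j < K) \sum_(l < K | l == (i + j).+1 :> nat)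
        (i.+1 * j.+1)%:R *: (psum_mpoly l.+1 * G2 i j).
  transitivity (\sum_(j < N) (\sum_(i < K) (i.+1 * i)%:R *: ('X_j ^+ i.+1 * G i)
    + \sum_(i < K) \sum_(l < K) (i.+1 * l.+1)%:R *: ('X_j ^+ (i + l).+2 * G2 i l))).
    apply: eq_bigr => j _; rewrite mderiv_evN linear_sum mulr_sumr -big_split.
    apply: eq_bigr => i _ /=; rewrite mderivM mulrDr [LHS]addrC; congr (_ + _).
      rewrite mderivZ; case: i => -[|i] iK /=.
        have -> : ('X_j ^+ 0 : S)^`M(j) = 0 by rewrite expr0 -mpolyC1 mderivC.
        by rewrite muln0 scale0r scaler0 !mulr0.
      rewrite mderiv_Xn eqxx scale1r scalerA -natrM -!scalerAr; congr (_ *: _).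
      by rewrite mulrCA -exprD mulrC.
    rewrite mderiv_evN mulr_suml mulr_sumr; apply: eq_bigr => l _.
    rewrite -!scalerAr -!scalerAl -scalerAr scalerA mulrC natrM mulrC; congr (_ *: _).
    have -> : ((i + l).+2 = 2 + (l + i))%N by lia.
    rewrite /G2 2!exprD; ring.
  rewrite big_split /=; congr (_ + _).
    rewrite exchange_big; apply: eq_bigr => i _ /=.
    by rewrite -scaler_sumr -mulr_suml.
  rewrite exchange_big; apply: eq_bigr => i _ /=.
  rewrite exchange_big; apply: eq_bigr => l _ /=.
  rewrite -scaler_sumr -mulr_suml -/(psum_mpoly _).
  have [e|[di fi]] := whomog_mderiv i fd.
    rewrite /G2 e linear0 evN0 mulr0 scaler0 big1 // => p _.
    by rewrite mulr0 scaler0.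
  have [e|[dl _]] := whomog_mderiv l fi.
    by rewrite /G2 e evN0 mulr0 scaler0 big1 // => p _; rewrite mulr0 scaler0.
  have ilK : ((i + l).+1 < K)%N by lia.
  by rewrite (big_pred1 (Ordinal ilK)).
have first : 2%:R *: (\sum_(i < N) \sum_(j < N | (i < j)%N)
      ddiff i j ('X_i ^+ 2 * (evN f)^`M(i))) =
    \sum_(l < K) l.+1%:R *: (G l * (\sum_(i < K) \sum_(j < K | l == (i + j).+1 :> nat)
        psum_mpoly i.+1 * psum_mpoly j.+1 + (2%:R * N%:R - l.+2%:R) *: psum_mpoly l.+1)).
  transitivity (\sum_(l < K) (l.+1%:R *: (G l * (2%:R *: (\sum_(i < N)
     \sum_(j < N | (i < j)%N) ddiff i j ('X_i ^+ l.+2)))))).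
    rewrite scaler_sumr; under [RHS]eq_bigr do rewrite -scalerAr scalerA mulrC -scalerA mulr_sumr scaler_sumr scaler_sumr.
    rewrite exchange_big; apply: eq_bigr => i _ /=.
    rewrite scaler_sumr; under [RHS]eq_bigr do rewrite mulr_sumr !scaler_sumr.
    rewrite exchange_big; apply: eq_bigr => j ij /=; rewrite -scaler_sumr; congr (_ *: _).
    have ij' : i != j by rewrite -val_eqE /= ltn_eqF.
    rewrite mderiv_evN mulr_sumr linear_sum; apply: eq_bigr => l _ /=.
    rewrite -(ddiff_symM _ ij' (evN_sym _)) -!scalerAr linearZ /=; congr (_ *: _).
    by rewrite /G mulrCA -exprD.
  apply: eq_bigr => l _; rewrite sum_ddiffXn; congr (_ *: (_ * _)).
  rewrite big_ord_recl big_ord_recr /= subn0 /bump !add1n subnn.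
  have ps0 : psum_mpoly 0 = N%:R%:MP.
    rewrite /psum_mpoly; under eq_bigr do rewrite expr0.
    by rewrite sumr_const card_ord mpolyC_nat.
  rewrite ps0 (_ : \sum_(i < K) _ = \sum_(i < l) psum_mpoly (l.+1 - (bump 0 i)) * psum_mpoly (bump 0 i)).
    rewrite -!mul_mpolyC !(mpolyCB, mpolyCM, mpolyC_nat) /=; ring.
  have lK : (l <= K)%N by apply: ltnW.
  rewrite (big_ord_widen K (fun i => psum_mpoly (l.+1 - (bump 0 i)) * psum_mpoly (bump 0 i)) lK).
  rewrite [RHS]big_mkcond; apply: eq_bigr => i _; rewrite /bump add1n subSS.
  case: ltnP => il; last by rewrite big1 // => j /eqP e; exfalso; lia.
  have hK : (l - i.+1 < K)%N by have := ltn_ord l; lia.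
  rewrite (big_pred1 (Ordinal hK)) => [|j] /=.
    by rewrite mulrC; congr (psum_mpoly _ * _); lia.
  by rewrite -val_eqE /=; apply/eqP/eqP; lia.
rewrite /laplN second first /lapl evND evNZ !evN_sum.
have -> : (2%:R * (N%:R - 1) * d%:R) *: evN f =
    \sum_(l < K) (2%:R * (N%:R - 1) * l.+1%:R) *: (psum_mpoly l.+1 * G l).
  rewrite -scalerA -evNZ -(weuler fd) evN_sum scaler_sumr; apply: eq_bigr => l _ /=.
  by rewrite evNZ evNM evNX scalerA.
have -> : \sum_(i < K) evN (\sum_(j < K) \sum_(l < K | l == (i + j).+1 :> nat)
      ((a * (i.+1 * j.+1)%:R) *: ('X_l * f^`M(i)^`M(j)) + l.+1%:R *: ('X_i * 'X_j * f^`M(l))))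
  = \sum_(i < K) \sum_(j < K) \sum_(l < K | l == (i + j).+1 :> nat)
      a *: ((i.+1 * j.+1)%:R *: (psum_mpoly l.+1 * G2 i j))
   + \sum_(l < K) \sum_(i < K) \sum_(j < K | l == (i + j).+1 :> nat)
      l.+1%:R *: (G l * (psum_mpoly i.+1 * psum_mpoly j.+1)).
  have -> : \sum_(l < K) \sum_(i < K) \sum_(j < K | l == (i + j).+1 :> nat)
      l.+1%:R *: (G l * (psum_mpoly i.+1 * psum_mpoly j.+1))
    = \sum_(i < K) \sum_(j < K) \sum_(l < K | l == (i + j).+1 :> nat)
      l.+1%:R *: (G l * (psum_mpoly i.+1 * psum_mpoly j.+1)).
    rewrite exchange_big; apply: eq_bigr => i _ /=.
    by rewrite (exchange_big_dep xpredT).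
  rewrite -big_split; apply: eq_bigr => i _ /=.
  rewrite evN_sum -big_split; apply: eq_bigr => j _ /=.
  rewrite evN_sum -big_split; apply: eq_bigr => l _ /=.
  rewrite evND !evNZ !evNM !evNX scalerA; congr (_ + _ *: _).
  by rewrite mulrC.
rewrite scalerDr -!addrA [LHS]addrCA [RHS]addrCA; congr (_ + _).
  by rewrite scaler_sumr; apply: eq_bigr => i _; rewrite scaler_sumr; apply: eq_bigr => j _; rewrite scaler_sumr.
rewrite !scaler_sumr -!big_split; apply: eq_bigr => l _ /=.
rewrite evNZ evNM evNX.
have -> : \sum_(i < K) \sum_(j < K | l == (i + j).+1 :> nat)
      l.+1%:R *: (G l * (psum_mpoly i.+1 * psum_mpoly j.+1))
  = l.+1%:R *: (G l * \sum_(i < K) \sum_(j < K | l == (i + j).+1 :> nat)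
      (psum_mpoly i.+1 * psum_mpoly j.+1)).
  rewrite mulr_sumr scaler_sumr; apply: eq_bigr => i _.
  by rewrite mulr_sumr scaler_sumr.
rewrite -/(G l) -!mul_mpolyC !(mpolyCB, mpolyCM, mpolyC_nat, mpolyC1, natrM).
by rewrite -natr1 -[l.+2%:R]natr1 -[l.+1%:R]natr1; ring.
Qed.

End Evaluation.

(** * Partitions and monomial symmetric functions *)

Section PartitionFacts.
Implicit Types (s u : seq nat).

Lemma is_part_sorted s : is_part s -> sorted geq s. Proof. by case/andP. Qed.

Lemma is_part_neq0 s : is_part s -> 0%N \notin s. Proof. by case/andP. Qed.

Lemma intpartn_part n (lam : intpartn n) : is_part lam.
Proof. by case/andP: (valP lam). Qed.

Lemma intpartn_sumn n (lam : intpartn n) : sumn lam = n.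
Proof. by case/andP: (valP lam) => _ /eqP. Qed.

Lemma size_intpartn n (lam : intpartn n) : (size lam <= n)%N.
Proof.
by rewrite -[leqRHS](intpartn_sumn lam) size_part_le // is_part_neq0 // intpartn_part.
Qed.

Lemma part_eq_nth s u : is_part s -> is_part u ->
  (forall i, nth 0%N s i = nth 0%N u i) -> s = u.
Proof.
move=> sp up e; have sz v w : is_part v -> (forall i, nth 0%N v i = nth 0%N w i) ->
    (size v <= size w)%N.
  move=> vp evw; rewrite leqNgt; apply/negP => lt.
  have /negP := is_part_neq0 vp; apply.
  by have := mem_nth 0%N lt; rewrite evw nth_default.
apply: (@eq_from_nth _ 0%N) => [|i _]; last exact: e.
by apply/eqP; rewrite eqn_leq !sz // => i; rewrite e.
Qed.

Lemma part_perm_eq s u : is_part s -> is_part u -> perm_eq s u -> s = u.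
Proof.
move=> /is_part_sorted ss /is_part_sorted su; apply: (sorted_eq (leT := geq)) => //.
- by move=> y x z /= yx zy; apply: leq_trans yx.
- by move=> x y /=; rewrite -eqn_leq => /eqP ->.
Qed.

(** By [nstat_weighted], [nstat] and the sum of all partial sums add up to a constant, so [nstat]
    strictly decreases upwards in the dominance order. *)
Lemma part_excess_rigid s u : is_part s -> is_part u -> sumn s = sumn u ->
  (forall x, excess_seq x s <= excess_seq x u)%N -> (nstat s <= nstat u)%N -> s = u.
Proof.
move=> sp up su le le_n; pose N := maxn (size s) (size u).
have sN : (size s <= N)%N by rewrite leq_maxl.
have uN : (size u <= N)%N by rewrite leq_maxr.
have mp := @psum_le_of_excess (nth 0%N s) u N (is_part_sorted up).
have {}mp : forall k, (k <= N)%N -> (psum (nth 0 s) k <= psum (nth 0 u) k)%N.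
  by apply: mp => x; rewrite (@sum_nth_pad (fun y => y - x)%N) //; apply: le.
apply: part_eq_nth => // i; case: (ltnP i N) => iN; last first.
  by rewrite !nth_default //; apply: leq_trans iN.
apply: psum_rigid mp _ i iN; rewrite -(leq_add2r (nstat u)).
rewrite {1}(nstat_pad uN) nstat_weighted (@sum_nth_pad id) // -sumnE -su.
apply: leq_trans (leq_add (leqnn _) le_n).
by rewrite (nstat_pad sN) nstat_weighted (@sum_nth_pad id) // -sumnE.
Qed.

(** The [N] exponents already sum to [|u|], so the first [N] parts of [u] do as well and leave
    nothing for a further non-zero part. *)
Lemma size_le_of_excess N (m : 'X_{1..N}) u : is_part u -> mdeg m = sumn u ->
  (forall x, excess x m <= excess_seq x u)%N -> (size u <= N)%N.
Proof.
move=> up md me; rewrite leqNgt; apply/negP => lN.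
have me' x : (\sum_(i < N) (nth 0 m i - x) <= excess_seq x u)%N.
  apply: leq_trans (me x).
  by rewrite /excess; apply: eq_leq; apply: eq_bigr => i _; rewrite (mnm_nth 0).
have := psum_le_of_excess (is_part_sorted up) me' (leqnn N).
have -> : psum (nth 0%N m) N = sumn u.
  by rewrite -md mdegE; apply: eq_bigr => i _; rewrite (mnm_nth 0).
rewrite leqNgt => /negP; apply.
rewrite sumnE -(@sum_nth_pad id _ (size u)) // -(big_mkord xpredT (nth 0%N u)).
rewrite (@big_cat_nat _ _ _ N) //=; last exact: ltnW.
rewrite big_mkord -/(psum (nth 0%N u) N) -addn1 leq_add2l big_ltn //.
apply: leq_trans (leq_addr _ _).
by rewrite lt0n; apply: contraNneq (is_part_neq0 up) => <-; rewrite mem_nth.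
Qed.

Lemma psum_take s k : psum (nth 0%N s) k = sumn (take k s).
Proof.
elim: s k => [|x s IH] [|k]; rewrite /psum ?big_ord0 //=.
  by rewrite big1 // => i _; rewrite nth_nil.
by rewrite big_ord_recl -IH.
Qed.

Lemma dom_lt_excess n (mu lam : intpartn n) x : dom_lt mu lam ->
  (excess_seq x mu <= excess_seq x lam)%N.
Proof.
case/andP=> _ /forallP dm; apply: excess_le_of_psum.
- exact/is_part_sorted/intpartn_part.
- exact/is_part_sorted/intpartn_part.
move=> j js; rewrite !psum_take.
have jn : (j < n.+1)%N by rewrite ltnS (leq_trans js) // size_intpartn.
exact: (dm (Ordinal jn)).
Qed.

End PartitionFacts.

Section MonomialSymmetric.
Variables (F : fieldType) (N : nat).
Implicit Types (s u : seq nat) (m : 'X_{1..N}).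

Lemma mcoeff_monomial_sym s m : (monomial_sym F N s)@_m =
  ((mdeg m < (sumn s).+1)%N && perm_eq [seq j <- m | j != 0%N] s)%:R.
Proof.
rewrite /monomial_sym raddf_sum /=; case: (ltnP (mdeg m) (sumn s).+1) => h /=.
  have [pm|pm] := boolP (perm_eq _ _).
    rewrite (bigD1 (BMultinom h)) //= mcoeffX eqxx big1 ?addr0 // => e /andP[_ ne].
    rewrite mcoeffX; case: eqP => // e'; move/eqP: ne; case.
    by apply/val_inj.
  rewrite big1 // => e pe; rewrite mcoeffX; case: eqP => // e'.
  by rewrite -e' pe in pm.
rewrite big1 // => e _; rewrite mcoeffX; case: eqP => // e'.
by have := bmdeg e; rewrite e' ltnNge h.
Qed.

Lemma sum_mnm_filter (f : nat -> nat) m : f 0%N = 0%N ->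
  (\sum_(i < N) f (m i) = \sum_(j <- [seq j <- m | j != 0]) f j)%N.
Proof.
move=> f0; rewrite big_filter -(big_tuple _ _ (multinom_val m) xpredT f) //.
rewrite (bigID (fun j => j != 0%N)) /= [X in (_ + X)%N]big1 ?addn0 // => j.
by rewrite negbK => /eqP ->.
Qed.

Lemma monomial_sym_supp s m : (monomial_sym F N s)@_m != 0 ->
  mdeg m = sumn s /\ forall x, excess x m = excess_seq x s.
Proof.
rewrite mcoeff_monomial_sym; case: andP => [[_ pm] _|]; last by rewrite eqxx.
split.
  rewrite mdegE (@sum_mnm_filter id) // (perm_big _ pm) /=.
  by rewrite sumnE.
by move=> x; rewrite /excess (@sum_mnm_filter (fun y => y - x)%N) // (perm_big _ pm).
Qed.

Lemma filter_mpart s : is_part s -> (size s <= N)%N ->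
  [seq j <- mpart N s | j != 0%N] = s.
Proof.
move=> sp sN.
have -> : mpart N s = mkseq (nth 0%N s) N :> seq nat.
  apply: (@eq_from_nth _ 0%N); first by rewrite size_tuple size_mkseq.
  move=> i; rewrite size_tuple => iN; rewrite nth_mkseq //.
  by rewrite -[i]/(nat_of_ord (Ordinal iN)) -mnm_nth mnmE.
have -> : mkseq (nth 0%N s) N = s ++ nseq (N - size s) 0%N.
  apply: (@eq_from_nth _ 0%N) => [|i]; first by rewrite size_mkseq size_cat size_nseq subnKC.
  rewrite size_mkseq => iN; rewrite nth_mkseq // nth_cat nth_nseq.
  by case: ltnP => // si; rewrite nth_default //; case: ifP.
rewrite filter_cat filter_nseq cats0; apply/all_filterP/allP => j js.
by apply: contraNneq (is_part_neq0 sp) => <-.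
Qed.

Lemma mcoeff_monomial_sym_mpart s u : is_part s -> is_part u -> (size s <= N)%N ->
  (monomial_sym F N u)@_(mpart N s) = (s == u)%:R.
Proof.
move=> sp up sN; rewrite mcoeff_monomial_sym filter_mpart // mdeg_mpart // ltnS.
case: (eqVneq s u) => [->|ne]; first by rewrite leqnn perm_refl.
by case: andP => // -[_ /(part_perm_eq sp up) e]; rewrite e eqxx in ne.
Qed.

End MonomialSymmetric.

(** * Coordinates on partitions as polynomials in the power sums *)

Section Embedding.
Variables (F : fieldType) (k : nat) (a : F).
Notation K := k.+1.
Notation P := {mpoly F[K]}.
Implicit Types (s : seq nat) (d : nat).

Definition pmult s : 'X_{1..K} := [multinom count_mem i.+1 s | i < K].

Lemma part_bound s x : is_part s -> (sumn s <= K)%N -> x \in s -> (0 < x <= K)%N.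
Proof.
move=> sp sK xs; rewrite lt0n (leq_trans (part_le_sumn xs) sK) andbT.
by apply: contraNneq (is_part_neq0 sp) => <-.
Qed.

Lemma pmult_nil : pmult [::] = 0%MM.
Proof. by apply/mnmP => i; rewrite !mnmE. Qed.

Lemma pmult_cons x s (xK : (x.-1 < K)%N) : (0 < x)%N ->
  pmult (x :: s) = (U_(Ordinal xK) + pmult s)%MM.
Proof.
move=> x0; apply/mnmP => i; rewrite !mnmE /= -val_eqE /=.
by congr (nat_of_bool _ + _)%N; apply/eqP/eqP; lia.
Qed.

Lemma pmult_ind (Q : seq nat -> 'X_{1..K} -> Prop) :
  Q [::] 0%MM ->
  (forall x s (i : 'I_K), x = i.+1 -> Q s (pmult s) -> Q (x :: s) (U_(i) + pmult s)%MM) ->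
  forall s, (forall x, x \in s -> 0 < x <= K)%N -> Q s (pmult s).
Proof.
move=> Q0 QS; elim=> [|x s IH] sb; first by rewrite pmult_nil.
have /andP[x0 xK] := sb x (mem_head _ _).
have xK' : (x.-1 < K)%N by lia.
rewrite (pmult_cons s xK' x0); apply: QS => /=; first by lia.
by apply: IH => y ys; apply: sb; rewrite inE ys orbT.
Qed.

Lemma mnmwgt_pmult s : (forall x, x \in s -> 0 < x <= K)%N -> mnmwgt (pmult s) = sumn s.
Proof.
apply: (@pmult_ind (fun s m => mnmwgt m = sumn s)) => [|x {}s i -> IH].
  exact: mnmwgt0.
by rewrite mnmwgtD mnmwgt1 IH.
Qed.

Lemma mdeg_pmult s : (forall x, x \in s -> 0 < x <= K)%N -> mdeg (pmult s) = size s.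
Proof.
apply: (@pmult_ind (fun s m => mdeg m = size s)) => [|x {}s i _ IH].
  exact: mdeg0.
by rewrite mdegD mdeg1 IH.
Qed.

Lemma power_sum_evN N s : (forall x, x \in s -> 0 < x <= K)%N ->
  power_sum F N s = evN N 'X_[pmult s].
Proof.
apply: (@pmult_ind (fun s m => power_sum F N s = evN N 'X_[m])) => [|x {}s i -> IH].
  by rewrite /power_sum big_nil mpolyX0 /evN rmorph1.
by rewrite /power_sum big_cons -/(power_sum F N s) IH mpolyXD evNM evNX.
Qed.

Lemma pmult_inj s u : is_part s -> is_part u -> (sumn s <= K)%N -> (sumn u <= K)%N ->
  pmult s = pmult u -> s = u.
Proof.
move=> sp up sK uK e; apply: part_perm_eq => //; apply/allP => x xs /=.
have /andP[x0 xK] : (0 < x <= K)%N.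
  by move: xs; rewrite mem_cat => /orP[]; apply: part_bound.
have xK' : (x.-1 < K)%N by lia.
have /mnmP/(_ (Ordinal xK')) := e; rewrite !mnmE /= prednK // => ->.
by rewrite eqxx.
Qed.

Lemma pmult_surj d (m : 'X_{1..K}) : mnmwgt m = d ->
  exists mu : intpartn d, pmult mu = m.
Proof.
move=> md; pose s := flatten [seq nseq (m i) i.+1 | i : 'I_K].
pose u := sort geq s.
have cs (i : 'I_K) : count_mem i.+1 s = m i.
  rewrite count_flatten -map_comp sumnE big_map big_enum /= (bigD1 i) //=.
  rewrite count_nseq /= eqxx mul1n big1 ?addn0 // => j /negPf ji.
  by rewrite count_nseq /= eqSS val_eqE ji mul0n.
have u0 : is_part u.
  rewrite /is_part /u sort_sorted => [|x y]; last by rewrite /= leq_total.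
  rewrite mem_sort; apply/flattenP => -[v /mapP[i _ ->]].
  by rewrite mem_nseq => /andP[_ /eqP].
have um : pmult u = m.
  apply/mnmP => i; rewrite mnmE -cs; by apply/seq.permP; rewrite perm_sort.
have ub x : x \in u -> (0 < x <= K)%N.
  rewrite mem_sort => /flattenP[v /mapP[i _ ->]].
  by rewrite mem_nseq => /andP[_ /eqP ->]; rewrite ltn_ord.
have hu : is_part u && (sumn u == d) by rewrite u0 -(mnmwgt_pmult ub) um md eqxx.
by exists (IntPartn hu).
Qed.

Lemma pweight_pmult s : is_part s -> (sumn s <= K)%N ->
  pweight a (pmult s) = a ^+ size s * (zpart s)%:R.
Proof.
move=> sp sK; have sb x := @part_bound s x sp sK.
rewrite /pweight /zpart -(mdeg_pmult sb) mdegE -prodrXr natr_prod.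
have -> : \prod_(1 <= i < (sumn s).+1) (i ^ count_mem i s * (count_mem i s)`!)%:R
    = \prod_(i < K) ((i.+1)%:R ^+ pmult s i * (pmult s i)`!%:R) :> F.
  transitivity (\prod_(1 <= i < K.+1) (i%:R ^+ count_mem i s * (count_mem i s)`!%:R) : F).
    rewrite [RHS](@big_cat_nat _ _ _ (sumn s).+1) //= [X in _ = _ * X]big_nat.
    rewrite [X in _ = _ * X]big1 ?mulr1 => [|i /andP[si _]].
      by apply: eq_bigr => i _; rewrite natrM natrX.
    have -> : count_mem i s = 0%N.
      by apply/count_memPn; apply/negP => /part_le_sumn; rewrite leqNgt si.
    by rewrite expr0 mul1r.
  by rewrite big_add1 big_mkord; apply: eq_bigr => i _; rewrite mnmE.
rewrite -big_split; apply: eq_bigr => i _ /=.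
by rewrite exprMn mulrA.
Qed.

Definition emb d (f : {ffun intpartn d -> F}) : P :=
  \sum_(mu : intpartn d) f mu *: 'X_[pmult mu].

Lemma emb_coef d (f : {ffun intpartn d -> F}) (mu : intpartn d) : (d <= K)%N ->
  (emb f)@_(pmult mu) = f mu.
Proof.
move=> dK; rewrite /emb raddf_sum (bigD1 mu) //= mcoeffZ mcoeffX eqxx mulr1.
rewrite big1 ?addr0 // => nu ne; rewrite mcoeffZ mcoeffX.
case: eqP => [|_]; last by rewrite mulr0.
move/pmult_inj => e; move/eqP: ne; case; apply/val_inj; apply: e.
- exact: intpartn_part.
- exact: intpartn_part.
- by rewrite intpartn_sumn.
- by rewrite intpartn_sumn.
Qed.

Lemma emb_whomog d (f : {ffun intpartn d -> F}) : (d <= K)%N ->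
  emb f \is d.-homog for (@mnmwgt K).
Proof.
move=> dK; apply: rpred_sum => mu _; apply: rpredZ; rewrite dhomogX /= mnmwgt_pmult.
  by rewrite intpartn_sumn.
by move=> x; apply: part_bound; rewrite ?intpartn_sumn // intpartn_part.
Qed.

Lemma evN_emb N d (f : {ffun intpartn d -> F}) : (d <= K)%N ->
  evN N (emb f) = symf_eval N f.
Proof.
move=> dK; rewrite evN_sum; apply: eq_bigr => mu _; rewrite evNZ power_sum_evN //.
by move=> x; apply: part_bound; rewrite ?intpartn_sumn // intpartn_part.
Qed.

Lemma pdot_emb d (f g : {ffun intpartn d -> F}) : (d <= K)%N ->
  pdot a (emb f) (emb g) = symf_dot a f g.
Proof.
move=> dK; rewrite {1}/emb pdot_suml; apply: eq_bigr => mu _.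
rewrite pdotZl pdotX emb_coef // pweight_pmult ?intpartn_part ?intpartn_sumn //.
by ring.
Qed.

Lemma whomog_eq d (f g : P) : f \is d.-homog for (@mnmwgt K) ->
  g \is d.-homog for (@mnmwgt K) ->
  (forall mu : intpartn d, f@_(pmult mu) = g@_(pmult mu)) -> f = g.
Proof.
move=> /whomogP fd /whomogP gd fg; apply/mpolyP => m.
case: (eqVneq (mnmwgt m) d) => [/pmult_surj[mu <-] //|md].
rewrite !memN_msupp_eq0 //; first by apply: contraNN md => /gd ->.
by apply: contraNN md => /fd ->.
Qed.

End Embedding.

(** * Jack functions as eigenvectors *)

Section Jack.
Variables (F : fieldType) (k : nat) (a : F).
Hypothesis gen_a : generic a.
Variable J : forall n : nat, intpartn n -> {ffun intpartn n -> F}.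
Hypothesis hJ : is_jack a J.
Notation K := k.+1.
Notation P := {mpoly F[K]}.
Implicit Types (s : seq nat) (d : nat).

Lemma generic_neq0 A B : (0 < A + B)%N -> a * A%:R + B%:R != 0.
Proof.
move=> AB; apply/eqP => e; have [|A0 B0] := @gen_a A B 0 0; last by rewrite A0 B0 in AB.
by rewrite e mulr0 addr0.
Qed.

Lemma natr_neq0 A : (0 < A)%N -> A%:R != 0 :> F.
Proof. by move=> A0; have := @generic_neq0 0 A A0; rewrite mulr0 add0r. Qed.

Lemma a_neq0 : a != 0.
Proof. by have := @generic_neq0 1 0 isT; rewrite mulr1 addr0. Qed.

Lemma hook_neq0 s : hook a s != 0.
Proof.
apply/prodf_neq0 => i _; apply/prodf_neq0 => j _.
by rewrite -addrA natr1 generic_neq0 // addnS.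
Qed.

Lemma hook'_neq0 s : hook' a s != 0.
Proof.
apply/prodf_neq0 => i _; apply/prodf_neq0 => j _.
by rewrite nat1r generic_neq0 // addSn.
Qed.

(* Indexed by plain sequences, to avoid transport between the types [intpartn d]. *)
Definition jackP s : P :=
  oapp (fun lam : intpartn (sumn s) => emb k (J lam)) 0 (insub s).

Lemma jackPE d (lam : intpartn d) : jackP lam = emb k (J lam).
Proof.
case: lam => s sp /=; have e : d = sumn s by case/andP: (sp) => _ /eqP.
move: sp; rewrite {}e => sp; rewrite /jackP insubT /=; by congr (emb k (J _)).
Qed.

Lemma jackP_whomog d (lam : intpartn d) : (d <= K)%N ->
  jackP lam \is d.-homog for (@mnmwgt K).
Proof. by move=> dK; rewrite jackPE emb_whomog. Qed.

Lemma jackP_orth d (lam mu : intpartn d) : (d <= K)%N -> lam != mu ->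
  pdot a (jackP lam) (jackP mu) = 0.
Proof.
by move=> dK ne; rewrite !jackPE pdot_emb // (jack_orthogonal hJ).
Qed.

Lemma evN_jackP N d (lam : intpartn d) : (d <= K)%N ->
  exists u : intpartn d -> F, evN N (jackP lam) =
    hook a lam *: monomial_sym F N lam
    + \sum_(mu : intpartn d | dom_lt mu lam) u mu *: monomial_sym F N mu.
Proof.
move=> dK; have [u e] := jack_triangular hJ lam; exists u.
by rewrite jackPE evN_emb.
Qed.

Lemma jackP_supp N d (lam : intpartn d) (m : 'X_{1..N}) : (d <= K)%N ->
  m \in msupp (evN N (jackP lam)) ->
  mdeg m = d /\ forall x, (excess x m <= excess_seq x lam)%N.
Proof.
move=> dK; rewrite mcoeff_msupp; have [u ->] := evN_jackP N lam dK.
rewrite mcoeffD mcoeffZ [X in _ + X]raddf_sum /=.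
have [->|nz] := eqVneq (monomial_sym F N lam)@_m 0; last first.
  by have [-> ex _] := monomial_sym_supp nz; rewrite intpartn_sumn; split=> // x; rewrite ex.
rewrite mulr0 add0r => nz.
have [mu /andP[ml nz1]] : exists mu : intpartn d, dom_lt mu lam && ((monomial_sym F N mu)@_m != 0).
  case: (pickP (fun mu : intpartn d => dom_lt mu lam && ((monomial_sym F N mu)@_m != 0))).
    by move=> mu h; exists mu.
  move=> h; move/eqP: nz; case; rewrite big1 // => mu ml.
  by have := h mu; rewrite ml /= mcoeffZ => /negbFE/eqP ->; rewrite mulr0.
have [-> ex] := monomial_sym_supp nz1; rewrite intpartn_sumn; split=> // x.
by rewrite ex dom_lt_excess.
Qed.

Lemma jackP_lead N d (lam : intpartn d) : (d <= K)%N -> (size lam <= N)%N ->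
  (evN N (jackP lam))@_(mpart N lam) = hook a lam.
Proof.
move=> dK lN; have [u ->] := evN_jackP N lam dK.
rewrite mcoeffD mcoeffZ mcoeff_monomial_sym_mpart ?intpartn_part // eqxx mulr1.
rewrite raddf_sum big1 ?addr0 // => mu /andP[ne _] /=.
rewrite mcoeffZ mcoeff_monomial_sym_mpart ?intpartn_part //.
by case: eqP => [e|_]; rewrite ?mulr0 //; case/eqP: ne; apply/val_inj.
Qed.

Lemma jackP_homog N d (lam : intpartn d) : (d <= K)%N ->
  evN N (jackP lam) \is d.-homog.
Proof. by move=> dK; apply/dhomogP => m /(jackP_supp dK)[]. Qed.

Lemma jackP_small N d (lam : intpartn d) : (d <= K)%N -> (N < size lam)%N ->
  evN N (jackP lam) = 0.
Proof.
move=> dK Nl; apply/eqP; rewrite -msupp_eq0; case E : (msupp _) => [//|m t].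
have /(jackP_supp dK)[md me] : m \in msupp (evN N (jackP lam)) by rewrite E inE eqxx.
have := size_le_of_excess (intpartn_part lam) _ me.
by rewrite intpartn_sumn leqNgt Nl => /(_ md).
Qed.

(** If the leading monomial of [kap] cancels in the sum, another [J_mu] with non-zero coefficient
    contains it, and [mu] dominates [kap]. The climb continues from [mu] and stops because [nstat]
    drops. *)
Lemma jackP_triangular N d (t : intpartn d -> F) (kap : intpartn d) : (d <= K)%N ->
  t kap != 0 -> (size kap <= N)%N ->
  exists2 kap' : intpartn d, (forall x, (excess_seq x kap <= excess_seq x kap')%N)
    & (size kap' <= N)%N /\
      mpart N kap' \in msupp (\sum_(mu : intpartn d) t mu *: evN N (jackP mu)).
Proof.
move=> dK; have [n] := ubnP (nstat kap); elim: n kap => // n IH kap; rewrite ltnS => kn tk kN.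
have [h|h] := boolP (mpart N kap \in msupp (\sum_(mu : intpartn d) t mu *: evN N (jackP mu))).
  by exists kap.
have [mu /and3P[ne tmu mk]] : exists mu : intpartn d,
    [&& mu != kap, t mu != 0 & mpart N kap \in msupp (evN N (jackP mu))].
  case: (pickP (fun mu : intpartn d => [&& mu != kap, t mu != 0
     & mpart N kap \in msupp (evN N (jackP mu))])) => [mu h'|h']; first by exists mu.
  move/memN_msupp_eq0: h; rewrite raddf_sum (bigD1 kap) //= big1 => [|mu ne].
    rewrite mcoeffZ jackP_lead // addr0 => /eqP.
    by rewrite mulf_eq0 (negPf tk) (negPf (hook_neq0 _)).
  rewrite mcoeffZ; have := h' mu; rewrite ne /=.
  case: (eqVneq (t mu) 0) => [-> _|_ /= /negbT/memN_msupp_eq0 ->]; first by rewrite mul0r.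
  by rewrite mulr0.
have muN : (size mu <= N)%N.
  rewrite leqNgt; apply/negP => h'; move: mk.
  by rewrite (jackP_small dK h') msupp0.
have [_ ex] := jackP_supp dK mk.
have {}ex x : (excess_seq x kap <= excess_seq x mu)%N.
  by rewrite -(@excess_mpart N) // ex.
case: (@IH mu) => // [|kap' ex' h']; last by exists kap' => // x; apply: leq_trans (ex' x).
apply: leq_trans kn; rewrite ltnNge; apply/negP => le.
move/eqP: ne; case; apply/val_inj/esym; apply: part_excess_rigid ex le.
- exact: intpartn_part.
- exact: intpartn_part.
- by rewrite !intpartn_sumn.
Qed.

Lemma jackP_indep N d (t : intpartn d -> F) : (d <= K)%N ->
  \sum_(mu : intpartn d) t mu *: evN N (jackP mu) = 0 ->
  forall mu : intpartn d, (size mu <= N)%N -> t mu = 0.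
Proof.
move=> dK e mu muN; apply/eqP; apply: contraT => tmu.
by have [kap _ [_]] := jackP_triangular dK tmu muN; rewrite e msupp0.
Qed.

(** Independence in [d] variables, where no partition of [d] is lost, makes the square matrix of
    power sum coefficients invertible. *)
Lemma jackP_span d (f : P) : (d <= K)%N -> f \is d.-homog for (@mnmwgt K) ->
  exists t : intpartn d -> F, f = \sum_(mu : intpartn d) t mu *: jackP mu.
Proof.
move=> dK fd; pose n := #|{: intpartn d}|.
pose A := \matrix_(i < n, j < n) (jackP (enum_val i : intpartn d))@_(pmult k (enum_val j : intpartn d)).
have coefA (v : 'rV[F]_n) (j : 'I_n) : (v *m A) ord0 j =
    (\sum_(mu : intpartn d) v ord0 (enum_rank mu) *: jackP mu)@_(pmult k (enum_val j : intpartn d)).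
  rewrite mxE raddf_sum /= [RHS](reindex _ (onW_bij _ (enum_val_bij _))) /=.
  by apply: eq_bigr => i _; rewrite mxE mcoeffZ enum_valK.
have homS (t : intpartn d -> F) : \sum_(mu : intpartn d) t mu *: jackP mu
    \is d.-homog for (@mnmwgt K).
  by apply: rpred_sum => mu _; rewrite rpredZ // jackP_whomog.
have Aunit : A \in unitmx.
  rewrite -row_free_unit -kermx_eq0; apply/eqP/row_matrixP => i; rewrite row0.
  set v := row i _; have vA : v *m A = 0 by rewrite -row_mul mulmx_ker row0.
  have S0 : \sum_(mu : intpartn d) v ord0 (enum_rank mu) *: jackP mu = 0.
    apply: (@whomog_eq _ _ d) => // [|mu]; first exact: rpred0.
    by rewrite -[mu]enum_rankK -coefA vA mxE mcoeff0.
  have : \sum_(mu : intpartn d) v ord0 (enum_rank mu) *: evN d (jackP mu) = 0.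
    by rewrite -[RHS](evN0 F k d) -S0 evN_sum; apply: eq_bigr => mu _; rewrite evNZ.
  move=> /(jackP_indep dK) h; apply/rowP => j; rewrite [RHS]mxE.
  by have := h (enum_val j) (size_intpartn _); rewrite enum_valK.
pose w : 'rV[F]_n := \row_j f@_(pmult k (enum_val j : intpartn d)).
exists (fun mu => (w *m invmx A) ord0 (enum_rank mu)).
apply: (@whomog_eq _ _ d) => // mu.
by rewrite -[mu]enum_rankK -coefA mulmxKV // mxE.
Qed.

(** A [J_lam] of norm 0 would be orthogonal to its whole degree by [jackP_span], hence to every
    product of power sums, and all its coefficients would be 0. *)
Lemma jackP_norm_neq0 d (lam : intpartn d) : (d <= K)%N ->
  pdot a (jackP lam) (jackP lam) != 0.
Proof.
move=> dK; apply/eqP => n0.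
have orth (f : P) : f \is d.-homog for (@mnmwgt K) -> pdot a f (jackP lam) = 0.
  case/(jackP_span dK) => t ->; rewrite pdot_suml big1 // => mu _; rewrite pdotZl.
  by case: (eqVneq mu lam) => [->|ne]; rewrite ?n0 ?jackP_orth ?mulr0.
have z : jackP lam = 0.
  apply: (@whomog_eq _ _ d); [exact: jackP_whomog|exact: rpred0|move=> mu].
  have mud : 'X_[F, pmult k mu] \is d.-homog for (@mnmwgt K).
    rewrite dhomogX /= mnmwgt_pmult ?intpartn_sumn // => x.
    by apply: part_bound; rewrite ?intpartn_sumn // intpartn_part.
  have := orth _ mud; rewrite pdotX mcoeff0 => /eqP; rewrite mulf_eq0 => /orP[|/eqP //].
  rewrite /pweight prodf_seq_eq0 => /hasP[i _ /=].
  rewrite mulf_eq0 expf_eq0 mulf_eq0 (negPf a_neq0) (negPf (natr_neq0 _)) // andbF /=.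
  by rewrite (negPf (natr_neq0 (fact_gt0 _))).
have := jackP_lead (N := d) dK (size_intpartn lam).
by rewrite z evN0 mcoeff0 => /esym/eqP; rewrite (negPf (hook_neq0 _)).
Qed.

Lemma jackP_expand d (f : P) : (d <= K)%N -> f \is d.-homog for (@mnmwgt K) ->
  f = \sum_(mu : intpartn d) (pdot a f (jackP mu) / pdot a (jackP mu) (jackP mu)) *: jackP mu.
Proof.
move=> dK /(jackP_span dK)[t ->]; apply: eq_bigr => mu _; congr (_ *: _).
rewrite pdot_suml (bigD1 mu) //= big1 => [|nu ne].
  by rewrite addr0 pdotZl mulfK // jackP_norm_neq0.
by rewrite pdotZl jackP_orth // mulr0.
Qed.

Lemma pdot_jackP_sum d (t : intpartn d -> F) (mu : intpartn d) : (d <= K)%N ->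
  pdot a (\sum_(nu : intpartn d) t nu *: jackP nu) (jackP mu)
  = t mu * pdot a (jackP mu) (jackP mu).
Proof.
move=> dK; rewrite pdot_suml (bigD1 mu) //= big1 => [|nu ne].
  by rewrite addr0 pdotZl.
by rewrite pdotZl jackP_orth // mulr0.
Qed.

Lemma jackP_dominated N d (f : P) s (mu : intpartn d) : (d <= K)%N ->
  f \is d.-homog for (@mnmwgt K) -> (size mu <= N)%N ->
  (forall m x, m \in msupp (evN N f) -> (excess x m <= excess_seq x s)%N) ->
  pdot a f (jackP mu) != 0 -> forall x, (excess_seq x mu <= excess_seq x s)%N.
Proof.
move=> dK fd muN fs nz x.
pose t (mu : intpartn d) := pdot a f (jackP mu) / pdot a (jackP mu) (jackP mu).
have tmu : t mu != 0 by rewrite mulf_neq0 ?invr_neq0 // jackP_norm_neq0.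
have e : evN N f = \sum_(nu : intpartn d) t nu *: evN N (jackP nu).
  by rewrite {1}(jackP_expand dK fd) evN_sum; apply: eq_bigr => nu _; rewrite evNZ.
have [kap ex [kN]] := jackP_triangular dK tmu muN.
rewrite -e => /fs h; apply: leq_trans (ex x) _.
by rewrite -(@excess_mpart N).
Qed.

Lemma mpart_laplN N d (lam : intpartn d) (g : {mpoly F[N]}) : (size lam <= N)%N ->
  g \is d.-homog ->
  (forall m x, m \in msupp g -> (excess x m <= excess_seq x lam)%N) ->
  (laplN a g)@_(mpart N lam) = eigenN a N lam * g@_(mpart N lam).
Proof.
move=> lN /dhomogP gd gs; rewrite mcoeff_laplN_extremal.
- by rewrite extremal_coef_mpart.
- move=> i j ij; rewrite !mnmE; apply: sorted_nth; last exact: ltnW.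
  exact/is_part_sorted/intpartn_part.
move=> m mg; apply: sqsum_le_of_excess.
  by rewrite (gd _ mg) mdeg_mpart // intpartn_sumn.
by move=> x; rewrite excess_mpart // gs.
Qed.

(** Triangularity bounds from above the [J_nu] that occur in the image, self-adjointness bounds them
    from below, so only [nu = lam] remains. The eigenvalue is read off at the leading monomial, in
    [d] variables. *)
Lemma lapl_jackP d (lam : intpartn d) : (d <= K)%N ->
  lapl a (jackP lam) = content2 a lam *: jackP lam.
Proof.
move=> dK; have hd := jackP_whomog lam dK.
have ld (mu : intpartn d) := lapl_whomog a (jackP_whomog mu dK).
have dom (mu nu : intpartn d) : pdot a (lapl a (jackP mu)) (jackP nu) != 0 ->
    forall x, (excess_seq x nu <= excess_seq x mu)%N.
  apply: (jackP_dominated dK (ld mu) (size_intpartn nu)) => m x.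
  have e := laplN_evN d a dK (jackP_whomog mu dK).
  have -> : evN d (lapl a (jackP mu)) = laplN a (evN d (jackP mu))
      - (2%:R * (d%:R - 1) * d%:R) *: evN d (jackP mu) by rewrite e addrK.
  move=> /msuppB_le; rewrite mem_cat => /orP[|/msuppZ_le h].
    apply: laplN_excess => m' /(jackP_supp dK)[_]; exact.
  by have [_] := jackP_supp dK h; apply.
have off (nu : intpartn d) : nu != lam -> pdot a (lapl a (jackP lam)) (jackP nu) = 0.
  move=> ne; apply/eqP; apply: contraT => nz.
  have h1 := dom _ _ nz; have h2 : forall x, (excess_seq x lam <= excess_seq x nu)%N.
    by apply: dom; rewrite pdot_lapl pdotC.
  move/eqP: ne; case; apply/val_inj.
  have [le|le] := leqP (nstat nu) (nstat lam).
    by apply: part_excess_rigid h1 le; rewrite ?intpartn_part ?intpartn_sumn.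
  apply/esym; apply: part_excess_rigid h2 (ltnW le); by rewrite ?intpartn_part ?intpartn_sumn.
pose c := pdot a (lapl a (jackP lam)) (jackP lam) / pdot a (jackP lam) (jackP lam).
have e : lapl a (jackP lam) = c *: jackP lam.
  rewrite {1}(jackP_expand dK (ld lam)) (bigD1 lam) //= big1 ?addr0 // => nu ne.
  by rewrite off // mul0r scale0r.
rewrite e; congr (_ *: _).
have := laplN_evN d a dK hd; rewrite e evNZ -scalerDl.
move=> /(congr1 (mcoeff (mpart d lam))); rewrite mcoeffZ.
rewrite mpart_laplN ?size_intpartn ?jackP_homog //; last first.
  by move=> m x /(jackP_supp dK)[_]; apply.
have hz : (evN d (jackP lam))@_(mpart d lam) != 0.
  by rewrite jackP_lead ?size_intpartn // hook_neq0.
by move=> /(mulIf hz); rewrite /eigenN intpartn_sumn => /addIr.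
Qed.

Lemma laplN_jackP N d (lam : intpartn d) : (d <= K)%N ->
  laplN a (evN N (jackP lam)) = eigenN a N lam *: evN N (jackP lam).
Proof.
move=> dK; rewrite (laplN_evN N a dK (jackP_whomog lam dK)) lapl_jackP // evNZ.
by rewrite -scalerDl /eigenN intpartn_sumn.
Qed.

End Jack.

(** * Hook and content products *)

Section StripCombinatorics.
Implicit Types (s u : seq nat).

(** Deletes the first column of the diagram. *)
Definition strip s : seq nat := [seq x.-1 | x <- s & (1 < x)%N].

Lemma part_consP x s : is_part (x :: s) -> [/\ (0 < x)%N, is_part s & forall y, y \in s -> (y <= x)%N].
Proof.
case/andP=> /= ps; rewrite inE negb_or eq_sym -lt0n => /andP[x0 s0].
have tr : transitive geq by move=> y z t /= yz ty; apply: leq_trans yz.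
by split=> //; [rewrite /is_part (path_sorted ps)|apply/allP; apply: order_path_min ps].
Qed.

Lemma nth_strip s i : is_part s -> nth 0%N (strip s) i = (nth 0%N s i).-1.
Proof.
elim: s i => [|x s IH] i sp; first by rewrite !nth_nil.
have [x0 sp' le] := part_consP sp; rewrite /strip /=; case: ltnP => h.
  by case: i => //= i; apply: IH.
have -> : [seq y <- s | (1 < y)%N] = [::].
  rewrite -(filter_pred0 s); apply: eq_in_filter => y /le yx /=.
  by rewrite ltnNge (leq_trans yx h).
have le1 y : (y <= 1)%N -> 0%N = y.-1 by case: y => [|[]].
rewrite nth_nil; case: i => [|i] /=; first exact: le1.
case: (ltnP i (size s)) => si; last by rewrite nth_default.
by apply/le1/(leq_trans _ h)/le/mem_nth.
Qed.

Lemma sorted_of_nth s : (forall i j, (i <= j)%N -> (nth 0%N s j <= nth 0%N s i)%N) ->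
  sorted geq s.
Proof.
move=> h; case: s h => // x s h; apply/(pathP 0%N) => i si /=.
exact: (h i i.+1).
Qed.

Lemma strip_part s : is_part s -> is_part (strip s).
Proof.
move=> sp; rewrite /is_part; apply/andP; split.
  apply: sorted_of_nth => i j ij; rewrite !nth_strip //.
  by have := sorted_nth (is_part_sorted sp) ij; lia.
by apply/mapP => -[x]; rewrite mem_filter => /andP[]; lia.
Qed.

Lemma size_strip s : (size (strip s) <= size s)%N.
Proof. by rewrite size_map size_filter count_size. Qed.

Lemma sumn_strip s : is_part s -> sumn s = (sumn (strip s) + size s)%N.
Proof.
move=> sp; rewrite !sumnE -(@sum_nth_pad id _ (size s)) //.
rewrite -(@sum_nth_pad id (strip s) (size s)) ?size_strip //.
rewrite -[X in (_ + X)%N]muln1 -[X in (_ + X * _)%N]card_ord -sum_nat_const -big_split.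
apply: eq_bigr => i _ /=; rewrite nth_strip // addn1 prednK // lt0n.
by apply: contraNneq (is_part_neq0 sp) => <-; rewrite mem_nth.
Qed.

Lemma strip_inj s u : is_part s -> is_part u -> size s = size u -> strip s = strip u -> s = u.
Proof.
move=> sp up su e; apply: (@eq_from_nth _ 0%N) => // i si.
have := nth_strip i sp; rewrite e nth_strip // => h.
have [h1 h2] : (0 < nth 0 s i)%N /\ (0 < nth 0 u i)%N.
  split; rewrite lt0n; first by apply: contraNneq (is_part_neq0 sp) => <-; rewrite mem_nth.
  by apply: contraNneq (is_part_neq0 up) => <-; rewrite mem_nth -?su.
by rewrite -(prednK h1) -(prednK h2) h.
Qed.

Lemma ltn_nth_count s i j : sorted geq s ->
  (j < nth 0 s i)%N = (i < count (fun x => j < x) s)%N.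
Proof.
elim: s i => [|x s IH] i ss; first by rewrite nth_nil.
have tr : transitive geq by move=> y z t /= yz ty; apply: leq_trans yz.
have le : forall y, y \in s -> (y <= x)%N by apply/allP; apply: order_path_min ss.
have [h|h] := ltnP j x.
  by case: i => [|i] /=; rewrite h // add1n ltnS IH // (path_sorted ss).
have c0 : count (fun x => j < x)%N s = 0%N.
  apply/eqP; rewrite -leqn0 leqNgt -has_count; apply/hasPn => y /le yx.
  by rewrite -leqNgt (leq_trans yx h).
case: i => [|i] /=; rewrite [(j < x)%N]ltnNge h c0 //.
by rewrite IH ?(path_sorted ss) // c0 ltn0.
Qed.

Lemma count_strip s j : is_part s ->
  count (fun x => j < x)%N (strip s) = count (fun x => j.+1 < x)%N s.
Proof.
move=> sp; rewrite /strip count_map count_filter; apply: eq_count => x /=.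
by apply/andP/idP => [[]|]; lia.
Qed.

Lemma excess_strip s x : is_part s -> excess_seq x.+1 s = excess_seq x (strip s).
Proof.
move=> sp; rewrite /excess_seq -(@sum_nth_pad (fun y => y - x.+1)%N _ (size s)) //.
rewrite -(@sum_nth_pad (fun y => y - x)%N (strip s) (size s)) ?size_strip //.
by apply: eq_bigr => i _; rewrite nth_strip //; lia.
Qed.

End StripCombinatorics.

Section HookProducts.
Variables (F : fieldType) (a : F).
Implicit Types (s u : seq nat) (t : F).

Definition content_prod t s : F :=
  \prod_(i < size s) \prod_(j < nth 0%N s i) (t + a * j%:R - i%:R).

Lemma prod_boxes_pad (G : nat -> nat -> F) s N : (size s <= N)%N ->
  \prod_(i < size s) \prod_(j < nth 0%N s i) G i j
  = \prod_(i < N) \prod_(j < nth 0%N s i) G i j.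
Proof.
move=> sN; rewrite -!(big_mkord xpredT (fun i => \prod_(j < nth 0%N s i) G i j)).
rewrite [RHS](@big_cat_nat _ _ _ (size s)) //= [X in _ = _ * X]big_nat.
rewrite [X in _ = _ * X]big1 ?mulr1 // => i /andP[si _].
by rewrite nth_default // big_ord0.
Qed.

Lemma prod_boxes_strip (G : nat -> nat -> F) s : is_part s ->
  \prod_(i < size s) \prod_(j < nth 0%N s i) G i j
  = \prod_(i < size s) G i 0%N *
    \prod_(i < size (strip s)) \prod_(j < nth 0%N (strip s) i) G i j.+1.
Proof.
move=> sp; rewrite (prod_boxes_pad (fun i j => G i j.+1) (size_strip s)) -big_split.
apply: eq_bigr => i _ /=; rewrite nth_strip //.
have : (0 < nth 0 s i)%N.
  by rewrite lt0n; apply: contraNneq (is_part_neq0 sp) => <-; rewrite mem_nth.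
by case: (nth 0%N s i) => // p _; rewrite big_ord_recl.
Qed.

Lemma content_prod_strip t s : is_part s ->
  content_prod t s = \prod_(i < size s) (t - i%:R) * content_prod (t + a) (strip s).
Proof.
move=> sp; rewrite /content_prod (prod_boxes_strip (fun i j => t + a * j%:R - i%:R) sp); congr (_ * _).
  by apply: eq_bigr => i _; rewrite mulr0 addr0.
apply: eq_bigr => i _; apply: eq_bigr => j _; rewrite -natr1; ring.
Qed.

(** The smaller shape is viewed as the diagram without the last box of each row, so that, unlike in
    [content_prod_strip], [t] does not change. *)
Lemma content_prod_strip_last t s : is_part s ->
  content_prod t s =
    \prod_(i < size s) (t + a * (nth 0%N s i).-1%:R - i%:R) * content_prod t (strip s).
Proof.
move=> sp; rewrite /content_prod (prod_boxes_pad (fun i j => t + a * j%:R - i%:R) (size_strip s)) -big_split.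
apply: eq_bigr => i _ /=; rewrite nth_strip //.
have : (0 < nth 0 s i)%N.
  by rewrite lt0n; apply: contraNneq (is_part_neq0 sp) => <-; rewrite mem_nth.
case: (nth 0%N s i) => // p _; by rewrite big_ord_recr /= mulrC.
Qed.

(** The first box of row [i] has arm [s_i - 1] and leg [size s - i - 1], so its hook factor is the
    content factor of the last box of that row at [t = size s]. The other boxes keep their arms and
    legs. *)
Lemma hook_strip s : is_part s ->
  hook a s = \prod_(i < size s) ((size s)%:R + a * (nth 0%N s i).-1%:R - i%:R)
             * hook a (strip s).
Proof.
move=> sp; rewrite /hook (prod_boxes_strip (fun i j => a * (arm s i j)%:R + (leg s i j)%:R + 1) sp).
congr (_ * _).
  apply: eq_bigr => i _; rewrite /arm subn1 /leg.
  have -> : count (fun k => 0 < k)%N (drop i.+1 s) = (size s - i.+1)%N.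
    rewrite -size_drop; apply/eqP; rewrite -all_count; apply/allP => x /mem_drop xs.
    by rewrite lt0n; apply: contraNneq (is_part_neq0 sp) => <-.
  rewrite natrB // -natr1; ring.
apply: eq_bigr => i _; apply: eq_bigr => j _.
have -> : arm s i j.+1 = arm (strip s) i j by have := nth_strip i sp; rewrite /arm; lia.
have -> // : leg s i j.+1 = leg (strip s) i j.
rewrite /leg; apply/eqP; rewrite -(eqn_add2l (count (fun x => j.+1 < x)%N (take i.+1 s))).
rewrite -count_cat cat_take_drop.
have -> : count (fun x => j.+1 < x)%N (take i.+1 s) = count (fun x => j < x)%N (take i.+1 (strip s)).
  have is_ : (i < size (strip s))%N by [].
  have all1 v p : is_part v -> (i < size v)%N -> (p < nth 0 v i)%N ->
      count (fun x => p < x)%N (take i.+1 v) = i.+1.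
    move=> vp iv pv; rewrite (_ : count _ _ = size (take i.+1 v)); first by rewrite size_takel.
    apply/eqP; rewrite -all_count; apply/(all_nthP 0%N) => l; rewrite size_takel // => li.
    rewrite nth_take //; apply: leq_trans pv _.
    by apply: sorted_nth => //; apply: is_part_sorted.
  have js : (j < nth 0 (strip s) i)%N by [].
  rewrite !all1 ?strip_part //; last by have := nth_strip i sp; lia.
  exact: leq_trans (size_strip s).
by rewrite -count_cat cat_take_drop count_strip.
Qed.

Lemma hook_content_prod s : is_part s ->
  hook a s * content_prod (size s)%:R (strip s)
  = hook a (strip s) * content_prod (size s)%:R s.
Proof. by move=> sp; rewrite (hook_strip sp) (content_prod_strip_last _ sp); ring. Qed.

Lemma prod_boxes_cols (G : nat -> nat -> F) s M : sorted geq s ->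
  (forall x, x \in s -> (x <= M)%N) ->
  \prod_(i < size s) \prod_(j < nth 0%N s i) G i j
  = \prod_(j < M) \prod_(i < count (fun x => j < x)%N s) G i j.
Proof.
move=> ss sM; transitivity (\prod_(i < size s) \prod_(j < M | (j < nth 0 s i)%N) G i j).
  apply: eq_bigr => i _; rewrite (big_ord_widen M (G i)) //.
  by apply: sM; rewrite mem_nth.
rewrite (exchange_big_dep xpredT) //=; apply: eq_bigr => j _.
rewrite (big_ord_widen (size s) (fun i => G i j)) ?count_size //.
by apply: eq_bigl => i; rewrite ltn_nth_count.
Qed.

Lemma hook'_cons x s : hook' a (x :: s) =
  \prod_(j < x) (a * (1 + (arm (x :: s) 0 j)%:R) + (leg (x :: s) 0 j)%:R) * hook' a s.
Proof. by rewrite /hook' big_ord_recl. Qed.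

(** Column [j] of [M :: s] has one box more than column [j] of [s]. If [c] is the height of the
    latter, the extra content factor at [t = - M a] is [- (a (M - j) + c)], up to sign the [hook']
    factor of box [j] in the first row. *)
Lemma content_prod_top M s : is_part (M :: s) ->
  content_prod (- (M%:R * a)) (M :: s) * hook' a s
  = (-1) ^+ M * content_prod (- (M%:R * a)) s * hook' a (M :: s).
Proof.
move=> sp; have [M0 sp' le] := part_consP sp.
rewrite hook'_cons /content_prod (prod_boxes_cols (fun i j => - (M%:R * a) + a * j%:R - i%:R) (is_part_sorted sp) (M := M)); last first.
  by move=> x; rewrite inE => /orP[/eqP -> //|/le].
rewrite (prod_boxes_cols (fun i j => - (M%:R * a) + a * j%:R - i%:R) (is_part_sorted sp') le) !mulrA; congr (_ * _).
rewrite mulrAC -[X in (-1) ^+ X]card_ord -prodr_const -!big_split.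
apply: eq_bigr => j _ /=; rewrite ltn_ord add1n big_ord_recr /= mulrC; congr (_ * _).
rewrite /leg /arm /= drop0 natrB // -natr1; move: (count _ s) => c; ring.
Qed.

Lemma content_prod_big M s : (M < head 0 s)%N -> content_prod (- (M%:R * a)) s = 0.
Proof.
case: s => // x s /= Mx; rewrite /content_prod big_ord_recl /= (bigD1 (Ordinal Mx)) //=.
by rewrite subr0 [a * _]mulrC addNr !mul0r.
Qed.

Lemma content2_strip s : is_part s ->
  content2 a s = content2 a (strip s) + 2%:R * a * (sumn (strip s))%:R
                 - (size s)%:R * ((size s)%:R - 1).
Proof.
move=> sp; have pos (i : 'I_(size s)) : nth 0%N s i = (nth 0%N (strip s) i).+1.
  rewrite nth_strip // prednK // lt0n.
  by apply: contraNneq (is_part_neq0 sp) => <-; rewrite mem_nth.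
rewrite /content2 (nstat_pad (size_strip s)) /nstat sumnE.
rewrite -(@sum_nth_pad (fun k => k * k.-1)%N s (size s)) //.
rewrite -(@sum_nth_pad (fun k => k * k.-1)%N (strip s) (size s)) ?size_strip //.
rewrite -(@sum_nth_pad id (strip s) (size s)) ?size_strip //.
have -> : (\sum_(i < size s) nth 0 s i * (nth 0 s i).-1
   = \sum_(i < size s) nth 0 (strip s) i * (nth 0 (strip s) i).-1
     + 2 * \sum_(i < size s) nth 0 (strip s) i)%N.
  rewrite big_distrr -big_split; apply: eq_bigr => i _ /=; rewrite pos.
  by case: (nth 0%N (strip s) i) => //= p; nia.
have -> : (\sum_(i < size s) i * nth 0 s i
   = \sum_(i < size s) i * nth 0 (strip s) i + \sum_(i < size s) i)%N.
  by rewrite -big_split; apply: eq_bigr => i _ /=; rewrite pos mulnS addnC.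
have -> : (size s)%:R * ((size s)%:R - 1) = 2%:R * (\sum_(i < size s) i)%:R :> F.
  rewrite -natrM -(big_mkord xpredT id) bin2_sum.
  have := mul_bin_diag (size s) 1; rewrite bin1 => <-.
  by case: (size s) => [|n]; rewrite ?mul0r // natrM -natr1 addrK.
rewrite !natrD; rewrite ?natrM; ring.
Qed.

Lemma content2_cons M s :
  content2 a (M :: s) = a * (M * M.-1)%:R + content2 a s - 2%:R * (sumn s)%:R.
Proof.
rewrite /content2 big_cons natrD mulrDr.
have -> : nstat (M :: s) = (nstat s + sumn s)%N.
  rewrite /nstat big_ord_recl add0n sumnE -(@sum_nth_pad id s (size s)) // -big_split.
  by apply: eq_bigr => i _; rewrite /= mulSn addnC.
rewrite natrD; ring.
Qed.

End HookProducts.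

(** * Specialization and norm of Jack functions *)

Section JackStructure.
Variables (F : fieldType) (k : nat) (a : F).
Hypothesis gen_a : generic a.
Variable J : forall n : nat, intpartn n -> {ffun intpartn n -> F}.
Hypothesis hJ : is_jack a J.
Notation K := k.+1.
Notation P := {mpoly F[K]}.
Notation jackP := (jackP k J).
Implicit Types (s u : seq nat) (d : nat) (t : F) (f : P).

Lemma mk_intpartn s d : is_part s -> sumn s = d -> exists lam : intpartn d, lam = s :> seq nat.
Proof.
move=> sp sd; have h : is_part s && (sumn s == d) by rewrite sp sd eqxx.
by exists (IntPartn h).
Qed.

(** With exactly [size s] variables, [x_1 ... x_N] plays the role of the first column. By
    [laplN_mones] and [content2_strip] both sides are eigenvectors for the eigenvalue of [s]; the
    scalars make their coefficients at [mpart N s] agree, and [laplN_uniq] applies to the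
    difference. *)
Lemma jackP_strip s : is_part s -> (sumn s <= K)%N ->
  hook a (strip s) *: evN (size s) (jackP s)
  = hook a s *: ('X_[mones (size s)] * evN (size s) (jackP (strip s))).
Proof.
move=> sp sK; set N := size s.
have [lam el] := mk_intpartn sp (erefl (sumn s)).
have [mu em] := mk_intpartn (strip_part sp) (erefl (sumn (strip s))).
have sK' : (sumn (strip s) <= K)%N by rewrite (leq_trans _ sK) // (sumn_strip sp) leq_addr.
have sN' : (size (strip s) <= N)%N by exact: size_strip.
have onesN : 'X_[F, mones N] \is N.-homog.
  rewrite dhomogX /= mdegE (eq_bigr (fun=> 1%N)) => [|i _]; last by rewrite mnmE.
  by rewrite sum_nat_const card_ord muln1.
have hN : (N + sumn (strip s) = sumn s)%N by rewrite addnC /N -sumn_strip.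
have hmu := jackP_homog hJ N mu sK'.
have hlam := jackP_homog hJ N lam sK.
rewrite em in hmu; rewrite el in hlam.
apply/eqP; rewrite -subr_eq0; apply/eqP.
apply: (@laplN_uniq _ a N gen_a _ s (is_part_sorted sp) (is_part_neq0 sp)).
- rewrite rpredB // rpredZ ?evN_sym // rpredM ?evN_sym //; exact: mones_sym.
- rewrite rpredB // rpredZ // -hN; exact: dhomogM.
- move=> m x /msuppB_le; rewrite mem_cat => /orP[|] /msuppZ_le.
    by rewrite -el => /(jackP_supp hJ sK)[_]; apply.
  rewrite mulrC => mg; have mh : mdeg m = sumn s.
    have := dhomogM onesN hmu; rewrite mulrC hN => /dhomogP; exact.
  (* Threshold 0 sees only the degree; at a positive threshold the factor [x_1 ... x_N] lowers it by
     one. *)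
  case: x => [|x]; first by rewrite excess0 mh sumnE /excess_seq; under [leqRHS]eq_bigr do rewrite subn0.
  move: mg; rewrite (perm_mem (msuppMX _ _)) => /mapP[m' m'g ->].
  rewrite excess_strip //.
  have -> : excess x.+1 (mones N + m') = excess x m'.
    by apply: eq_bigr => i _; rewrite mnmDE mnmE add1n subSS.
  by move: m'g; rewrite -em => /(jackP_supp hJ sK')[_]; apply.
- rewrite [laplN a _]linearB /= [X in X - _]linearZ [X in _ - X]linearZ /= (laplN_mones a (evN_sym _ _) hmu).
  have := laplN_jackP gen_a hJ N lam sK; rewrite el => ->.
  have := laplN_jackP gen_a hJ N mu sK'; rewrite em => ->.
  have e : eigenN a N s = eigenN a N (strip s)
      + (2%:R * a * (sumn (strip s))%:R + N%:R * (N%:R - 1)).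
    by rewrite /eigenN content2_strip // [sumn s]sumn_strip // natrD; ring.
  by rewrite e -!mul_mpolyC !(mpolyCD, mpolyCM); ring.
move=> _; rewrite mcoeffB !mcoeffZ.
have := jackP_lead hJ (N := N) (lam := lam) sK; rewrite el => -> //.
have -> : mpart N s = (mones N + mpart N (strip s))%MM.
  apply/mnmP => i; rewrite mnmDE !mnmE nth_strip // add1n prednK // lt0n.
  by apply: contraNneq (is_part_neq0 sp) => <-; rewrite mem_nth.
rewrite ['X_[mones N] * _]mulrC mcoeffMX.
have := jackP_lead hJ (N := N) (lam := mu) sK'; rewrite em => -> //.
by rewrite mulrC subrr.
Qed.

(** The uniqueness argument again, now with [xtop_laplN] and [content2_cons]. Dominance at the
    threshold [M] keeps every exponent at most [M], as [xtop_laplN] demands. *)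
Lemma jackP_top N M u : is_part (M :: u) -> (sumn (M :: u) <= K)%N ->
  hook a u *: xtop M (evN N.+1 (jackP (M :: u))) = hook a (M :: u) *: evN N (jackP u).
Proof.
move=> sp sK; have [M0 up le] := part_consP sp.
have [lam el] := mk_intpartn sp (erefl (sumn (M :: u))).
have [mu em] := mk_intpartn up (erefl (sumn u)).
have uK : (sumn u <= K)%N by rewrite (leq_trans _ sK) //= leq_addl.
have hmu := jackP_homog hJ N mu uK; rewrite em in hmu.
have slam m : m \in msupp (evN N.+1 (jackP (M :: u))) -> mdeg m = (M + sumn u)%N
    /\ forall x, (excess x m <= excess_seq x (M :: u))%N.
  by rewrite -el => /(jackP_supp hJ sK) []; rewrite el.
have exM m i : m \in msupp (evN N.+1 (jackP (M :: u))) -> (m i <= M)%N.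
  move=> /slam[_ /(_ M)]; rewrite /excess_seq big_cons subnn add0n.
  rewrite big_seq big1 => [|x /le xM]; last by apply/eqP; rewrite subn_eq0.
  by rewrite leqn0 sum_nat_eq0 => /forallP/(_ i)/=; rewrite subn_eq0.
have stop m : m \in msupp (xtop M (evN N.+1 (jackP (M :: u)))) ->
    mnm_cons M m \in msupp (evN N.+1 (jackP (M :: u))).
  by rewrite !mcoeff_msupp mcoeff_xtop.
have htop : xtop M (evN N.+1 (jackP (M :: u))) \is (sumn u).-homog.
  apply/dhomogP => m /stop/slam[]; rewrite /= mdeg_mnm_cons => /addnI -> //.
apply/eqP; rewrite -subr_eq0; apply/eqP.
apply: (@laplN_uniq _ a N gen_a _ u (is_part_sorted up) (is_part_neq0 up)).
- by rewrite rpredB // rpredZ ?evN_sym // msym_xtop // evN_sym.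
- by rewrite rpredB // rpredZ.
- move=> m x /msuppB_le; rewrite mem_cat => /orP[|] /msuppZ_le.
    move=> /stop/slam[_ /(_ x)]; rewrite excess_mnm_cons /excess_seq big_cons.
    by rewrite leq_add2l.
  by rewrite -em => /(jackP_supp hJ uK)[_]; apply.
- rewrite [laplN a _]linearB /= [X in X - _]linearZ [X in _ - X]linearZ /=.
  have := laplN_jackP gen_a hJ N mu uK; rewrite em => ->.
  have := xtop_laplN a (fun m i => @exM m i).
  have := laplN_jackP gen_a hJ N.+1 lam sK; rewrite el => ->.
  rewrite linearZ /= => eL.
  have -> : laplN a (xtop M (evN N.+1 (jackP (M :: u)))) =
      eigenN a N.+1 (M :: u) *: xtop M (evN N.+1 (jackP (M :: u)))
      - (a * (M * M.-1)%:R + 2%:R * (N * M)%:R) *: xtop M (evN N.+1 (jackP (M :: u))).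
    by rewrite eL addrK.
  have e : eigenN a N.+1 (M :: u) = eigenN a N u + (a * (M * M.-1)%:R + 2%:R * (N * M)%:R).
    rewrite /eigenN content2_cons /= natrD natrM -natr1; ring.
  rewrite e -!mul_mpolyC !(mpolyCD, mpolyCM); ring.
move=> uN; rewrite mcoeffB !mcoeffZ mcoeff_xtop.
have -> : mnm_cons M (mpart N u) = mpart N.+1 (M :: u).
  apply/mnmP => i; rewrite [RHS]mnmE; case: (unliftP ord0 i) => [j|] ->.
    by rewrite mnm_consS mnmE.
  by rewrite mnm_cons0.
have := jackP_lead hJ (N := N.+1) (lam := lam) sK; rewrite el => -> //.
have := jackP_lead hJ (N := N) (lam := mu) uK; rewrite em => -> //.
by rewrite mulrC subrr.
Qed.

Lemma jackP_top0 N M s : is_part s -> (sumn s <= K)%N -> (head 0%N s < M)%N ->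
  xtop M (evN N.+1 (jackP s)) = 0.
Proof.
move=> sp sK hM; have [lam el] := mk_intpartn sp (erefl (sumn s)).
apply/mpolyP => m; rewrite mcoeff_xtop mcoeff0; apply/eqP; rewrite mcoeff_eq0.
apply/negP; rewrite -el => /(jackP_supp hJ sK)[_ /(_ (head 0%N s))]; rewrite el.
have -> : excess_seq (head 0%N s) s = 0%N.
  case: (s) sp => [|x v] sp /=; first by rewrite /excess_seq big_nil.
  have [_ _ le] := part_consP sp.
  rewrite /excess_seq big_seq big1 // => y; rewrite inE => /orP[/eqP ->|/le yx].
    by rewrite subnn.
  by apply/eqP; rewrite subn_eq0.
by rewrite excess_mnm_cons leqn0 addn_eq0 subn_eq0 leqNgt hM.
Qed.

(** The [J_nu] with at most [N] rows stay independent in [N] variables, so a relation there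
    determines their coordinates. *)
Lemma pdot_evN0 N d (f : P) (nu : intpartn d) : (d <= K)%N ->
  f \is d.-homog for (@mnmwgt K) -> evN N f = 0 -> (size nu <= N)%N ->
  pdot a f (jackP nu) = 0.
Proof.
move=> dK fd f0 nuN.
have e : \sum_(mu : intpartn d)
    (pdot a f (jackP mu) / pdot a (jackP mu) (jackP mu)) *: evN N (jackP mu) = 0.
  rewrite -[RHS]f0 [in RHS](jackP_expand gen_a hJ dK fd) evN_sum.
  by apply: eq_bigr => mu _; rewrite evNZ.
have := jackP_indep gen_a hJ dK e nuN => /eqP.
by rewrite mulf_eq0 invr_eq0 (negPf (jackP_norm_neq0 gen_a hJ _ dK)) orbF => /eqP.
Qed.

Lemma whomog_mderiv0 d (f : P) : f \is d.+1.-homog for (@mnmwgt K) ->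
  f^`M(ord0) \is d.-homog for (@mnmwgt K).
Proof.
by move=> /(whomog_mderiv ord0)[->|[_]]; rewrite ?rpred0 // subn1.
Qed.

Lemma two_neq0 : 2%:R != 0 :> F. Proof. exact: (natr_neq0 gen_a). Qed.

Lemma plowerE f : plower f = 2%:R^-1 *: ((lapl a f)^`M(ord0) - lapl a f^`M(ord0)) :> P.
Proof. by rewrite mderiv0_lapl addrC addKr scalerA mulVf ?two_neq0 // scale1r. Qed.

Lemma plower_whomog d f : f \is d.+1.-homog for (@mnmwgt K) ->
  plower f \is d.-homog for (@mnmwgt K).
Proof.
move=> fd; rewrite plowerE rpredZ // rpredB //.
  by apply/whomog_mderiv0/lapl_whomog.
by apply/lapl_whomog/whomog_mderiv0.
Qed.

Definition content s : F := content2 a s / 2%:R.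

(** [plower] is the commutator of [d/dp_1] with [D], so between two eigenvectors of [D] it
    multiplies the pairing by the difference of their eigenvalues. *)
Lemma pdot_lower t d (lam : intpartn d.+1) (mu : intpartn d) : (d < K)%N ->
  pdot a (t *: (jackP lam)^`M(ord0) + plower (jackP lam)) (jackP mu)
  = (t + (content lam - content mu)) * pdot a (jackP lam)^`M(ord0) (jackP mu).
Proof.
move=> dK; rewrite pdotDl pdotZl plowerE pdotZl -[- _]scaleN1r pdotDl pdotZl.
rewrite pdot_lapl (lapl_jackP gen_a hJ lam dK) (lapl_jackP gen_a hJ mu (ltnW dK)).
rewrite linearZ /= pdotZl pdotZr /content; field; exact: two_neq0.
Qed.

Lemma pdot_mulX0 d (lam : intpartn d.+1) (mu : intpartn d) :
  pdot a ('X_ord0 * jackP mu) (jackP lam)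
  = a * pdot a (jackP lam)^`M(ord0) (jackP mu).
Proof. by rewrite pdot_mulXl pdotC mulr1. Qed.

Lemma evN_lower N f : \sum_j (evN N f)^`M(j) = evN N (N%:R *: f^`M(ord0) + plower f) :> {mpoly F[N]}.
Proof. exact: sum_mderiv_evN. Qed.

(** If [mu] had more rows, [p_1 J_mu] would vanish in [size lam] variables and have no component
    along [J_lam]. *)
Lemma lower_size d (lam : intpartn d.+1) (mu : intpartn d) : (d < K)%N ->
  pdot a (jackP lam)^`M(ord0) (jackP mu) != 0 -> (size mu <= size lam)%N.
Proof.
move=> dK; apply: contraNT; rewrite -ltnNge => lt.
have := @pdot_evN0 (size lam) _ ('X_ord0 * jackP mu) lam dK.
rewrite evNM (jackP_small hJ (ltnW dK) lt) mulr0 pdot_mulX0 => /(_ _ erefl (leqnn _)).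
have -> : 'X_ord0 * jackP mu \is d.+1.-homog for (@mnmwgt K).
  exact: whomog_mulX (jackP_whomog J mu (ltnW dK)).
move=> /(_ isT)/eqP; by rewrite mulf_eq0 (negPf (a_neq0 gen_a)).
Qed.

(** In [N = size lam - 1] variables [J_lam] is 0, hence so is its image under [N d/dp_1 + plower].
    Pairing with [J_mu] gives [c_lam - c_mu = - N], the content of the first box in row [N].
    Genericity splits this into two equalities of integers, and dominance then shows that [lam] is
    [mu] with this box added. *)
Lemma lower_box1 d (lam : intpartn d.+1) (mu : intpartn d) : (d < K)%N ->
  pdot a (jackP lam)^`M(ord0) (jackP mu) != 0 -> (size mu < size lam)%N ->
  forall t, content_prod a t lam = (t + (content lam - content mu)) * content_prod a t mu.
Proof.
move=> dK nz szlt; have [N lN] : exists N, size lam = N.+1.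
  by case: (size lam) szlt => // N _; exists N.
rewrite lN ltnS in szlt.
have hl := jackP_whomog J lam dK.
have hlow N' : N'%:R *: (jackP lam)^`M(ord0) + plower (jackP lam)
    \is d.-homog for (@mnmwgt K).
  by rewrite rpredD ?plower_whomog // rpredZ // whomog_mderiv0.
have cN : content lam - content mu = - N%:R.
  have := pdot_evN0 (N := N) (ltnW dK) (hlow N) _ szlt.
  rewrite -evN_lower (jackP_small hJ dK) ?lN // big1 => [|i _]; last by rewrite linear0.
  move=> /(_ erefl)/eqP; rewrite pdot_lower // mulf_eq0 (negPf nz) orbF.
  by rewrite addrC addr_eq0 => /eqP.
have [eS en] : (\sum_(k0 <- lam) k0 * k0.-1 = \sum_(k0 <- mu) k0 * k0.-1)%N
    /\ (2 * (nstat mu + N) = 2 * nstat lam)%N.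
  apply: gen_a; rewrite !natrM natrD.
  have : content2 a lam - content2 a mu = - (2%:R * N%:R).
    have e2 : forall s, content2 a s = 2%:R * content s.
      by move=> s; rewrite /content; field; exact: two_neq0.
    by rewrite !e2 -mulrBr cN mulrN.
  rewrite /content2 => /(canRL (subrK _)) e.
  apply: (addIr (- (2%:R * (nstat lam)%:R))); rewrite addrAC e; ring.
have {}en : (nstat lam = nstat mu + N)%N by lia.
have dom x : (excess_seq x mu <= excess_seq x lam)%N.
  (* Large enough to keep [J_mu] alive and to make the factor [N' - N] of the pairing non-zero. *)
  pose N' := (N + d).+1.
  apply: (@jackP_dominated _ _ _ gen_a _ hJ N' _ _ lam mu (ltnW dK) (hlow N')).
  - by apply: leq_trans szlt _; rewrite /N'; lia.
  - move=> m y; rewrite -evN_lower mcoeff_msupp raddf_sum /= => nzs.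
    have [j nzj] : exists j, ((evN N' (jackP lam))^`M(j))@_m != 0.
      case: (pickP (fun j => ((evN N' (jackP lam))^`M(j))@_m != 0)) => [j|h]; first by exists j.
      by move/eqP: nzs; case; rewrite big1 // => j _; have := h j => /negbFE/eqP.
    have mj : (m + U_(j))%MM \in msupp (evN N' (jackP lam)).
      rewrite mcoeff_msupp; apply: contraNneq nzj; rewrite mcoeff_deriv => ->.
      by rewrite mul0rn.
    have [_ /(_ y)] := jackP_supp hJ dK mj; apply: leq_trans.
    by apply: leq_sum => i _; rewrite mnmDE leq_sub2r // leq_addr.
  have NN' : (N < N')%N by rewrite /N' ltnS leq_addr.
  rewrite pdot_lower // mulf_neq0 // cN -natrB ?(ltnW NN') //.
  by rewrite (natr_neq0 gen_a) // subn_gt0.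
have mup : (size mu <= N.+1)%N by lia.
have sumN : (\sum_(i < N) nth 0 mu i = d)%N.
  by rewrite (@sum_nth_pad id) // -sumnE intpartn_sumn.
have sumN1 : (\sum_(i < N.+1) nth 0 lam i = d.+1)%N.
  by rewrite (@sum_nth_pad id) ?lN // -sumnE intpartn_sumn.
have eqn : forall i, (i < N)%N -> nth 0%N mu i = nth 0%N lam i.
  apply: psum_rigid => [j jN|].
    apply: (psum_le_of_excess (N := N)) jN; first exact/is_part_sorted/intpartn_part.
    by move=> x; rewrite (@sum_nth_pad (fun y => y - x)%N) //; apply: dom.
  (* The length [l] of the last row of [lam] drops out: both weighted sums equal
     [N d - nstat mu]. *)
  have := nstat_weighted (nth 0%N mu) N; have := nstat_weighted (nth 0%N lam) N.
  rewrite -(nstat_pad szlt) sumN.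
  have := nstat_pad (N := N.+1) (s := lam); rewrite lN => /(_ (leqnn _)).
  rewrite big_ord_recr /=; move: sumN1; rewrite big_ord_recr /=.
  move: (\sum_(i < N) nth 0 lam i)%N (\sum_(i < N) i * nth 0 lam i)%N => S1 S2.
  move: (\sum_(i < N) (N - i) * nth 0 lam i)%N (\sum_(i < N) (N - i) * nth 0 mu i)%N => T1 T2.
  move: (nth 0%N lam N) => l; rewrite en; nia.
have lamN : nth 0%N lam N = 1%N.
  move: sumN1; rewrite big_ord_recr /= (eq_bigr (fun i : 'I_N => nth 0%N mu i)).
    by rewrite sumN -[RHS]addn1 => /addnI.
  by move=> i _; rewrite eqn.
move=> t; rewrite cN /content_prod lN big_ord_recr /= lamN big_ord_recr big_ord0 /= mul1r.
rewrite mulr0 addr0 mulrC; congr (_ * _).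
rewrite (prod_boxes_pad (fun i j => t + a * j%:R - i%:R) szlt).
by apply: eq_bigr => i _; rewrite eqn.
Qed.

(** In [N = size lam] variables, only [J_kap] with exactly [N] rows survive in the expansion of
    [p_1 J_mu]: longer ones vanish, shorter ones are excluded by [lower_size]. Hence [x_1 ... x_N]
    can be cancelled. The resulting relation is [f = 0], and its component along [J_lam'] links the
    two pairings. *)
Lemma lower_strip d (lam : intpartn d.+1) (mu : intpartn d) e
    (lam' : intpartn e.+1) (mu' : intpartn e) : (d < K)%N ->
  size mu = size lam -> lam' = strip lam :> seq nat -> mu' = strip mu :> seq nat ->
  pdot a (jackP lam)^`M(ord0) (jackP mu) != 0 ->
  pdot a (jackP lam')^`M(ord0) (jackP mu') != 0.
Proof.
move=> dK sz el em; apply: contraNneq => B0.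
set N := size lam.
have ed : (e.+1 + N = d.+1)%N.
  by rewrite -(intpartn_sumn lam') el -(sumn_strip (intpartn_part _)) intpartn_sumn.
have eK : (e < K)%N by lia.
pose psi (kap : intpartn d.+1) :=
  pdot a ('X_ord0 * jackP mu) (jackP kap) / pdot a (jackP kap) (jackP kap).
have hX : 'X_ord0 * jackP mu \is d.+1.-homog for (@mnmwgt K).
  exact: whomog_mulX (jackP_whomog J mu (ltnW dK)).
pose c (kap : intpartn d.+1) := psi kap * (hook a kap / hook a (strip kap)).
pose f : P := \sum_(kap : intpartn d.+1 | size kap == N) c kap *: jackP (strip kap)
   - (hook a mu / hook a (strip mu)) *: ('X_ord0 * jackP (strip mu)).
have stripd (kap : intpartn d.+1) : size kap = N -> exists2 kap' : intpartn e.+1,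
    kap' = strip kap :> seq nat & True.
  move=> kN; have [|kap' ek] := @mk_intpartn (strip kap) e.+1 (strip_part (intpartn_part kap)).
    have := sumn_strip (intpartn_part kap); rewrite kN intpartn_sumn; lia.
  by exists kap'.
have hf : f \is e.+1.-homog for (@mnmwgt K).
  rewrite rpredB // ?rpredZ //.
    apply: rpred_sum => kap /eqP/stripd[kap' <- _].
    by rewrite rpredZ // jackP_whomog.
  by rewrite -em; apply: whomog_mulX (jackP_whomog J mu' (ltnW eK)).
have stripE s : is_part s -> (sumn s <= K)%N -> evN (size s) (jackP s) =
    (hook a s / hook a (strip s)) *: ('X_[mones (size s)] * evN (size s) (jackP (strip s))).
  move=> sp sK; apply: (scalerI (hook_neq0 gen_a (strip s))).
  by rewrite jackP_strip // scalerA mulrCA divff ?mulr1 // hook_neq0.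
have f0 : evN N f = 0.
  apply: (mulfI (_ : 'X_[mones N] != 0 :> {mpoly F[N]})).
    by apply/eqP => /(congr1 (mcoeff (mones N))); rewrite mcoeffX eqxx mcoeff0 => /eqP; rewrite oner_eq0.
  rewrite mulr0 /f evND -scaleN1r !evNZ evNM evN_sum mulrDr scaleN1r mulrN.
  apply/eqP; rewrite subr_eq0 -scalerAr [_ * (evN N 'X_ord0 * _)]mulrCA scalerAr.
  have := stripE mu (intpartn_part mu); rewrite intpartn_sumn sz => /(_ (ltnW dK)) <-.
  rewrite -evNM (jackP_expand gen_a hJ dK hX) evN_sum [X in _ == X](bigID (fun kap : intpartn d.+1 => size kap == N)) /=.
  rewrite [X in _ + X]big1 ?addr0 => [|kap kN].
    rewrite mulr_sumr; apply/eqP; apply: eq_bigr => kap /eqP kN.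
    rewrite !evNZ -scalerAr /c -scalerA; congr (_ *: _).
    have := stripE kap (intpartn_part kap); rewrite intpartn_sumn kN => /(_ dK) -> //.
  rewrite evNZ; case: (ltnP N (size kap)) => h.
    by rewrite (jackP_small hJ dK h) scaler0.
  rewrite pdot_mulX0 (_ : pdot a _ _ = 0) ?mulr0 ?mul0r ?scale0r //.
  apply/eqP; apply: contraT => /(lower_size dK); rewrite sz => h'.
  by move: kN; rewrite eqn_leq h h'.
have l'N : (size lam' <= N)%N by rewrite el size_strip.
have := pdot_evN0 eK hf f0 l'N.
rewrite /f -scaleN1r pdotDl !pdotZl -em pdot_mulX0 B0 !mulr0 addr0.
rewrite pdot_suml (bigD1 lam) //= -el pdotZl big1 ?addr0 => [|kap /andP[/eqP kN ne]].
  move=> /eqP; rewrite mulf_eq0 (negPf (jackP_norm_neq0 gen_a hJ _ eK)) orbF.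
  rewrite /c /psi !mulf_eq0 !invr_eq0 !(negPf (hook_neq0 gen_a _)) !orbF.
  rewrite (negPf (jackP_norm_neq0 gen_a hJ _ dK)) orbF pdot_mulX0 mulf_eq0.
  by rewrite (negPf (a_neq0 gen_a)).
have [kap' ek _] := stripd kap kN; rewrite pdotZl -ek jackP_orth ?mulr0 //.
apply: contraNneq ne => e'; apply/eqP/val_inj; apply: strip_inj => //.
- exact: intpartn_part.
- exact: intpartn_part.
- by rewrite -ek e' -el.
Qed.

(* [p_1^perp] only removes boxes, as far as contents can tell. *)
Lemma lower_content_prod d (lam : intpartn d.+1) (mu : intpartn d) : (d < K)%N ->
  pdot a (jackP lam)^`M(ord0) (jackP mu) != 0 ->
  forall t, content_prod a t lam = (t + (content lam - content mu)) * content_prod a t mu.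
Proof.
have [n] := ubnP d; elim: n d lam mu => // n IH d lam mu; rewrite ltnS => dn dK nz t.
have := lower_size dK nz; rewrite leq_eqVlt => /orP[/eqP sz|]; last first.
  by move=> lt; apply: lower_box1.
have l0 : (0 < size lam)%N by case: (val lam) (intpartn_sumn lam).
have := sumn_strip (intpartn_part lam); have := sumn_strip (intpartn_part mu).
rewrite !intpartn_sumn sz => e1 e2.
have [mu' em] := mk_intpartn (strip_part (intpartn_part mu)) (erefl (sumn (strip mu))).
have [|lam' el] := @mk_intpartn (strip lam) (sumn (strip mu)).+1 (strip_part (intpartn_part lam)).
  by lia.
have h := lower_strip dK sz el em nz.
have := IH _ lam' mu' _ _ h (t + a); rewrite el em => IH'.
rewrite (content_prod_strip _ _ (intpartn_part lam)) (content_prod_strip _ _ (intpartn_part mu)).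
rewrite sz mulrCA; congr (_ * _); rewrite IH'; [|by lia|by lia].
congr (_ * _); rewrite -addrA; congr (_ + _); rewrite /content.
rewrite (content2_strip _ (intpartn_part lam)) (content2_strip _ (intpartn_part mu)) sz.
rewrite -em -el !intpartn_sumn em el -natr1; field; exact: two_neq0.
Qed.

End JackStructure.

(** * The specialization, its kernel and the norm *)

Section JackNorm.
Variables (F : fieldType) (k : nat) (a : F).
Hypothesis gen_a : generic a.
Variable J : forall n : nat, intpartn n -> {ffun intpartn n -> F}.
Hypothesis hJ : is_jack a J.
Notation K := k.+1.
Notation P := {mpoly F[K]}.
Notation jackP := (jackP k J).
Implicit Types (s u : seq nat) (d : nat) (t : F) (f : P).

Notation norm lam := (pdot a (jackP lam) (jackP lam)).

Lemma whomog0 f : f \is 0.-homog for (@mnmwgt K) -> f = (f@_0%MM)%:MP.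
Proof.
move=> /whomogP f0; apply/mpolyP => m; rewrite mcoeffC.
case: (eqVneq m 0%MM) => [->|m0]; rewrite ?mulr1 // mulr0.
apply/memN_msupp_eq0/negP => /f0/eqP; apply/negP; apply: contra m0 => /eqP w0.
by rewrite -mdeg_eq0 -leqn0 -w0 leq_mdeg_mnmwgt.
Qed.

Lemma intpartn0 (lam : intpartn 0) : lam = [::] :> seq nat.
Proof. by apply/eqP; rewrite -size_eq0 -leqn0 size_intpartn. Qed.

Lemma content_prod_nil t : content_prod a t [::] = 1.
Proof. by rewrite /content_prod big_ord0. Qed.

Definition p1coef d f : F := f@_(U_(ord0) *+ d)%MM.

Lemma pval_sum t d (c : intpartn d -> F) :
  pval t (\sum_(mu : intpartn d) c mu *: jackP mu) =
  \sum_(mu : intpartn d) c mu * pval t (jackP mu).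
Proof. by rewrite /pval raddf_sum; apply: eq_bigr => mu _; rewrite /= mevalZ. Qed.

(** The specialization and the coefficient of [p_1 ^ d] both satisfy a recursion over the expansion
    of [d/dp_1 J_lam], the former through [pval_weuler] and [pdot_lower]; [lower_content_prod]
    matches the two term by term. *)
Lemma pval_jackP_aux t d (lam : intpartn d) : (d <= K)%N ->
  pval t (jackP lam) = p1coef d (jackP lam) * content_prod a t lam.
Proof.
elim: d lam => [|d IH] lam dK.
  have := whomog0 (jackP_whomog J lam dK); rewrite /pval /p1coef mulm0n => {1}->.
  by rewrite mevalC intpartn0 content_prod_nil mulr1.
have hl := jackP_whomog J lam dK.
have hd := whomog_mderiv0 hl.
have hE : t *: (jackP lam)^`M(ord0) + plower (jackP lam) \is d.-homog for (@mnmwgt K).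
  by rewrite rpredD ?rpredZ // (plower_whomog gen_a hl).
apply: (mulfI (natr_neq0 gen_a (ltn0Sn d))).
rewrite -(pval_weuler t hl) (jackP_expand gen_a hJ (ltnW dK) hE) pval_sum.
pose B (mu : intpartn d) := pdot a (jackP lam)^`M(ord0) (jackP mu).
have xE : d.+1%:R * p1coef d.+1 (jackP lam)
    = \sum_(mu : intpartn d) B mu / norm mu * p1coef d (jackP mu).
  have := congr1 (p1coef d) (jackP_expand gen_a hJ (ltnW dK) hd).
  rewrite {1}/p1coef mcoeff_deriv -mulmSr mulmnE mnm1E eqxx mul1n => e.
  rewrite mulr_natl; apply: etrans e _.
  by rewrite /p1coef raddf_sum; apply: eq_bigr => mu _; rewrite /= mcoeffZ.
rewrite mulrA xE mulr_suml; apply: eq_bigr => mu _.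
rewrite (pdot_lower gen_a hJ) // -/(B mu) IH ?(ltnW dK) //.
have [B0|nz] := eqVneq (B mu) 0; first by rewrite B0 !(mulr0, mul0r).
rewrite (lower_content_prod gen_a hJ dK nz t); ring.
Qed.

Lemma evN_ones N f : (evN N f).@[fun=> 1] = pval N%:R f.
Proof.
rewrite /evN comp_mpoly_meval; apply: meval_eq => i; rewrite tnth_mktuple.
rewrite /psum_mpoly raddf_sum /= (eq_bigr (fun=> 1)) => [|j _].
  by rewrite sumr_const card_ord.
by rewrite rmorphXn /= mevalXU expr1n.
Qed.

Lemma content_prod_size_neq0 s : content_prod a (size s)%:R s != 0.
Proof.
apply/prodf_neq0 => i _; apply/prodf_neq0 => j _.
rewrite addrAC -natrB; last by apply: ltnW.
by rewrite addrC (generic_neq0 gen_a) // addn_gt0 subn_gt0 ltn_ord orbT.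
Qed.

(* Strip the first column, in [size lam] variables, and evaluate at
   [(1, ..., 1)]. *)
Lemma p1coef_jackP d (lam : intpartn d) : (d <= K)%N -> p1coef d (jackP lam) = 1.
Proof.
have [n] := ubnP d; elim: n d lam => // n IH d lam; rewrite ltnS => dn dK.
case: (posnP d) => [d0|d0].
  move: d0 lam dK {dn} => -> lam dK.
  have := jackP_lead hJ (N := 0) (lam := lam) dK; rewrite intpartn0 => /(_ isT).
  have := whomog0 (jackP_whomog J lam dK); rewrite intpartn0 => e.
  rewrite {1}e /evN comp_mpolyC mcoeffC (_ : mpart 0 [::] = 0%MM); last first.
    by apply/mnmP; case.
  by rewrite eqxx mulr1 /hook big_ord0 /p1coef mulm0n.
have l0 : (0 < size lam)%N.
  by case: (val lam) (intpartn_sumn lam) d0 => //= <-.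
have lp := intpartn_part lam.
have := @jackP_strip F k a gen_a J hJ _ lp; rewrite intpartn_sumn => /(_ dK).
move=> /(congr1 (fun g : {mpoly F[size lam]} => g.@[fun=> 1])).
rewrite /= !mevalZ mevalM mevalX big1 ?mul1r => [|i _]; last by rewrite expr1n.
rewrite !evN_ones.
have sl := sumn_strip lp; rewrite intpartn_sumn in sl.
have [mu em] := mk_intpartn (strip_part lp) (erefl (sumn (strip lam))).
have muK : (sumn (strip lam) <= K)%N by lia.
have := pval_jackP_aux (size lam)%:R mu muK; rewrite IH ?mul1r; [|lia|lia].
rewrite em => ->; rewrite pval_jackP_aux // hook_content_prod // => e.
have nz : hook a (strip lam) * content_prod a (size lam)%:R lam != 0.
  by rewrite mulf_neq0 ?content_prod_size_neq0 // (hook_neq0 gen_a).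
by apply: (mulIf nz); rewrite mul1r -[RHS]e; ring.
Qed.

Lemma pval_jackP t d (lam : intpartn d) : (d <= K)%N ->
  pval t (jackP lam) = content_prod a t lam.
Proof. by move=> dK; rewrite pval_jackP_aux // p1coef_jackP // mul1r. Qed.

(* The element representing the functional [pval t] on degree [d]; in [N]
   variables it is the degree [d] part of [\prod_i (1 - x_i) ^ (- t / a)]. *)
Definition kernelP d t : P :=
  \sum_(kap : intpartn d) (content_prod a t kap / norm kap) *: jackP kap.

Lemma kernelP_whomog d t : (d <= K)%N -> kernelP d t \is d.-homog for (@mnmwgt K).
Proof.
by move=> dK; apply: rpred_sum => kap _; rewrite rpredZ // jackP_whomog.
Qed.

Lemma pdot_kernelP d t f : (d <= K)%N -> f \is d.-homog for (@mnmwgt K) ->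
  pdot a (kernelP d t) f = pval t f.
Proof.
move=> dK /(jackP_span gen_a hJ dK)[c ->].
rewrite pdot_sumr pval_sum; apply: eq_bigr => mu _.
rewrite pdotZr (pdot_jackP_sum hJ) // divfK ?(jackP_norm_neq0 gen_a hJ) //.
by rewrite pval_jackP.
Qed.

Lemma pdot_jackP_ext d f (g : P) : (d <= K)%N -> f \is d.-homog for (@mnmwgt K) ->
  g \is d.-homog for (@mnmwgt K) ->
  (forall mu : intpartn d, pdot a f (jackP mu) = pdot a g (jackP mu)) -> f = g.
Proof.
move=> dK fd gd h; rewrite (jackP_expand gen_a hJ dK fd) (jackP_expand gen_a hJ dK gd).
by apply: eq_bigr => mu _; rewrite h.
Qed.

Lemma praise_whomog d f : f \is d.-homog for (@mnmwgt K) ->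
  praise f \is d.+1.-homog for (@mnmwgt K).
Proof.
move=> fd; have nz : 2%:R * a != 0 by rewrite mulf_neq0 ?(two_neq0 gen_a) ?(a_neq0 gen_a).
have -> : praise f = (2%:R * a)^-1 *: (lapl a ('X_ord0 * f) - 'X_ord0 * lapl a f).
  by rewrite lapl_mulX0 addrC addKr scalerA mulVf // scale1r.
rewrite rpredZ // rpredB //; first exact: lapl_whomog (whomog_mulX _ fd).
exact: whomog_mulX (lapl_whomog _ fd).
Qed.

(** Dual to [pval_weuler]: the adjoints of [t d/dp_1] and [plower] are [(t / a) p_1] and
    [praise]. *)
Lemma kernelP_rec d t : (d < K)%N ->
  d.+1%:R *: kernelP d.+1 t
  = praise (kernelP d t) + (t / a) *: ('X_ord0 * kernelP d t).
Proof.
move=> dK; have hk := kernelP_whomog t (ltnW dK).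
apply: (pdot_jackP_ext dK).
- by rewrite rpredZ // kernelP_whomog.
- by rewrite rpredD ?praise_whomog // rpredZ //; apply: whomog_mulX.
move=> mu; have hmu := jackP_whomog J mu dK.
rewrite pdotZl pdot_kernelP // pdotDl pdotZl pdot_mulXl pdot_praise mulr1.
rewrite mulrA divfK ?(a_neq0 gen_a) // -pdotZr -pdotDr addrC pdot_kernelP ?(ltnW dK) //.
  by rewrite (pval_weuler t hmu).
by rewrite rpredD ?(plower_whomog gen_a hmu) // rpredZ // whomog_mderiv0.
Qed.

(** The coefficient of [x ^ m] in [(1 - x) ^ M]. *)
Definition sbin M (m : nat) : F := (-1) ^+ m * 'C(M, m)%:R.

Lemma sbin_rec M m : (m%:R - M%:R) * sbin M m = m.+1%:R * sbin M m.+1.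
Proof.
have h : m.+1%:R * 'C(M, m.+1)%:R = (M%:R - m%:R) * 'C(M, m)%:R :> F.
  rewrite -natrM mul_bin_left natrM; case: (leqP m M) => mM; first by rewrite natrB.
  by rewrite bin_small // !mulr0.
have -> : m.+1%:R * sbin M m.+1 = - (-1) ^+ m * (m.+1%:R * 'C(M, m.+1)%:R).
  by rewrite /sbin exprS; ring.
by rewrite h /sbin; ring.
Qed.

Lemma mcoeff_mulXi N (i : 'I_N) (g : {mpoly F[N]}) m :
  ('X_i * g)@_m = if m i == 0%N then 0 else g@_(m - U_(i)).
Proof.
case: eqP => [mi|/eqP mi].
  rewrite mulrC; apply/memN_msupp_eq0; rewrite (perm_mem (msuppMX _ _)).
  apply/mapP => -[m' _ e]; move: mi; rewrite e mnmDE mnm1E eqxx; lia.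
rewrite mulrC -{1}(submK (m := U_(i)) (m' := m)) ?lep1mP //.
by rewrite addmC mcoeffMX.
Qed.

(** At [t = - M a], [kernelP_rec] says that [d + 1] times the kernel of degree [d + 1] is
    [\sum_i (x_i^2 d/dx_i - M x_i)] applied to the one of degree [d]; on coefficients, [sbin_rec]
    solves this variable by variable. *)
Lemma mcoeff_evN_kernelP N M d (m : 'X_{1..N}) : (d <= K)%N -> mdeg m = d ->
  (evN N (kernelP d (- (M%:R * a))))@_m = \prod_(i < N) sbin M (m i).
Proof.
set t := - (M%:R * a); elim: d m => [|d IH] m dK md.
  move/eqP: md; rewrite mdeg_eq0 => /eqP ->.
  have e := whomog0 (kernelP_whomog t dK).
  have e1 := @pdot_kernelP 0 t 1 dK (dhomog1 _ _).
  have pw0 : pweight a (0%MM : 'X_{1..K}) = 1.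
    by rewrite /pweight big1 // => i _; rewrite mnm0E expr0 mul1r.
  rewrite {1}e -alg_mpolyC pdotZl -mpolyX0 pdotX mpolyX0 mcoeff1 eqxx pw0 !mulr1 in e1.
  rewrite e e1 /pval meval1 /evN comp_mpolyC mcoeffC eqxx mulr1 big1 // => i _.
  by rewrite mnm0E /sbin bin0 mulr1.
have nz := natr_neq0 gen_a (ltn0Sn d).
apply: (mulfI nz); rewrite -mcoeffZ -evNZ kernelP_rec // evND evNZ evNM evNX.
rewrite -(@sum_X2_mderiv_evN _ _ N _ d) ?kernelP_whomog ?(ltnW dK) //.
have -> : t / a = - M%:R by rewrite /t mulNr mulfK // (a_neq0 gen_a).
rewrite /psum_mpoly mulr_suml scaler_sumr -big_split raddf_sum /= -md mdegE natr_sum mulr_suml.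
apply: eq_bigr => i _; rewrite mcoeffD mcoeffZ expr1 expr2 -mulrA !mcoeff_mulXi.
case: eqP => [->|/eqP mi]; first by rewrite mulr0 addr0 mul0r.
have mi0 : (0 < m i)%N by rewrite lt0n.
set m' := (m - U_(i))%MM.
have m'i : m' i = (m i).-1 by rewrite mnmBE mnm1E eqxx subn1.
have em : (m' + U_(i))%MM = m by rewrite submK // lep1mP.
have hm' : mdeg m' = d.
  by apply/eqP; have := mdegD m' U_(i); rewrite em mdeg1 md addn1 => -[->].
have -> : (if m' i == 0%N then 0
   else ((evN N (kernelP d t))^`M(i))@_(m' - U_(i))) = (m' i)%:R * (evN N (kernelP d t))@_m'.
  case: eqP => [->|/eqP m'i0]; first by rewrite mul0r.
  rewrite mcoeff_deriv submK ?lep1mP // mnmBE mnm1E eqxx subn1 prednK ?lt0n //.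
  by rewrite mulr_natl.
rewrite -mulrDl IH ?(ltnW dK) // (bigD1 i) //= [in RHS](bigD1 i) //= [LHS]mulrA [RHS]mulrA.
congr (_ * _); first by rewrite m'i sbin_rec prednK.
by apply: eq_bigr => j /negPf ji; rewrite mnmBE mnm1E eq_sym ji subn0.
Qed.

Lemma xtop_kernelP N M d : (M + d <= K)%N ->
  xtop M (evN N.+1 (kernelP (M + d) (- (M%:R * a))))
  = (-1) ^+ M *: evN N (kernelP d (- (M%:R * a))).
Proof.
move=> dK; have dK' : (d <= K)%N by apply: leq_trans dK; rewrite leq_addl.
have hom e N' : (e <= K)%N -> evN N' (kernelP e (- (M%:R * a))) \is e.-homog.
  move=> eK; rewrite evN_sum; apply: rpred_sum => mu _.
  by rewrite evNZ rpredZ // (jackP_homog hJ).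
apply/mpolyP => m; rewrite mcoeff_xtop mcoeffZ.
case: (eqVneq (mdeg m) d) => md; last first.
  rewrite (dhomog_nemf_coeff (hom _ _ dK)); last by rewrite /= mdeg_mnm_cons eqn_add2l.
  by rewrite (dhomog_nemf_coeff (hom _ _ dK')) // mulr0.
rewrite !mcoeff_evN_kernelP //; last by rewrite mdeg_mnm_cons md.
rewrite big_ord_recl mnm_cons0 /sbin binn mulr1; congr (_ * _).
by apply: eq_bigr => i _; rewrite mnm_consS.
Qed.

(** Compare the coefficients of [x_0 ^ M] in the kernel at [t = - M a]. A first part above [M] puts
    a factor 0 into the content product, one below [M] excludes [x_0 ^ M], and for the rest
    [jackP_top] removes the first row. The component along [J_mu] relates the two norms, and
    [content_prod_top] trades content products for [hook']. *)
Lemma jackP_norm_top M d (lam : intpartn (M + d)) (mu : intpartn d) : (M + d <= K)%N ->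
  lam = M :: mu :> seq nat ->
  norm lam / (hook a lam * hook' a lam) = norm mu / (hook a mu * hook' a mu).
Proof.
move=> dK el; have dK' : (d <= K)%N by apply: leq_trans dK; rewrite leq_addl.
pose t := - (M%:R * a).
have hdE (kap : intpartn (M + d)) : (head 0%N kap == M) -> (0 < M)%N ->
    kap = M :: behead kap :> seq nat.
  by case: (intpartn_val kap) => [|x v] /= /eqP <-.
have M0 : (0 < M)%N.
  by have := intpartn_part lam; rewrite el => /part_consP[].
pose c (kap : intpartn (M + d)) :=
  content_prod a t kap / norm kap * (hook a kap / hook a (behead kap)).
have bh (kap : intpartn (M + d)) : (head 0%N kap == M) ->
    exists2 kap' : intpartn d, kap' = behead kap :> seq nat & True.
  move=> /hdE/(_ M0) ek; have := intpartn_part kap; rewrite ek => /part_consP[_ kp _].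
  have [|kap' e'] := @mk_intpartn (behead kap) d kp.
    by have := intpartn_sumn kap; rewrite ek /= => /addnI.
  by exists kap'.
pose f : P := \sum_(kap : intpartn (M + d) | head 0%N kap == M) c kap *: jackP (behead kap)
  - (-1) ^+ M *: kernelP d t.
have hf : f \is d.-homog for (@mnmwgt K).
  rewrite rpredB // ?rpredZ ?kernelP_whomog //; apply: rpred_sum => kap /bh[kap' <- _].
  by rewrite rpredZ // jackP_whomog.
have f0 : evN d f = 0.
  rewrite /f evND -scaleN1r !evNZ scaleN1r -xtop_kernelP // /kernelP !evN_sum.
  apply/eqP; rewrite subr_eq0 [xtop M _]linear_sum /= [X in _ == X](bigID (fun kap : intpartn (M + d) => head 0%N kap == M)) /=.
  rewrite [X in _ + X]big1 ?addr0 => [|kap kM].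
    apply/eqP; apply: eq_bigr => kap kM; rewrite !evNZ linearZ /= /c -scalerA; congr (_ *: _).
    have ek := hdE _ kM M0.
    apply: (scalerI (hook_neq0 gen_a (behead kap))).
    have := @jackP_top F k a gen_a J hJ d M (behead kap); rewrite -ek.
    rewrite intpartn_sumn => /(_ (intpartn_part _) dK) ->.
    by rewrite scalerA mulrCA divff ?mulr1 // (hook_neq0 gen_a).
  rewrite evNZ linearZ /=; case: (ltngtP (head 0%N kap) M) kM => // h _.
    by rewrite (jackP_top0 hJ) ?scaler0 ?intpartn_part ?intpartn_sumn.
  by rewrite content_prod_big // mul0r scale0r.
have := pdot_evN0 gen_a hJ dK' hf f0 (size_intpartn mu).
rewrite /f -scaleN1r pdotDl !pdotZl pdot_kernelP ?jackP_whomog // pval_jackP //.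
rewrite pdot_suml (bigD1 lam) /=; last by rewrite el.
rewrite big1 ?addr0 => [|kap /andP[kM ne]]; last first.
  have [kap' ek _] := bh kap kM; rewrite pdotZl -ek (jackP_orth hJ) ?mulr0 //.
  apply: contraNneq ne => e'; apply/eqP/val_inj => /=.
  by rewrite (hdE _ kM M0) -ek e' el.
rewrite /c el /= pdotZl -el mulN1r => /eqP; rewrite subr_eq0 => /eqP e.
have := @content_prod_top F a M mu; rewrite -el => /(_ (intpartn_part _)) e2.
have nl := jackP_norm_neq0 gen_a hJ lam dK; have nm := jackP_norm_neq0 gen_a hJ mu dK'.
have h1 := hook_neq0 gen_a lam; have h2 := hook_neq0 gen_a mu.
have h3 := hook'_neq0 gen_a lam; have h4 := hook'_neq0 gen_a mu.
have cz : content_prod a t mu != 0.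
  have mp := intpartn_part lam; rewrite el in mp; have [_ _ le] := part_consP mp.
  apply/prodf_neq0 => i _; apply/prodf_neq0 => j _.
  have jM : (j < M)%N by apply: leq_trans (ltn_ord j) _; apply/le/mem_nth.
  have -> : t + a * j%:R - i%:R = - (a * (M - j)%:R + i%:R).
    by rewrite /t natrB ?(ltnW jM) //; ring.
  by rewrite oppr_eq0 (generic_neq0 gen_a) // addn_gt0 subn_gt0 jM.
have s0 : (-1) ^+ M != 0 :> F by rewrite expf_neq0 // oppr_eq0 oner_eq0.
have key : norm lam * (hook a mu * hook' a mu) = norm mu * (hook a lam * hook' a lam).
  apply: (mulfI (mulf_neq0 s0 cz)).
  have -> : (-1) ^+ M * content_prod a t mu * (norm lam * (hook a mu * hook' a mu))
    = ((-1) ^+ M * content_prod a t mu) * norm lam * hook a mu * hook' a mu by ring.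
  rewrite -[in LHS]e; have -> : content_prod a t lam / norm lam * (hook a lam / hook a mu) * norm mu * norm lam * hook a mu * hook' a mu
   = (content_prod a t lam * hook' a mu) * hook a lam * norm mu.
    by field; rewrite nl h2.
  by rewrite e2 -/t; ring.
apply/eqP; rewrite eqr_div ?mulf_neq0 //; apply/eqP; rewrite key; ring.
Qed.

Lemma jackP_norm d (lam : intpartn d) : (d <= K)%N ->
  norm lam = hook a lam * hook' a lam.
Proof.
move=> dK; apply/eqP; rewrite -subr_eq0; apply/eqP.
have nz (s : seq nat) : hook a s * hook' a s != 0.
  by rewrite mulf_neq0 ?(hook_neq0 gen_a) ?(hook'_neq0 gen_a).
suff : norm lam / (hook a lam * hook' a lam) = 1.
  by move=> /(canRL (divfK (nz lam))) ->; rewrite mul1r subrr.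
have [n] := ubnP d; elim: n d lam dK => // n IH d lam dK; rewrite ltnS => dn.
case e1 : (intpartn_val lam) => [|M u].
  have d0 : d = 0%N by rewrite -(intpartn_sumn lam) e1.
  move: lam dK {dn e1}; rewrite d0 => lam dK.
  have := whomog0 (jackP_whomog J lam dK); have := p1coef_jackP lam dK.
  rewrite /p1coef mulm0n => ->; rewrite intpartn0 => ->; rewrite mpolyC1 -mpolyX0 pdotX mpolyX0 mcoeff1 eqxx.
  rewrite /pweight big1 => [|i _]; last by rewrite mnm0E expr0 mul1r.
  by rewrite /hook /hook' !big_ord0 !mulr1 divr1.
have sp := intpartn_part lam; have sd := intpartn_sumn lam.
rewrite e1 in sp sd; have [M0 up _] := part_consP sp.
have [mu em] := mk_intpartn up (erefl (sumn u)).
have ed : d = (M + sumn u)%N by rewrite -sd.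
move: lam dK dn e1; rewrite ed => lam dK dn e1.
rewrite -e1 (@jackP_norm_top M _ lam mu) //; last by rewrite e1 em.
apply: IH; first by apply: leq_trans dK; rewrite leq_addl.
by apply: leq_trans dn; rewrite -add1n leq_add2r.
Qed.

End JackNorm.

(** * Joins and cuts *)

Section PathCount.
Variables (F : fieldType) (k : nat) (a : F) (n : nat).
Hypothesis two0 : 2%:R != 0 :> F.
Notation K := k.+1.
Notation P := {mpoly F[K]}.
Implicit Types (f : P) (m : 'X_{1..K}) (v w : F) (r : nat).

Definition nneg_poly (p : {poly int}) : Prop := forall i, 0 <= p`_i.

(* [v] is the coefficient at [m] of an [r]-fold application of half the
   Laplacian to [p_1 ^ n].  A join costs a factor [a], a cut a factor 1, and
   there are [n - mdeg m] more joins than cuts, so that [a ^ (mdeg m - n)]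
   leaves a factor [a = 1 + (a - 1)] for each cut and [a - 1] for each loop. *)
Definition path_weight r m v : Prop := exists p : {poly int},
  [/\ nneg_poly p, (size p <= r.+1 - (n - mdeg m))%N
    & a ^+ mdeg m * v = a ^+ n * (map_poly intr p).[a - 1]].

Lemma path_weight0 r m : path_weight r m 0.
Proof.
exists 0; split; first by move=> i; rewrite coef0.
  by rewrite size_poly0.
by rewrite rmorph0 horner0 !mulr0.
Qed.

Lemma path_weightD r m v w :
  path_weight r m v -> path_weight r m w -> path_weight r m (v + w).
Proof.
move=> [p [p0 sp ep]] [q [q0 sq eq]]; exists (p + q); split.
- by move=> i; rewrite coefD addr_ge0.
- by apply: leq_trans (size_polyD _ _) _; rewrite geq_max sp sq.
- by rewrite rmorphD hornerD !mulrDr ep eq.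
Qed.

Lemma path_weight_sum r m (I : Type) (s : seq I) (Q : pred I) (v : I -> F) :
  (forall i, Q i -> path_weight r m (v i)) ->
  path_weight r m (\sum_(i <- s | Q i) v i).
Proof.
move=> h; elim/big_ind: _ => //; first exact: path_weight0.
exact: path_weightD.
Qed.

Lemma path_weight_nat r m c v : path_weight r m v -> path_weight r m (c%:R * v).
Proof.
move=> h; rewrite mulr_natl -[c]card_ord -sumr_const.
by apply: path_weight_sum.
Qed.

Lemma path_weight_loop r m v : path_weight r m v -> path_weight r.+1 m ((a - 1) * v).
Proof.
move=> [p [p0 sp ep]]; exists (p * 'X); split.
- by move=> [|i]; rewrite coefMX /= ?p0.
- have [->|pz] := eqVneq p 0; first by rewrite mul0r size_poly0.
  by rewrite size_mulX //; move: pz; rewrite -size_poly_gt0; lia.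
- by rewrite rmorphM /= map_polyX hornerMX mulrCA ep; ring.
Qed.

Lemma path_weight_join r m m' v : mdeg m' = (mdeg m).+1 ->
  path_weight r m' v -> path_weight r.+1 m (a * v).
Proof.
move=> dm [p [p0 sp ep]]; exists p; split=> //; first by rewrite dm in sp; lia.
by rewrite -ep dm exprSr mulrA.
Qed.

Lemma path_weight_cut r m m' v : mdeg m = (mdeg m').+1 ->
  path_weight r m' v -> path_weight r.+1 m v.
Proof.
move=> dm [p [p0 sp ep]]; exists (p * 'X + p); split.
- by move=> [|i]; rewrite coefD coefMX /= ?add0r ?addr_ge0 ?p0.
- have [->|pz] := eqVneq p 0; first by rewrite mul0r addr0 size_poly0.
  apply: leq_trans (size_polyD _ _) _; rewrite geq_max size_mulX //.
  by move: pz; rewrite -size_poly_gt0 dm; lia.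
- rewrite rmorphD rmorphM /= map_polyX hornerD hornerMX dm exprS -mulrA ep; ring.
Qed.

(** For [i = j] the multiplicity counts ordered pairs of equal parts; its evenness pays for the
    factor one half in [lapl_half]. *)
Lemma mcoeff_join i j l f m : exists c m',
  [/\ ('X_l * f^`M(i)^`M(j))@_m = (c * f@_m')%R,
      c = 0 \/ mdeg m' = (mdeg m).+1
    & exists2 e : nat, c = e%:R & i = j -> exists e', e = (2 * e')%N].
Proof.
rewrite mcoeff_mulXi; case: eqP => [_|/eqP ml].
  by exists 0, m; split; [rewrite mul0r|left|exists 0%N => // _; exists 0%N].
set m1 := (m - U_(l))%MM.
exists ((m1 j).+1 * ((m1 + U_(j))%MM i).+1)%:R, (m1 + U_(j) + U_(i))%MM; split.
- by rewrite !mcoeff_deriv -mulrnA mulr_natl mulnC.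
- right; rewrite !mdegD !mdeg1 !addn1; congr _.+1.
  have := mdegD m1 U_(l); rewrite /m1 submK ?lep1mP // mdeg1 addn1 => ->.
  by [].
exists ((m1 j).+1 * ((m1 + U_(j))%MM i).+1)%N => // ->.
rewrite mnmDE mnm1E eqxx addn1; exists ('C((m1 j).+2, 2)).
have := mul_bin_diag (m1 j).+2 1; rewrite bin1 /= => <-; exact: mulnC.
Qed.

Lemma mcoeff_cut i j l f m : exists c m',
  [/\ ('X_i * 'X_j * f^`M(l))@_m = (c * f@_m')%R,
      c = 0 \/ mdeg m = (mdeg m').+1 & exists e : nat, c = e%:R].
Proof.
rewrite -mulrA mcoeff_mulXi; case: eqP => [_|/eqP mi].
  by exists 0, m; split; [rewrite mul0r|left|exists 0%N].
set m1 := (m - U_(i))%MM; rewrite mcoeff_mulXi; case: eqP => [_|/eqP mj].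
  by exists 0, m; split; [rewrite mul0r|left|exists 0%N].
set m2 := (m1 - U_(j))%MM.
exists (m2 l).+1%:R, (m2 + U_(l))%MM; split; last by exists (m2 l).+1.
- by rewrite mcoeff_deriv mulr_natl.
right; rewrite mdegD mdeg1 addn1.
have := mdegD m1 U_(i); rewrite {1}/m1 submK ?lep1mP // mdeg1 addn1 => ->.
by have := mdegD m2 U_(j); rewrite {1}/m2 submK ?lep1mP // mdeg1 addn1 => ->.
Qed.

Lemma half_double v : 2%:R^-1 * (v *+ 2) = v.
Proof. by rewrite -[v *+ 2]mulr_natl mulrA mulVf // mul1r. Qed.

Definition lapl_half f : P := 2%:R^-1 *: lapl a f.

(** All multiplicities remain natural after halving: off the diagonal every unordered pair is met
    twice; on it a join has an even coefficient and a cut carries [l + 1 = 2 (i + 1)]; a loop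
    carries the binomial [i (i + 1) / 2]. *)
Lemma path_weight_lapl r f : (forall m, path_weight r m f@_m) ->
  forall m, path_weight r.+1 m (lapl_half f)@_m.
Proof.
move=> fw m; rewrite mcoeffZ /lapl mcoeffD mcoeffZ mulrDr; apply: path_weightD.
  rewrite mulrCA raddf_sum /= mulr_sumr; apply: path_weight_loop.
  apply: path_weight_sum => i _; rewrite mcoeffZ mulrA.
  have -> : 2%:R^-1 * (i.+1 * i)%:R = 'C(i.+1, 2)%:R :> F.
    have := mul_bin_diag i.+1 1; rewrite bin1 /= => ->.
    by rewrite natrM mulrA mulVf // mul1r.
  apply: path_weight_nat; rewrite mcoeff_mulXi; case: eqP => [_|/eqP mi]; first exact: path_weight0.
  rewrite mcoeff_deriv submK ?lep1mP // -mulr_natl; exact: path_weight_nat.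
pose T (i j : 'I_K) := \sum_(l < K | l == (i + j).+1 :> nat)
   (a * ((i.+1 * j.+1)%:R * ('X_l * f^`M(i)^`M(j))@_m)
    + l.+1%:R * ('X_i * 'X_j * f^`M(l))@_m).
have -> : (\sum_(i < K) \sum_(j < K) \sum_(l < K | l == (i + j).+1 :> nat)
      ((a * (i.+1 * j.+1)%:R) *: ('X_l * f^`M(i)^`M(j))
       + l.+1%:R *: ('X_i * 'X_j * f^`M(l))))@_m
    = \sum_(i < K) \sum_(j < K) T i j.
  rewrite raddf_sum; apply: eq_bigr => i _ /=; rewrite raddf_sum; apply: eq_bigr => j _ /=.
  rewrite raddf_sum; apply: eq_bigr => l _ /=.
  by rewrite mcoeffD !mcoeffZ mulrA.
rewrite sum_symm => [|i j]; last first.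
  rewrite /T addnC; apply: eq_bigr => l _.
  by rewrite mderiv_comm mulnC ['X_i * 'X_j]mulrC.
rewrite mulrDr half_double; apply: path_weightD; last first.
  apply: path_weight_sum => i _; apply: path_weight_sum => j _.
  apply: path_weight_sum => l _; apply: path_weightD.
    have [c [m' [-> cm [e ec _]]]] := mcoeff_join i j l f m.
    rewrite {}ec in cm *; case: cm => [->|dm].
      rewrite mul0r !mulr0; exact: path_weight0.
    by apply: (path_weight_join dm); do 2!apply: path_weight_nat.
  have [c [m' [-> cm [e ec]]]] := mcoeff_cut i j l f m.
  rewrite {}ec in cm *; case: cm => [->|dm].
    rewrite mul0r mulr0; exact: path_weight0.
  by apply: (path_weight_cut dm); do 2!apply: path_weight_nat.
rewrite mulr_sumr; apply: path_weight_sum => i _.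
rewrite /T mulr_sumr; apply: path_weight_sum => l /eqP el; rewrite mulrDr.
apply: path_weightD.
  have [c [m' [-> cm [e ec he]]]] := mcoeff_join i i l f m.
  have [e' ee] := he erefl; rewrite {}ec {}ee in cm *; case: cm => [->|dm].
    rewrite mul0r !mulr0; exact: path_weight0.
  rewrite mulrCA; apply: (path_weight_join dm).
  have -> : 2%:R^-1 * ((i.+1 * i.+1)%:R * ((2 * e')%:R * f@_m'))
      = (i.+1 * i.+1)%:R * (e'%:R * f@_m').
    by rewrite (natrM _ 2 e'); field.
  by do 2!apply: path_weight_nat.
have [c [m' [-> cm [e ec]]]] := mcoeff_cut i i l f m.
rewrite {}ec in cm *; case: cm => [->|dm].
  rewrite mul0r !mulr0; exact: path_weight0.
have -> : l.+1 = (2 * i.+1)%N by rewrite el; lia.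
have -> : 2%:R^-1 * ((2 * i.+1)%:R * (e%:R * f@_m')) = i.+1%:R * (e%:R * f@_m').
  by rewrite (natrM _ 2 i.+1); field.
by apply: (path_weight_cut dm); do 2!apply: path_weight_nat.
Qed.

Lemma path_weight_iter r : forall m,
  path_weight r m (iter r lapl_half 'X_[U_(ord0) *+ n])@_m.
Proof.
elim: r => [|r IH] m; last exact: path_weight_lapl.
rewrite /= mcoeffX; case: eqP => [<-|_]; last exact: path_weight0.
exists 1; split.
- by move=> [|i]; rewrite coef1.
- by rewrite size_poly1 mdegMn mdeg1 mul1n subnn.
- have -> : map_poly intr (1 : {poly int}) = 1 :> {poly F} by apply: rmorph1.
  by rewrite -polyC1 hornerC mdegMn mdeg1 mul1n.
Qed.

End PathCount.

(** * The coefficients as iterates of the operator *)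

Section JackCoefficients.
Variables (F : fieldType) (k : nat) (a : F).
Hypothesis gen_a : generic a.
Variable J : forall n : nat, intpartn n -> {ffun intpartn n -> F}.
Hypothesis hJ : is_jack a J.
Notation K := k.+1.
Notation P := {mpoly F[K]}.
Notation jackP := (jackP k J).

Lemma jack_char_coef (beta mu : intpartn K) :
  jack_char J beta mu = (jackP beta)@_(pmult k mu).
Proof. by rewrite jackPE emb_coef // /jack_char valK. Qed.

(** A loop on [p_1] has coefficient 0 and a join always creates a part above 1, so a power of [p_1]
    arises only by cutting a [p_2], with coefficient 2. *)
Lemma mcoeff_lapl_p1 (f : P) n (i1 : 'I_K) : i1 = 1%N :> nat ->
  (lapl a f)@_(U_(ord0) *+ n.+2) = 2%:R * f@_(U_(i1) + U_(ord0) *+ n).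
Proof.
move=> ei1; set m := (U_(ord0) *+ n.+2)%MM.
have m0 (i : 'I_K) : i != ord0 -> m i = 0%N.
  by move=> /negPf i0; rewrite mulmnE mnm1E eq_sym i0 mul0n.
have mX (i : 'I_K) (g : P) : i != ord0 -> ('X_i * g)@_m = 0.
  by move=> /m0 mi; rewrite mcoeff_mulXi mi.
rewrite /lapl mcoeffD mcoeffZ [X in _ * X]raddf_sum big1 /= ?mulr0 ?add0r => [|i _]; last first.
  rewrite mcoeffZ; case: (eqVneq i ord0) => [->|/mX ->]; last by rewrite mulr0.
  by rewrite muln0 mul0r.
rewrite raddf_sum (bigD1 ord0) //= [X in _ + X]big1 ?addr0 => [|i i0]; last first.
  rewrite raddf_sum big1 // => j _ /=; rewrite raddf_sum big1 // => l /eqP el /=.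
  have l0 : l != ord0 by apply/eqP => e; rewrite e in el.
  by rewrite mcoeffD !mcoeffZ -['X_i * _ * _]mulrA !mX // !mulr0 addr0.
rewrite raddf_sum (bigD1 ord0) //= [X in _ + X]big1 ?addr0 => [|j j0]; last first.
  rewrite raddf_sum big1 // => l /eqP el /=.
  have l0 : l != ord0 by apply/eqP => e; rewrite e in el.
  by rewrite mcoeffD !mcoeffZ ['X_ord0 * 'X_j]mulrC -['X_j * _ * _]mulrA !mX // !mulr0 addr0.
rewrite (big_pred1 i1) => [|l]; last by rewrite /= -[RHS]val_eqE /= ei1.
have i10 : i1 != ord0 by rewrite -val_eqE /= ei1.
rewrite mcoeffD !mcoeffZ mX // mulr0 add0r ei1 -['X_ord0 * _ * _]mulrA; congr (_ * _).
have mS j : (U_(ord0) *+ j.+1)%MM ord0 == 0%N = false :> bool.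
  by rewrite mulmnE mnm1E eqxx mul1n.
have mB j : (U_(ord0) *+ j.+1 - U_(ord0))%MM = (U_(ord0) *+ j)%MM :> 'X_{1..K}.
  by rewrite mulmS addmC addmK.
rewrite !mcoeff_mulXi mS mB mS mB mcoeff_deriv.
have -> : (U_(ord0) *+ n)%MM i1 = 0%N.
  by rewrite mulmnE mnm1E eq_sym (negPf i10) mul0n.
by rewrite mulr1n addmC.
Qed.

Lemma jack_char_rho (beta : intpartn K) : jack_char J beta (rho K) = content a beta.
Proof.
have hE : (lapl a (jackP beta))@_(U_(ord0) *+ K) = content2 a beta.
  by rewrite (lapl_jackP gen_a hJ) // mcoeffZ [_@__](p1coef_jackP gen_a hJ) ?mulr1.
case: (posnP k) => [k0|k0].
  (* For [K = 1] the character is 0 by default. The content is 0 too, since [lapl] annihilates every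
     polynomial in [p_1] alone. *)
  rewrite /jack_char insubF /=; last by rewrite /rho k0.
  rewrite /content -hE.
  have -> : lapl a (jackP beta) = 0.
    apply/mpolyP => m; rewrite mcoeff0 /lapl mcoeffD mcoeffZ !raddf_sum /= big1 => [|i _].
      rewrite mulr0 add0r big1 // => i _; rewrite raddf_sum big1 // => j _ /=.
      rewrite big_pred0 ?mcoeff0 // => l; apply/negP => /eqP e.
      by have := ltn_ord l; lia.
    have -> : i = 0%N :> nat by have := ltn_ord i; lia.
    by rewrite muln0 scale0r mcoeff0.
  by rewrite mcoeff0 mul0r.
have [n en] : exists n, k = n.+1 by case: (k) k0 => // n _; exists n.
have rp : is_part (rho K) && (sumn (rho K) == K).
  rewrite /is_part /rho en subSS subSS subn0 /=; apply/andP; split; last first.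
    by rewrite sumn_nseq mul1n.
  apply/andP; split; last by rewrite inE /= mem_nseq /= andbF.
  by case: n {en} => //= n; elim: n => //= n IH; rewrite leqnn.
have -> : rho K = IntPartn rp :> seq nat by [].
rewrite jack_char_coef /=.
have k1 : (1 < K)%N by rewrite ltnS.
have e := mcoeff_lapl_p1 (jackP beta) n (erefl : Ordinal k1 = 1%N :> nat).
have hm : (U_(ord0) *+ K)%MM = (U_(ord0) *+ n.+2)%MM :> 'X_{1..K}.
  by congr (_ *+ _)%MM; rewrite en.
have rE : rho K = 2%N :: nseq n 1%N by rewrite /rho en subSS subSS subn0.
rewrite /content -hE hm e mulrC mulrA mulVf ?(two_neq0 gen_a) // mul1r.
congr (_@__); rewrite rE; apply/mnmP => i; rewrite mnmE mnmDE mulmnE !mnm1E.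
rewrite /= count_nseq /=; congr (nat_of_bool _ + nat_of_bool _ * _)%N.
Qed.

Lemma iter_lapl_half_sum r (c : intpartn K -> F) :
  iter r (lapl_half a) (\sum_(beta : intpartn K) c beta *: jackP beta)
  = \sum_(beta : intpartn K) (c beta * content a beta ^+ r) *: jackP beta.
Proof.
elim: r => [|r IH] /=; first by apply: eq_bigr => beta _; rewrite mulr1.
rewrite IH /lapl_half linear_sum scaler_sumr; apply: eq_bigr => beta _ /=.
rewrite linearZ /= (lapl_jackP gen_a hJ) // !scalerA; congr (_ *: _).
by rewrite /content exprSr; ring.
Qed.

(** Pairing [p_1 ^ K] with [J_beta] only sees the coefficient of [p_1 ^ K] in [J_beta], which is 1.
    The coordinate of [p_1 ^ K] along [J_beta] is thus [a ^ K K!] over the norm, and each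
    application of [lapl_half] multiplies it by the character at [rho]. *)
Lemma jack_coef_lapl (lam : intpartn K) r :
  a ^+ K * (K`!%:R * jack_coef a J lam r)
  = (iter r (lapl_half a) 'X_[U_(ord0) *+ K])@_(pmult k lam).
Proof.
have hX : 'X_[F, U_(ord0) *+ K] \is K.-homog for (@mnmwgt K).
  rewrite dhomogX /= /mnmwgt big_ord_recl big1 => [|i _].
    by rewrite mulmnE mnm1E eqxx mul1n addn0 muln1.
  by rewrite mulmnE mnm1E.
have wX : pweight a (U_(ord0) *+ K : 'X_{1..K})%MM = a ^+ K * K`!%:R.
  rewrite /pweight big_ord_recl big1 => [|i _].
    by rewrite mulmnE mnm1E eqxx mul1n !mulr1.
  by rewrite mulmnE mnm1E /= mul0n expr0 mul1r.
rewrite (jackP_expand gen_a hJ (leqnn K) hX) iter_lapl_half_sum raddf_sum /=.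
rewrite /jack_coef !mulr_sumr; apply: eq_bigr => beta _.
rewrite mcoeffZ pdotX wX [_@_(_ *+ _)](p1coef_jackP gen_a hJ) // mulr1.
rewrite (jackP_norm gen_a hJ) // jack_char_rho jack_char_coef; ring.
Qed.

End JackCoefficients.

Lemma generic_alpha : generic alpha.
Proof.
have nat (A : nat) : A%:R = tofrac (A%:R%:P : {poly rat}) :> ratfun.
  by rewrite polyC_natr tofracMn tofrac1.
move=> A B A' B' /eqP; rewrite /alpha !nat -!tofracM -!tofracD tofrac_eq => /eqP e.
have := congr1 (fun p : {poly rat} => p`_0) e.
rewrite /= !coefD !coefXM /= !add0r !coefC /= => /eqP; rewrite eqr_nat => /eqP ->.
have := congr1 (fun p : {poly rat} => p`_1) e.
by rewrite /= !coefD !coefXM /= !coefC /= !addr0 => /eqP; rewrite eqr_nat => /eqP ->.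
Qed.

Theorem theorem3
  (J : forall n : nat, intpartn n -> {ffun intpartn n -> ratfun})
  (hJ : is_jack alpha J)
  (n : nat) (hn : (1 <= n)%N) (lam : intpartn n)
  (r : nat) (hr : (n - size lam < r)%N) :
  exists P : {poly int},
    [/\ forall i : nat, 0 <= P`_i,
        (size P <= (r - (n - size lam)).+1)%N
      & n`!%:R * alpha ^+ size lam * jack_coef alpha J lam r
          = (map_poly intr P).[alpha - 1]].
Proof.
(* Degree [n] only involves [p_1, ..., p_n], so [n] itself serves as the number [K] of power
   sums. *)
case: n hn lam hr => // k _ lam hr.
have gen := generic_alpha.
have [p [p0 sp ep]] := path_weight_iter alpha k.+1 (two_neq0 gen) r (pmult k lam).
have szE : mdeg (pmult k lam) = size lam.
  apply: mdeg_pmult => x; apply: part_bound; rewrite ?intpartn_sumn //.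
  exact: intpartn_part.
rewrite szE in sp ep; exists p; split=> //.
  (* Since [r] exceeds [n - size lam], the truncated difference in the size bound is a true one. *)
  by rewrite -subSn // ltnW.
apply: (mulfI (expf_neq0 k.+1 (a_neq0 gen))); rewrite -ep -(jack_coef_lapl gen hJ).
ring.
Qed.
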